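(* Let $\eta\in(0,1)$ and $\rho\ge 1$. There exist a constant $K>0$ (depending at most on $\eta,\rho$) and a constant $c>0$ (depending at most on $\eta$), both independent of $\sigma,\sigma_S,f$, of the mesh and of $N$, such that the following holds for all data $\sigma_S,\sigma_A,f$ as in the context, every mesh of diameter $h$ as in the context and every $N\ge 2$. If $h\log N\le 1$ and $$\big(h^{\eta}+h\log N+N^{-1}\big)^{-1}\ \ge\ K\,\frac{(\sigma_S)_{\max}}{(\sigma_S)_{\min}}\left(\frac{\overline{\sigma_{\max}}}{\underline{\sigma_{\min}}}\right)^{3}\overline{\|\sigma\|_{\eta,pw}}\;\mathcal R_1(\sigma,\sigma_S),$$ then $$\|\phi-\phi^{h,N}\|_\infty\ \le\ c\,\mathcal R(\sigma,\sigma_S)\,\big(N^{-1}+h\log N+h^{\eta}\big)\,\|f\|_{\eta,pw},$$ where $$\mathcal R(\sigma,\sigma_S)=\rho\,\mathcal R_4(\sigma,\sigma_S)\,\mathcal R_2(\sigma,\sigma_S)\left(\frac{\overline{\sigma_{\max}}}{\underline{\sigma_{\min}}}\right)^{2}\overline{\|\sigma\|_{\eta,pw}}\;\overline{\|\sigma_S\|_{\eta,pw}}.$$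
   Context: Spaces. For an interval $I\subset[0,1]$, $\mathrm C(I)$ is the space of uniformly continuous functions on $I$ with the sup norm $\|\cdot\|_\infty$; for $0<\xi\le1$, $\mathrm C^\xi(I)$ is the space of H\''older functions with norm $\|g\|_{\mathrm C^\xi(I)}=\|g\|_\infty+\sup_{x\neq y\in I}|g(x)-g(y)|/|x-y|^\xi$. Fix a partition $0=c_1<\dots<c_J=1$, $J\ge2$. $\mathrm C^\xi_{pw}$ is the space of $g\in L_\infty[0,1]$ with $g|_{(c_j,c_{j+1})}\in \mathrm C^\xi(c_j,c_{j+1})$ for $j=1,\dots,J-1$, the value $g(c_j)$ being the limit from the right for $j<J$ and from the left for $j=J$; its norm is $\|g\|_{\xi,pw}=\max_{1\le j\le J-1}\|g\|_{\mathrm C^\xi(c_j,c_{j+1})}$. Data. $\sigma_S,\sigma_A:[0,1]\to\mathbb R$ are bounded with positive infimum, $\sigma=\sigma_S+\sigma_A$, and $\sigma,\sigma_S,f\in \mathrm C^\eta_{pw}$. $\sigma_{\min},\sigma_{\max},(\sigma_S)_{\min},(\sigma_S)_{\max}$ are the infima and suprema of $\sigma,\sigma_S$ over $[0,1]$. For $a\in\mathbb R$: $\overline a=\max\{1,a\}$, $\underline a=\min\{a,1\}$. Exact problem. $\psi(x,\mu)$ solves $\mu\,\partial_x\psi+\sigma\psi=\sigma_S\phi+f$ for $x\in(0,1)$, $\mu\in[-1,1]$, where $\phi(x)=\frac12\int_{-1}^1\psi(x,\mu')\,d\mu'$ is the scalar flux, with $\psi(0,\mu)=0$ for $\mu>0$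 and $\psi(1,\mu)=0$ for $\mu<0$. Equivalently, $\phi$ is the unique solution of $\phi=\mathcal K(\sigma_S\phi+f)$, where $\mathcal Kg(x)=\frac12\int_0^1E_1(|\tau(x,y)|)g(y)\,dy$, $\tau(x,y)=\int_x^y\sigma(s)\,ds$ and $E_1(z)=\int_1^\infty e^{-tz}\,dt/t$. Discretisation. The mesh $0=x_0<x_1<\dots<x_M=1$ contains all the points $c_j$; $h_j=x_j-x_{j-1}$, $h=\max_jh_j$, and $h\le\rho\min_jh_j$. The double Gauss rule has nodes $\mu_k$ and weights $w_k$, $k=\pm1,\dots,\pm N$, where $\mu_1,\dots,\mu_N$, $w_1,\dots,w_N$ are the nodes and weights of the $N$-point Gauss--Legendre rule on $[0,1]$, and $\mu_{-k}=-\mu_k$, $w_{-k}=w_k$. A subscript $j-1/2$ denotes the value at the midpoint of $(x_{j-1},x_j)$. The scheme is: for $j=1,\dots,M$, $|k|=1,\dots,N$, $$\mu_k\frac{\psi_{k,j}-\psi_{k,j-1}}{h_j}+\sigma_{j-1/2}\frac{\psi_{k,j}+\psi_{k,j-1}}2=\sigma_{S,j-1/2}\,\phi_{j-1/2}+f_{j-1/2},\qquad \phi_{j-1/2}=\frac12\sum_{|k|=1}^Nw_k\frac{\psi_{k,j}+\psi_{k,j-1}}2,$$ with $\psi_{k,0}=0$ for $k>0$ and $\psi_{k,M}=0$ for $k<0$. $\phi^{h,N}$ is the continuous piecewise linear function on the mesh with nodal values $\frac12\sum_{|k|=1}^Nw_k\psi_{k,j}$ at $x_j$. Constants. $\mathcal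 R_1(\sigma,\sigma_S)=2\,\overline{\sigma_{\max}}^{1/2}\,\frac{\sigma_{\max}}{\sigma_{\min}}\,(1-\|\sigma_S/\sigma\|_\infty)^{-1}$; $\mathcal R_2(\sigma,\sigma_S)=\overline{\sigma_{\max}}^{1/2}\,(\overline{\sigma_{\max}}/\underline{\sigma_{\min}})^{3/2}\,\mathcal R_1(\sigma,\sigma_S)$; $\mathcal R_4(\sigma,\sigma_S)=\rho\,\frac{\overline{\sigma_{\max}}}{\sigma_{\min}}\,\frac{(\sigma_S)_{\max}}{(\sigma_S)_{\min}}\,\overline{(\sigma_S)_{\max}}\,\mathcal R_1(\sigma,\sigma_S)$. *)

(* Defs.v *)
(* MathComp-Analysis, over an arbitrary R : realType. *)
From HB Require Import structures.
From mathcomp Require Import all_boot all_order all_algebra.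
From mathcomp Require Import all_classical all_reals all_analysis.

Set Implicit Arguments.
Unset Strict Implicit.
Unset Printing Implicit Defensive.

Import Order.TTheory GRing.Theory Num.Theory.
Import numFieldNormedType.Exports.

Local Open Scope classical_set_scope.
Local Open Scope ring_scope.

(* Partitions of [0, 1] are given by s with [itv_partition 0 1 s]: the list s
   excludes the left end point 0 and ends at 1, so that the points are
   [pt s 0 = 0 < pt s 1 < ... < pt s (size s) = 1]. Both the partition (c_j)
   and the mesh (x_j) are of this form; c_1, ..., c_J are
   [pt cs 0, ..., pt cs (J - 1)], hence [size cs = J - 1]. *)
Definition pt {R : realType} (s : seq R) (j : nat) : R := nth 1 (0 :: s) j.

Definition cell {R : realType} (s : seq R) (j : nat) : set R :=
  `]pt s j, pt s j.+1[%classic.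

Definition step {R : realType} (s : seq R) (j : nat) : R :=
  pt s j.+1 - pt s j.

Definition diam {R : realType} (s : seq R) : R :=
  \big[Num.max/0]_(j < size s) step s j.

Definition mid {R : realType} (s : seq R) (j : nat) : R :=
  (pt s j + pt s j.+1) / 2.

(* [h <= rho * min_j h_j] *)
Definition quasi_uniform {R : realType} (rho : R) (s : seq R) : Prop :=
  forall j, (j < size s)%N -> diam s <= rho * step s j.

(* Suprema are taken in R, where [sup] is 0 on unbounded sets: [supnorm],
   [holder_norm] and [pw_norm] are the norms of the text only for functions
   that are bounded, in_holder, in_pw respectively. *)
Definition supnorm {R : realType} (I : set R) (g : R -> R) : R :=
  sup [set `|g x| | x in I].

Definition holder_quotients {R : realType} (xi : R) (I : set R) (g : R -> R) :
    set R :=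
  [set `|g p.1 - g p.2| / `|p.1 - p.2| `^ xi
     | p in [set p : R * R | [/\ I p.1, I p.2 & p.1 != p.2]]].

Definition in_holder {R : realType} (xi : R) (I : set R) (g : R -> R) : Prop :=
  [bounded g x | x in I] /\ has_ubound (holder_quotients xi I g).

Definition holder_norm {R : realType} (xi : R) (I : set R) (g : R -> R) : R :=
  supnorm I g + sup (holder_quotients xi I g).

Definition in_pw {R : realType} (cs : seq R) (xi : R) (g : R -> R) : Prop :=
  [/\ forall j, (j < size cs)%N -> in_holder xi (cell cs j) g,
      forall j, (j < size cs)%N -> g x @[x --> (pt cs j)^'+] --> g (pt cs j)
    & g x @[x --> 1^'-] --> g 1].

Definition pw_norm {R : realType} (cs : seq R) (xi : R) (g : R -> R) : R :=
  \big[Num.max/0]_(j < size cs) holder_norm xi (cell cs j) g.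

Definition minval {R : realType} (g : R -> R) : R := inf (g @` `[0, 1]).
Definition maxval {R : realType} (g : R -> R) : R := sup (g @` `[0, 1]).

Definition over1 {R : realType} (a : R) : R := Num.max 1 a.
Definition under1 {R : realType} (a : R) : R := Num.min a 1.

(* Since [inf] is 0 on a set that is not bounded below, [0 < minval g] does
   express that the infimum is positive. *)
Definition bounded_positive {R : realType} (g : R -> R) : Prop :=
  [bounded g x | x in `[0, 1]] /\ 0 < minval g.

(* E_1 takes the value +oo at z = 0, where the real-valued integral below
   returns 0; in [calK] this happens only at the single point y = x. *)
Definition E1 {R : realType} (z : R) : R :=
  \int[lebesgue_measure]_(t in `[1, +oo[) (expR (- (t * z)) / t).

Definition tau {R : realType} (sigma : R -> R) (x y : R) : R :=
  if x <= y then \int[lebesgue_measure]_(s in `[x, y]) sigma s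
  else - \int[lebesgue_measure]_(s in `[y, x]) sigma s.

Definition calK {R : realType} (sigma g : R -> R) (x : R) : R :=
  2^-1 * \int[lebesgue_measure]_(y in `[0, 1]) (E1 `|tau sigma x y| * g y).

Definition is_scalar_flux {R : realType} (sigma sigmaS f phi : R -> R) : Prop :=
  [/\ measurable_fun `[0 : R, 1]%classic phi,
      [bounded phi x | x in `[0, 1]]
    & forall x, x \in `[0, 1] ->
        phi x = calK sigma (fun y => sigmaS y * phi y + f y) x].

(* Rodrigues' formula for P_N(2x - 1) = (1/N!) (d/dx)^N (x^2 - x)^N; the
   notation [p^`N(n)] is the n-th derivative of p divided by n!. *)
Definition shifted_legendre (R : realType) (N : nat) : {poly R} :=
  (('X^2 - 'X) ^+ N)^`N(N).

Definition lagrange_basis {R : realType} (N : nat) (node : 'I_N -> R)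
    (k : 'I_N) : {poly R} :=
  \prod_(l < N | l != k) ((node k - node l)^-1 *: ('X - (node l)%:P)).

(* The nodes are the N zeros of the shifted Legendre polynomial, the weights
   those of the interpolatory quadrature at these nodes. *)
Definition gauss_legendre {R : realType} (N : nat) (node weight : 'I_N -> R) :
    Prop :=
  [/\ injective node,
      forall k, root (shifted_legendre R N) (node k)
    & forall k, weight k =
        \int[lebesgue_measure]_(x in `[0, 1]) (lagrange_basis node k).[x]].

(* The index k = +-1, ..., +-N is encoded as a pair (sign, |k| - 1), the sign
   being true for k < 0. *)
Definition dg_node {R : realType} (N : nat) (node : 'I_N -> R)
    (k : bool * 'I_N) : R := (-1) ^+ k.1 * node k.2.

Definition dg_weight {R : realType} (N : nat) (weight : 'I_N -> R)
    (k : bool * 'I_N) : R := weight k.2.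

(* [psi k j] stands for psi_{k,j}; only 0 <= j <= M = size xs is relevant. *)
Definition nodal_flux {R : realType} (N : nat) (weight : 'I_N -> R)
    (psi : bool * 'I_N -> nat -> R) (j : nat) : R :=
  2^-1 * \sum_(k : bool * 'I_N) dg_weight weight k * psi k j.

(* The cell of index j below, from x_j to x_{j+1}, is the (j+1)-st one. *)
Definition mid_flux {R : realType} (N : nat) (weight : 'I_N -> R)
    (psi : bool * 'I_N -> nat -> R) (j : nat) : R :=
  2^-1 * \sum_(k : bool * 'I_N)
    dg_weight weight k * ((psi k j.+1 + psi k j) / 2).

Definition discrete_solution {R : realType} (N : nat) (node weight : 'I_N -> R)
    (xs : seq R) (sigma sigmaS f : R -> R) (psi : bool * 'I_N -> nat -> R) :
    Prop :=
  [/\ forall (k : bool * 'I_N) (j : nat), (j < size xs)%N ->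
        dg_node node k * ((psi k j.+1 - psi k j) / step xs j)
          + sigma (mid xs j) * ((psi k j.+1 + psi k j) / 2)
        = sigmaS (mid xs j) * mid_flux weight psi j + f (mid xs j),
      forall k : 'I_N, psi (false, k) 0%N = 0
    & forall k : 'I_N, psi (true, k) (size xs) = 0].

Definition is_pw_linear_interpolant {R : realType} (xs : seq R) (v : nat -> R)
    (g : R -> R) : Prop :=
  forall j, (j < size xs)%N -> forall x, x \in `[pt xs j, pt xs j.+1] ->
    g x = v j + (x - pt xs j) / step xs j * (v j.+1 - v j).

Definition ratio_mm {R : realType} (sigma : R -> R) : R :=
  over1 (maxval sigma) / under1 (minval sigma).

Definition R1 {R : realType} (sigma sigmaS : R -> R) : R :=
  2 * over1 (maxval sigma) `^ (1 / 2) * (maxval sigma / minval sigma)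
    * (1 - supnorm `[0, 1] (fun x => sigmaS x / sigma x))^-1.

Definition R2 {R : realType} (sigma sigmaS : R -> R) : R :=
  over1 (maxval sigma) `^ (1 / 2) * ratio_mm sigma `^ (3 / 2)
    * R1 sigma sigmaS.

Definition R4 {R : realType} (rho : R) (sigma sigmaS : R -> R) : R :=
  rho * (over1 (maxval sigma) / minval sigma)
    * (maxval sigmaS / minval sigmaS) * over1 (maxval sigmaS)
    * R1 sigma sigmaS.

Definition calR {R : realType} (rho eta : R) (cs : seq R)
    (sigma sigmaS : R -> R) : R :=
  rho * R4 rho sigma sigmaS * R2 sigma sigmaS * ratio_mm sigma ^+ 2
    * over1 (pw_norm cs eta sigma) * over1 (pw_norm cs eta sigmaS).

(* Main.v *)
(* The scheme is the piecewise constant transport equation with each characteristic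
   solved by the diamond difference formula, so phi - phi^{h,N} splits into three
   parts. First, E_1 is replaced by the N-point kernel
   sum_k (w_k / mu_k) e^{- z / mu_k}: writing E_1 as an integral over directions,
   the error is at most C N^-1 z^{-1/2}, because w_k <= C sqrt(mu_k) / N (a peak
   polynomial in Christoffel's extremal problem) and because the partial sums of
   the weights separate the nodes. Second, freezing the coefficients on a cell costs
   O(h^eta), and third the diamond difference formula costs 2 S h sum_k w_k / mu_k,
   which is O(h log N). As 1 - |sigma_S / sigma| > 0, the resulting inequalities for
   sup |phi| and for the largest nodal error can be solved; the smallness assumption
   absorbs the remaining multiples of these two quantities. *)
Require Import Defs.
From HB Require Import structures.
From mathcomp Require Import all_boot all_order all_algebra.
From mathcomp Require Import all_classical all_reals all_analysis.
From mathcomp Require Import measurable_realfun.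
From mathcomp Require Import ring lra zify.

Set Implicit Arguments.
Unset Strict Implicit.
Unset Printing Implicit Defensive.

Import Order.TTheory GRing.Theory Num.Theory.
Import numFieldNormedType.Exports.

Local Open Scope classical_set_scope.
Local Open Scope ring_scope.

Section real_integrable.
Context d (T : measurableType d) (R : realType) (mu : {measure set T -> \bar R}).
Variables (D : set T) (mD : d.-measurable D).
Implicit Types f g : T -> R.

Lemma integrable_ZlR k f : mu.-integrable D (EFin \o f) ->
  mu.-integrable D (EFin \o (fun x => k * f x)).
Proof.
move=> /(@integrableZl _ _ _ mu _ mD k).
by apply: eq_integrable => // x _ /=; rewrite EFinM.
Qed.

Lemma integrable_DR f g : mu.-integrable D (EFin \o f) ->
  mu.-integrable D (EFin \o g) -> mu.-integrable D (EFin \o (fun x => f x + g x)).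
Proof.
move=> intf intg; have := @integrableD _ _ _ mu _ mD _ _ intf intg.
by apply: eq_integrable => // x _ /=; rewrite EFinD.
Qed.

Lemma integrable_BR f g : mu.-integrable D (EFin \o f) ->
  mu.-integrable D (EFin \o g) -> mu.-integrable D (EFin \o (fun x => f x - g x)).
Proof.
move=> intf intg; have := @integrableB _ _ _ mu _ mD _ _ intf intg.
by apply: eq_integrable => // x _ /=; rewrite EFinB.
Qed.

Lemma integrable_sum_fun (I : Type) (r : seq I) (P : pred I) (G : I -> T -> R) :
  (forall i, P i -> mu.-integrable D (EFin \o G i)) ->
  mu.-integrable D (EFin \o (fun x => \sum_(i <- r | P i) G i x)).
Proof.
move=> intG.
rewrite (_ : EFin \o _ = (fun x => (\sum_(i <- r | P i) (G i x)%:E)%E)).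
  exact: integrable_sum.
by apply/funext => x; rewrite /= sumEFin.
Qed.

Lemma Rint_sum (I : Type) (r : seq I) (G : I -> T -> R) :
  (forall i, mu.-integrable D (EFin \o G i)) ->
  \int[mu]_(x in D) (\sum_(i <- r) G i x) =
  \sum_(i <- r) \int[mu]_(x in D) G i x.
Proof.
move=> intG; elim: r => [|i r ih].
  rewrite big_nil; under eq_Rintegral do rewrite big_nil.
  by rewrite Rintegral_cst// mul0r.
rewrite big_cons -ih -RintegralD//; last exact: integrable_sum_fun.
by apply: eq_Rintegral => x _; rewrite big_cons.
Qed.

Lemma integrable_normR f : mu.-integrable D (EFin \o f) ->
  mu.-integrable D (EFin \o (fun x => `|f x|)).
Proof.
move=> /integrable_abse.
by apply: eq_integrable => // x _ /=.
Qed.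

Lemma integrable_le_bound f g : measurable_fun D f ->
  (forall x, D x -> `|f x| <= g x) -> mu.-integrable D (EFin \o g) ->
  mu.-integrable D (EFin \o f).
Proof.
move=> mf fg; apply: le_integrable => //; first exact/measurable_EFinP.
move=> x Dx /=; rewrite lee_fin (le_trans (fg _ Dx))//.
by rewrite ger0_norm// (le_trans _ (fg _ Dx)).
Qed.

Lemma Rint_norm_le f g : measurable_fun D f ->
  (forall x, D x -> `|f x| <= g x) -> mu.-integrable D (EFin \o g) ->
  `|\int[mu]_(x in D) f x| <= \int[mu]_(x in D) g x.
Proof.
move=> mf fg intg; have intf := integrable_le_bound mf fg intg.
rewrite (le_trans (le_normr_Rintegral mD intf))//.
by apply: le_Rintegral => //; exact: integrable_normR.
Qed.

End real_integrable.

(** * Integrals of continuous functions and of polynomials over an interval *)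

Section integral_kit.
Context {R : realType}.
Notation mu := (@lebesgue_measure R).
Implicit Types (f g F : R -> R) (a b c : R) (p q : {poly R}).

Lemma cont_integrable f a b : {within `[a, b], continuous f} ->
  mu.-integrable `[a, b] (EFin \o f).
Proof. by move=> cf; apply: continuous_compact_integrable => //; exact: segment_compact. Qed.

Lemma integrable_sub_itv f a b c d : a <= c -> d <= b ->
  mu.-integrable `[a, b] (EFin \o f) -> mu.-integrable `[c, d] (EFin \o f).
Proof.
move=> ac db; apply: integrableS => //.
by apply: subset_itv; rewrite bnd_simp.
Qed.

Lemma Rint_split f a b c : a <= c -> c <= b ->
  mu.-integrable `[a, b] (EFin \o f) ->
  \int[mu]_(x in `[a, b]) f x =
  \int[mu]_(x in `[a, c]) f x + \int[mu]_(x in `[c, b]) f x.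
Proof.
move=> ac cb intf.
have := @Rintegral_itvB R f (BLeft a) (BRight b) c intf.
rewrite !bnd_simp => /(_ ac cb) H.
have -> : \int[mu]_(x in `[c, b]) f x = \int[mu]_(x in `]c, b]) f x.
  rewrite Rintegral_itv_obnd_cbnd//.
  apply: integrableS intf => //.
  by apply: subset_itv; rewrite bnd_simp.
by rewrite -H addrC subrK.
Qed.

Lemma FTC2_closed F f a b : a <= b ->
  (forall x, x \in `[a, b] -> is_derive x 1 F (f x)) ->
  {within `[a, b], continuous f} ->
  \int[mu]_(x in `[a, b]) f x = F b - F a.
Proof.
rewrite le_eqVlt => /predU1P[-> _ _|ab dF cf].
  by rewrite set_itv1 Rintegral_set1 subrr.
have cF x : x \in `[a, b] -> {for x, continuous F}.
  move=> xab; apply: differentiable_continuous; apply/derivable1_diffP.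
  by have /@ex_derive := dF _ xab.
rewrite /Rintegral (@continuous_FTC2 _ f F)//.
- split.
  + by move=> x xab; apply: ex_derive; apply: dF; exact: subset_itv_oo_cc.
  + by apply: cvg_at_right_filter; apply: cF; rewrite in_itv/= lexx ltW.
  + by apply: cvg_at_left_filter; apply: cF; rewrite in_itv/= lexx ltW.
- move=> x xab; rewrite derive1E.
  by have Hd := dF _ (subset_itv_oo_cc xab); exact: derive_val.
Qed.

Lemma continuous_within_itv f a b : continuous f ->
  {within `[a, b], continuous f}.
Proof. by move=> cf; exact: continuous_subspaceT. Qed.

Lemma poly_integrable p a b : mu.-integrable `[a, b] (EFin \o (horner p)).
Proof. by apply/cont_integrable/continuous_within_itv/continuous_horner. Qed.

Lemma int_deriv p a b : a <= b ->
  \int[mu]_(x in `[a, b]) p^`().[x] = p.[b] - p.[a].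
Proof.
move=> ab; apply: (@FTC2_closed (horner p) (horner p^`())) => //.
exact/continuous_within_itv/continuous_horner.
Qed.

Lemma int_polyD p q a b :
  \int[mu]_(x in `[a, b]) (p + q).[x] =
  \int[mu]_(x in `[a, b]) p.[x] + \int[mu]_(x in `[a, b]) q.[x].
Proof.
rewrite -RintegralD//; try exact: poly_integrable.
by under eq_Rintegral do rewrite hornerD.
Qed.

Lemma int_polyZ (k : R) p a b :
  \int[mu]_(x in `[a, b]) (k *: p).[x] = k * \int[mu]_(x in `[a, b]) p.[x].
Proof.
rewrite -RintegralZl//; try exact: poly_integrable.
by under eq_Rintegral do rewrite hornerZ.
Qed.

Lemma int_polyN p a b :
  \int[mu]_(x in `[a, b]) (- p).[x] = - \int[mu]_(x in `[a, b]) p.[x].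
Proof. by rewrite -scaleN1r int_polyZ mulN1r. Qed.

Lemma int_poly0 a b : \int[mu]_(x in `[a, b]) (0 : {poly R}).[x] = 0.
Proof. by rewrite -(scale0r (0 : {poly R})) int_polyZ mul0r. Qed.

Lemma int_poly_sum (I : Type) (r : seq I) (P : pred I) (G : I -> {poly R}) a b :
  \int[mu]_(x in `[a, b]) (\sum_(i <- r | P i) G i).[x] =
  \sum_(i <- r | P i) \int[mu]_(x in `[a, b]) (G i).[x].
Proof.
apply: (big_morph (fun p => \int[mu]_(x in `[a, b]) p.[x])).
- by move=> p q; rewrite int_polyD.
- exact: int_poly0.
Qed.

Lemma poly_eq0_itv p a b : a < b ->
  (forall x, x \in `]a, b[ -> p.[x] = 0) -> p = 0.
Proof.
move=> ab p0.
(* These are [size p] distinct interior points, one more than a non-zero [p] can have as roots. *)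
pose rs := [seq a + (b - a) / i.+2%:R | i <- iota 0 (size p)].
apply: (@roots_geq_poly_eq0 _ p rs).
- apply/allP => _ /mapP[i _ ->]; apply/rootP; apply: p0; rewrite in_itv/=.
  have ba : 0 < b - a by rewrite subr_gt0.
  rewrite ltrDl divr_gt0//= -ltrBrDl ltr_pdivrMr// ltr_pMr//.
  by rewrite ltr1n.
- rewrite map_inj_uniq ?iota_uniq// => i j /addrI.
  move=> /(mulfI (lt0r_neq0 _)) => /(_ (ltac:(by rewrite subr_gt0))).
  by move=> /invr_inj /eqP; rewrite eqr_nat => /eqP [].
- by rewrite size_map size_iota.
Qed.

Lemma int_poly_ge0 p a b : (forall x, x \in `[a, b] -> 0 <= p.[x]) ->
  0 <= \int[mu]_(x in `[a, b]) p.[x].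
Proof. by move=> p0; apply: Rintegral_ge0 => x; exact: p0. Qed.

(** A non-zero polynomial is positive at some interior point [c], and by continuity it stays above
    [p.[c] / 2] on an interval to the right of [c]. *)
Lemma int_poly_gt0 p a b : a < b -> p != 0 ->
  (forall x, x \in `[a, b] -> 0 <= p.[x]) ->
  0 < \int[mu]_(x in `[a, b]) p.[x].
Proof.
move=> ab pn0 p0.
have [c cab pc] : exists2 c, c \in `]a, b[ & 0 < p.[c].
  apply/not_exists2P => H; move/eqP: pn0; apply.
  apply: (@poly_eq0_itv _ a b) => // x xab; have [//|/negP] := H x.
  rewrite -leNgt => px; apply/eqP; rewrite eq_le px p0//.
  exact: subset_itv_oo_cc.
have /cvgrPdist_lt /(_ (p.[c] / 2)) := @continuous_horner R p c.
rewrite divr_gt0// => /(_ isT) [e /= e0 He].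
move: (cab); rewrite in_itv/= => /andP[ac cb].
pose d := Num.min (c + e / 2) b.
have cd : c < d by rewrite lt_min cb andbT ltrDl divr_gt0.
have db : d <= b by rewrite ge_min lexx orbT.
have intp := poly_integrable p.
rewrite (@Rint_split (horner p) a b c) ?ltW//.
rewrite (@Rint_split (horner p) c b d) ?(ltW cd)//.
have H1 : 0 <= \int[mu]_(x in `[a, c]) p.[x].
  apply: int_poly_ge0 => x /[!in_itv]/= /andP[ax xc]; apply: p0.
  by rewrite in_itv/= ax (le_trans xc)// ltW.
have H2 : 0 <= \int[mu]_(x in `[d, b]) p.[x].
  apply: int_poly_ge0 => x /[!in_itv]/= /andP[dx xb]; apply: p0.
  by rewrite in_itv/= xb andbT (le_trans (ltW ac))// (le_trans (ltW cd)).
suff H3 : p.[c] / 2 * (d - c) <= \int[mu]_(x in `[c, d]) p.[x].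
  rewrite ltr_wpDl// ltr_wpDr//; apply: lt_le_trans H3.
  by rewrite mulr_gt0 ?divr_gt0// subr_gt0.
have -> : p.[c] / 2 * (d - c) = \int[mu]_(x in `[c, d]) (p.[c] / 2).
  by rewrite Rintegral_cst ?measurable_itv//= lebesgue_measure_itv/= lte_fin cd.
apply: le_Rintegral => //.
  apply: cont_integrable; apply: continuous_within_itv => x; exact: cvg_cst.
move=> x /=; rewrite in_itv/= => /andP[cx xd].
have : `|p.[c] - p.[x]| < p.[c] / 2.
  apply: He => /=; rewrite distrC ger0_norm ?subr_ge0// ltrBlDl.
  apply: (le_lt_trans xd); rewrite gt_min; apply/orP; left.
  by rewrite ltrD2l ltr_pdivrMr// ltr_pMr// ltr1n.
rewrite ltr_norml => /andP[_]; lra.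
Qed.

Lemma int_deriv_by_parts p q a b : a <= b ->
  \int[mu]_(x in `[a, b]) (p^`() * q).[x] =
  (p * q).[b] - (p * q).[a] - \int[mu]_(x in `[a, b]) (p * q^`()).[x].
Proof. by move=> ab; rewrite -int_deriv// derivM int_polyD addrK. Qed.

End integral_kit.

(** * Gauss-Legendre quadrature *)

Section gauss_legendre_rule.
Context {R : realType}.
Notation mu := (@lebesgue_measure R).
Implicit Types (p q : {poly R}).

Lemma dvdp_exp_deriv (d q : {poly R}) m :
  d ^+ m.+1 %| q -> d ^+ m %| q^`().
Proof.
move=> /dvdpP[s ->]; rewrite derivM deriv_exp/=; apply: dvdp_add.
  by rewrite exprS mulrA dvdp_mull.
by rewrite -mulrnAl mulrA dvdp_mull.
Qed.

Lemma rodrigues_dvd N i : (i <= N)%N ->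
  ('X^2 - 'X) ^+ (N - i) %| ((('X^2 - 'X) : {poly R}) ^+ N)^`(i).
Proof.
elim: i => [_|i ih iN]; first by rewrite subn0 derivn0.
rewrite derivnS; apply: dvdp_exp_deriv.
by rewrite -subSn// subSS; exact/ih/ltnW.
Qed.

Lemma rodrigues_endpoints N i x : (i < N)%N -> x = 0 \/ x = 1 ->
  ((('X^2 - 'X : {poly R}) ^+ N)^`(i)).[x] = 0.
Proof.
move=> iN x01; have /dvdpP[s ->] := rodrigues_dvd (ltnW iN).
rewrite hornerM horner_exp !hornerE.
have -> : x ^+ 2 - x = 0 by case: x01 => ->; ring.
by rewrite expr0n subn_eq0 leqNgt iN mulr0.
Qed.

(** Each integration by parts moves one derivative onto [q]. The boundary terms vanish because fewer
    than [N] derivatives leave a factor X^2 - X, and [i] derivatives annihilate [q]. *)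
Lemma rodrigues_orthogonal N i q : (i <= N)%N -> (size q <= i)%N ->
  \int[mu]_(x in `[0, 1]) ((('X^2 - 'X : {poly R}) ^+ N)^`(i) * q).[x] = 0.
Proof.
elim: i q => [q _|i ih q iN qi].
  by rewrite leqn0 size_poly_eq0 => /eqP ->; rewrite mulr0 int_poly0.
rewrite derivnS int_deriv_by_parts// !hornerM.
rewrite !rodrigues_endpoints ?mul0r; [|by auto..].
rewrite ih ?subrr//; first exact: ltnW.
have [->|q0] := eqVneq q 0; first by rewrite deriv0 size_poly0.
by rewrite -ltnS (leq_trans (lt_size_deriv q0)).
Qed.

Lemma shifted_legendre_orthogonal N q : (size q <= N)%N ->
  \int[mu]_(x in `[0, 1]) (shifted_legendre R N * q).[x] = 0.
Proof.
move=> qN; have /(rodrigues_orthogonal (leqnn N)) := qN.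
rewrite nderivn_def mulrnAl -scaler_nat int_polyZ => /eqP.
by rewrite mulf_eq0 pnatr_eq0 gtn_eqF ?fact_gt0//= => /eqP.
Qed.

(** From X^2 - X = X (X - 1): the factor X^N only shifts the coefficients. Degree, value and slope
    at 0 of the Legendre polynomial are all read off from this. *)
Lemma coef_rodrigues N j :
  (('X^2 - 'X : {poly R}) ^+ N)`_(N + j) = (('X - 1) ^+ N)`_j.
Proof.
have -> : 'X^2 - 'X = 'X * ('X - 1) :> {poly R} by rewrite mulrBr mulr1.
by rewrite exprMn coefXnM ltnNge leq_addr/= addKn.
Qed.

Lemma size_shifted_legendre N : size (shifted_legendre R N) = N.+1.
Proof.
have s1 : size (('X - 1 : {poly R}) ^+ N) = N.+1.
  by rewrite -[1]/(1%:P) size_exp_XsubC.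
apply/eqP; rewrite eqn_leq; apply/andP; split.
  apply/leq_sizeP => j Nj; rewrite coef_nderivn coef_rodrigues.
  by rewrite nth_default ?mul0rn// s1.
rewrite ltnNge; apply/negP => /leq_sizeP/(_ N (leqnn _)).
rewrite coef_nderivn coef_rodrigues => /eqP.
rewrite mulrn_eq0 gtn_eqF ?bin_gt0 ?leq_addr//=.
have -> : (('X - 1 : {poly R}) ^+ N)`_N = lead_coef (('X - 1) ^+ N).
  by rewrite lead_coefE s1.
by rewrite lead_coef_exp -[1]/(1%:P) lead_coefXsubC expr1n oner_eq0.
Qed.

Lemma shifted_legendre_at0 N : (shifted_legendre R N).[0] = (-1) ^+ N.
Proof.
rewrite horner_coef0 coef_nderivn coef_rodrigues addn0 binn mulr1n.
by rewrite -horner_coef0 horner_exp !hornerE.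
Qed.

Lemma deriv_shifted_legendre_at0 N :
  (shifted_legendre R N.+1)^`().[0] = - (-1) ^+ N.+1 * (N.+1 * N.+2)%:R.
Proof.
rewrite horner_coef0 coef_deriv coef_nderivn coef_rodrigues mulr1n addn1 binSn.
have -> : (('X - 1 : {poly R}) ^+ N.+1)`_1 = (('X - 1) ^+ N.+1)^`().[0].
  by rewrite horner_coef0 coef_deriv mulr1n.
rewrite deriv_exp/= derivB derivX derivC subr0 mul1r hornerMn horner_exp !hornerE.
by rewrite exprS mulN1r opprK mulr_natr mulrnA.
Qed.

(** The logarithmic derivative at 0; it will evaluate the sum of the reciprocals of the nodes. *)
Lemma deriv_prod_XsubC_at0 (rs : seq R) : (forall r, r \in rs -> r != 0) ->
  (\prod_(r <- rs) ('X - r%:P))^`().[0] =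
  - (\prod_(r <- rs) ('X - r%:P)).[0] * \sum_(r <- rs) r^-1.
Proof.
elim: rs => [|r rs ih] rs0; first by rewrite !big_nil derivC horner0 mulr0.
rewrite !big_cons derivM derivXsubC mul1r !(hornerD, hornerM) ih; last first.
  by move=> s srs; apply: rs0; rewrite in_cons srs orbT.
have r0 : r != 0 by apply: rs0; rewrite mem_head.
by rewrite hornerX hornerN hornerC; field.
Qed.

(** The bound on the size means degree at most 2N - 1. The separation theorem and the Christoffel
    bound rest on this property and on distinct nodes alone, which lets them be applied to the
    reflected rule too. *)
Definition exact_rule N (node weight : 'I_N -> R) := forall p,
  (size p <= N.*2)%N ->
  \int[mu]_(x in `[0, 1]) p.[x] = \sum_k weight k * p.[node k].

Section with_nodes.
Context (N : nat) (node weight : 'I_N -> R).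
Hypothesis node_inj : injective node.

Lemma size_lagrange_basis k : (size (lagrange_basis node k) <= N)%N.
Proof.
rewrite /lagrange_basis scaler_prod (leq_trans (size_scale_leq _ _))//.
rewrite -big_filter size_prod_XsubC size_filter.
have -> : count (fun l => l != k) (index_enum 'I_N) = #|predC1 k|.
  by rewrite cardE /enum_mem size_filter.
by rewrite cardC1 card_ord prednK//; case: (N) k => // -[].
Qed.

Lemma lagrange_basis_node k l :
  (lagrange_basis node k).[node l] = (l == k)%:R.
Proof.
rewrite /lagrange_basis horner_prod; have [->|lk] := eqVneq l k.
  rewrite big1// => i ik; rewrite !hornerE mulVf// subr_eq0.
  by rewrite inj_eq// eq_sym.
by rewrite (bigD1 l)//= !hornerE subrr mulr0 mul0r.
Qed.

Lemma poly_eq_on_nodes p q : (size p <= N)%N -> (size q <= N)%N ->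
  (forall k, p.[node k] = q.[node k]) -> p = q.
Proof.
move=> sp sq pq; apply/eqP; rewrite -subr_eq0; apply/eqP.
apply: (@roots_geq_poly_eq0 _ _ [seq node k | k <- enum 'I_N]).
- by apply/allP => _ /mapP[k _ ->]; apply/rootP; rewrite !hornerE pq subrr.
- by rewrite map_inj_uniq ?enum_uniq.
- by rewrite size_map size_enum_ord (leq_trans (size_polyD _ _))// size_polyN geq_max sp.
Qed.

Lemma lagrange_interpolation p : (size p <= N)%N ->
  p = \sum_k p.[node k] *: lagrange_basis node k.
Proof.
move=> sp; apply: poly_eq_on_nodes => //.
  rewrite (leq_trans (size_sum _ _ _))//; apply/bigmax_leqP => k _.
  by rewrite (leq_trans (size_scale_leq _ _))// size_lagrange_basis.
move=> l; rewrite horner_sum (bigD1 l)//= hornerZ lagrange_basis_node eqxx mulr1.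
rewrite big1 ?addr0// => k kl.
by rewrite hornerZ lagrange_basis_node eq_sym (negPf kl) mulr0.
Qed.

End with_nodes.

(** Divide by the Legendre polynomial: the quotient has degree below [N] and is orthogonal to it,
    while the remainder has the same values at the nodes and is reproduced by interpolation. *)
Lemma gauss_legendre_exact N (node weight : 'I_N -> R) :
  gauss_legendre node weight -> exact_rule node weight.
Proof.
move=> [inj rt w] p sp; set P := shifted_legendre R N.
have sP : size P = N.+1 := size_shifted_legendre N.
have P0 : P != 0 by rewrite -size_poly_eq0 sP.
have sr : (size (p %% P)%R <= N)%N.
  by have := ltn_modp p P; rewrite P0 sP ltnS => ->.
have pr k : p.[node k] = (p %% P).[node k].
  by rewrite {1}(divp_eq p P) hornerD hornerM (rootP (rt k)) mulr0 add0r.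
rewrite {1}(divp_eq p P) int_polyD mulrC shifted_legendre_orthogonal; last first.
  by rewrite size_divp// sP/= leq_subLR addnn.
rewrite add0r {1}(lagrange_interpolation inj sr) int_poly_sum.
by apply: eq_bigr => k _; rewrite int_polyZ -pr w mulrC.
Qed.

(** The reciprocals of the nodes add up to -P'(0) / P(0) = N (N + 1), and each of them is at most
    the sum. *)
Lemma gauss_legendre_node_ge N (node weight : 'I_N -> R) :
  gauss_legendre node weight -> (forall k, 0 < node k) ->
  forall k, ((N * N.+1)%:R)^-1 <= node k.
Proof.
move=> [inj rt _] n0 k; case: N node weight inj rt n0 k => [|N] node weight inj rt n0 k.
  by case: k.
set P := shifted_legendre R N.+1.
pose rs := [seq node k | k <- enum 'I_N.+1].
have PE : P = lead_coef P *: \prod_(z <- rs) ('X - z%:P).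
  apply: all_roots_prod_XsubC.
  - by rewrite size_shifted_legendre size_map size_enum_ord.
  - by apply/allP => _ /mapP[l _ ->].
  - by rewrite uniq_rootsE map_inj_uniq ?enum_uniq.
have rs0 r : r \in rs -> 0 < r by move=> /mapP[l _ ->].
have P0 : P.[0] = lead_coef P * (\prod_(z <- rs) ('X - z%:P)).[0].
  by rewrite {1}PE hornerZ.
have P1 : P^`().[0] = - P.[0] * \sum_(r <- rs) r^-1.
  rewrite P0 {1}PE derivZ hornerZ deriv_prod_XsubC_at0; last first.
    by move=> r /rs0 r0; rewrite gt_eqF.
  by rewrite !mulrA mulrN.
have : \sum_(r <- rs) r^-1 = (N.+1 * N.+2)%:R.
  move: P1; rewrite deriv_shifted_legendre_at0 shifted_legendre_at0.
  by move/mulfI => -> //; rewrite oppr_eq0 expf_neq0// oppr_eq0 oner_eq0.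
move=> <-; rewrite -[leRHS]invrK lef_pV2; last 2 first.
  - rewrite posrE big_map big_enum/=.
    by rewrite (bigD1 k)//= ltr_pwDl ?invr_gt0 ?n0// sumr_ge0// => i _; rewrite invr_ge0 ltW.
  - by rewrite posrE invr_gt0.
rewrite big_map big_enum/= (bigD1 k)//= lerDl sumr_ge0// => i _.
by rewrite invr_ge0 ltW.
Qed.

Section exact_rule_theory.
Context (N : nat) (node weight : 'I_N -> R).
Hypothesis node_inj : injective node.
Hypothesis exactR : exact_rule node weight.

Lemma int_lagrange_sqr_gt0 k :
  0 < \int[mu]_(x in `[0, 1]) (lagrange_basis node k ^+ 2).[x].
Proof.
apply: int_poly_gt0 => //; last by move=> x _; rewrite horner_exp sqr_ge0.
rewrite expf_neq0//; apply/negP => /eqP l0.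
have := lagrange_basis_node node_inj k k; rewrite l0 horner0 eqxx => /eqP.
by rewrite eq_sym oner_eq0.
Qed.

Lemma size_lagrange_sqr k : (size (lagrange_basis node k ^+ 2) < N.*2)%N.
Proof.
have := size_lagrange_basis node k; rewrite expr2.
have [->|l0] := eqVneq (lagrange_basis node k) 0.
  by rewrite mul0r size_poly0; case: (N) k => // -[].
rewrite size_mul//; move: l0; rewrite -size_poly_gt0.
by case: (size _) => // n _; rewrite addSn/= -addnn; lia.
Qed.

(** A squared basis polynomial vanishes at all other nodes, and a further factor of degree at most 1
    keeps the product within degree 2N - 1. The choices 1, X and 1 - X give the sign of the weight
    and the position of the node. *)
Lemma int_mul_lagrange_sqr p k : (size p <= 2)%N ->
  \int[mu]_(x in `[0, 1]) (p * lagrange_basis node k ^+ 2).[x] =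
  weight k * p.[node k].
Proof.
move=> sp; rewrite exactR; last first.
  rewrite (leq_trans (size_polyMleq _ _))//.
  have := size_lagrange_sqr k; move: (size _) => n; move: sp; case: (size p) => //; lia.
rewrite (bigD1 k)//= hornerM horner_exp lagrange_basis_node// eqxx expr1n mulr1.
rewrite big1 ?addr0// => i ik.
by rewrite hornerM horner_exp lagrange_basis_node// (negPf ik) expr0n mulr0 mulr0.
Qed.

Lemma weight_gt0 k : 0 < weight k.
Proof.
have := int_lagrange_sqr_gt0 k; rewrite -[lagrange_basis node k ^+ 2]mul1r.
by rewrite int_mul_lagrange_sqr ?size_poly1// hornerE mulr1.
Qed.

Lemma node_in01 k : 0 < node k < 1.
Proof.
have w0 := weight_gt0 k.
have l0 : lagrange_basis node k ^+ 2 != 0.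
  rewrite expf_neq0//; apply/negP => /eqP l0.
  have := lagrange_basis_node node_inj k k; rewrite l0 horner0 eqxx => /eqP.
  by rewrite eq_sym oner_eq0.
apply/andP; split.
  rewrite -(pmulr_rgt0 _ w0).
  have /(int_mul_lagrange_sqr k) := @eq_leq _ _ (@size_polyX R).
  rewrite hornerX => <-; apply: int_poly_gt0 => //.
    by rewrite mulf_neq0// polyX_eq0.
  move=> x /[!in_itv]/= /andP[x0 _].
  by rewrite hornerM hornerX horner_exp mulr_ge0// sqr_ge0.
rewrite -subr_gt0 -(pmulr_rgt0 _ w0).
have sz : size (1%:P - 'X : {poly R}) = 2 by rewrite -size_polyN opprB size_XsubC.
have /(int_mul_lagrange_sqr k) := @eq_leq _ _ sz.
rewrite hornerD hornerN hornerC hornerX => <-; apply: int_poly_gt0 => //.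
  by rewrite mulf_neq0// -size_poly_eq0 sz.
move=> x /[!in_itv]/= /andP[_ x1].
by rewrite hornerM horner_exp mulr_ge0 ?sqr_ge0// !hornerE subr_ge0.
Qed.

Lemma sum_weight : (0 < N)%N -> \sum_k weight k = 1.
Proof.
move=> N0; have := exactR (p := 1); rewrite size_poly1 double_gt0 => /(_ N0).
under eq_Rintegral do rewrite hornerE.
rewrite Rintegral_cst ?measurable_itv//= lebesgue_measure_itv/= lte_fin ltr01 mul1r.
rewrite oppr0 adde0/= => ->; apply: eq_bigr => k _; by rewrite hornerE mulr1.
Qed.

(** The square of [q] is integrated exactly and all terms of the rule are nonnegative. Any [q] that
    is large at the node and has a small mean square thus bounds the weight. *)
Lemma christoffel_bound q k : (size q <= N)%N ->
  weight k * q.[node k] ^+ 2 <= \int[mu]_(x in `[0, 1]) (q ^+ 2).[x].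
Proof.
move=> sq; rewrite exactR; last first.
  rewrite expr2 (leq_trans (size_polyMleq _ _))// -addnn.
  by move: (size q) sq => n; lia.
rewrite (bigD1 k)//= horner_exp lerDl sumr_ge0// => i _.
by rewrite horner_exp mulr_ge0 ?sqr_ge0// ltW// weight_gt0.
Qed.

End exact_rule_theory.
End gauss_legendre_rule.

(** * Separation: the weights interlace the nodes *)

Section separation.
Context {R : realType}.
Notation mu := (@lebesgue_measure R).
Implicit Types (p q : {poly R}).

Lemma integrable_step f (a b c : R) : mu.-integrable `[a, b] (EFin \o f) ->
  mu.-integrable `[a, b] (EFin \o (fun x => f x * (c <= x)%R%:R)).
Proof.
move=> intf; rewrite (_ : (fun x => _) = f \_ `[c, +oo[); last first.
  apply/funext => x; rewrite patchE.
  rewrite (_ : (x \in `[c, +oo[%classic) = (c <= x)); last first.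
    by apply/idP/idP => [/set_mem|H]; [|apply/mem_set]; rewrite /= in_itv/= andbT.
  by case: ifP => _; rewrite ?mulr1 ?mulr0.
rewrite -restrict_EFin; apply/integrable_restrict => //.
by apply: integrableS intf => //; exact: measurableI.
Qed.

Lemma Rint_step f (a b c : R) : a <= c -> mu.-integrable `[a, b] (EFin \o f) ->
  \int[mu]_(x in `[a, b]) (f x * (c <= x)%R%:R) = \int[mu]_(x in `[c, b]) f x.
Proof.
move=> c0 intf; transitivity (\int[mu]_(x in `[a, b]) (f \_ `[c, +oo[) x).
  apply: eq_Rintegral => x _; rewrite patchE.
  rewrite (_ : (x \in `[c, +oo[%classic) = (c <= x)); last first.
    by apply/idP/idP => [/set_mem|H]; [|apply/mem_set]; rewrite /= in_itv/= andbT.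
  by case: ifP => _; rewrite ?mulr1 ?mulr0.
rewrite -Rintegral_mkcondr; congr (Rintegral _ _ _).
apply/seteqP; split => x /=; rewrite !in_itv/= ?andbT.
  by move=> [/andP[_ ->] ->].
by move=> /andP[cx ->]; rewrite cx (le_trans c0).
Qed.

Lemma antiderivative_poly q :
  exists2 p, p^`() = q & (size p <= (size q).+1)%N.
Proof.
(* The constant coefficient is a division by 0, hence 0. *)
exists (\poly_(i < (size q).+1) (q`_i.-1 / i%:R)); last exact: size_poly.
apply/polyP => i; rewrite coef_deriv coef_poly ltnS.
case: ifPn => [iq|]; first by rewrite -mulrnAr -[X in _ * X]mulr_natr mulVf ?mulr1// pnatr_eq0.
by rewrite -leqNgt => iq; rewrite mul0rn nth_default.
Qed.

Context (N : nat) (node weight : 'I_N -> R).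
Hypothesis node_inj : injective node.
Hypothesis exactR : exact_rule node weight.
Hypothesis N_gt0 : (0 < N)%N.

Definition cdf_lt (x : R) : R := \sum_(k | node k < x) weight k.
Definition cdf_le (x : R) : R := \sum_(k | node k <= x) weight k.

Let D x := x - cdf_le x.

Let node01 k : 0 < node k < 1 := node_in01 node_inj exactR k.
Let node0 k : 0 < node k. Proof. by case/andP: (node01 k). Qed.
Let node1 k : node k < 1. Proof. by case/andP: (node01 k). Qed.
Let w_gt0 k : 0 < weight k := weight_gt0 node_inj exactR k.

Lemma cdf_le_sum x : cdf_le x = \sum_k weight k * (node k <= x)%R%:R.
Proof.
rewrite /cdf_le big_mkcond; apply: eq_bigr => k _.
by case: ifP; rewrite ?mulr1 ?mulr0.
Qed.

(** With [p] a primitive of [q], integration by parts turns the integral into the quadrature error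
    of [p], up to sign, and [p] still has degree at most 2N - 1. *)
Lemma discrepancy_orthogonal q : (size q < N.*2)%N ->
  mu.-integrable `[0, 1] (EFin \o (fun x => q.[x] * D x)) /\
  \int[mu]_(x in `[0, 1]) (q.[x] * D x) = 0.
Proof.
move=> sq.
have [p pq sp] := antiderivative_poly q.
have DE : (fun x => q.[x] * D x) = (fun x => (q * 'X).[x] -
    \sum_k weight k * (q.[x] * (node k <= x)%R%:R)).
  apply/funext => x; rewrite /D cdf_le_sum mulrBr hornerM hornerX mulr_sumr.
  by congr (_ - _); apply: eq_bigr => k _; ring.
have intG k : mu.-integrable `[0, 1]
    (EFin \o (fun x => weight k * (q.[x] * (node k <= x)%R%:R))).
  have := @integrable_step (horner q) 0 1 (node k) (poly_integrable q 0 1).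
  by apply: integrable_ZlR.
have intS := @integrable_sum_fun _ _ _ mu _ (measurable_itv `[0 : R, 1])
  _ (index_enum 'I_N) xpredT _ (fun k _ => intG k).
have intq := @poly_integrable R (q * 'X) 0 1.
split; rewrite DE.
  exact: integrable_BR.
rewrite RintegralB// Rint_sum//.
have intE k : \int[mu]_(x in `[0, 1]) (weight k * (q.[x] * (node k <= x)%R%:R)) =
    weight k * p.[1] - weight k * p.[node k].
  rewrite RintegralZl//; last exact: (integrable_step _ (poly_integrable q 0 1)).
  rewrite Rint_step ?ltW//; last exact: poly_integrable.
  by rewrite -pq int_deriv ?mulrBr// ltW.
rewrite (eq_bigr _ (fun k _ => intE k)).
rewrite sumrB -mulr_suml (sum_weight exactR)// mul1r -exactR; last first.
  by rewrite (leq_trans sp).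
rewrite -pq int_deriv_by_parts//.
rewrite !hornerM !hornerX mulr1 mulr0 subr0 derivX mulr1.
by rewrite opprB addrA subrK subrr.
Qed.

Section contradiction.
Variable k : 'I_N.
Hypothesis viol : node k < cdf_lt (node k).

Let pred_node i := \big[Num.max/0]_(j | node j < node i) node j.
Let next_node i := \big[Num.min/1]_(j | node i < node j) node j.
(** Between consecutive nodes the discrepancy [D] has slope 1, so it changes sign there at most
    once, where x equals the constant mass counted so far. [root_up i] is this place in the gap
    before node [i], [root_down i] the one in the gap after it. Clamping to the closed gap merges a
    root that has no sign change to mark with the root at an adjacent node. *)
Let root_up i := Num.max (pred_node i) (Num.min (cdf_lt (node i)) (node i)).
Let root_down i := Num.min (next_node i) (Num.max (cdf_le (node i)) (node i)).

Let pred_node_ge i j : node j < node i -> node j <= pred_node i.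
Proof. by move=> ji; rewrite /pred_node (bigD1 j)//= le_max lexx. Qed.

Let next_node_le i j : node i < node j -> next_node i <= node j.
Proof. by move=> ji; rewrite /next_node (bigD1 j)//= ge_min lexx. Qed.

Let pred_node_le i x : 0 <= x -> (forall j, node j < node i -> node j <= x) ->
  pred_node i <= x.
Proof. by move=> x0 H; apply: bigmax_le. Qed.

Let next_node_gt i x : x < 1 -> (forall j, node i < node j -> x < node j) ->
  x < next_node i.
Proof. by move=> x0 H; apply: lt_bigmin. Qed.

Let root_up_le i : root_up i <= node i.
Proof.
rewrite ge_max ge_min lexx orbT andbT.
by apply: pred_node_le => [|j /ltW//]; exact: ltW.
Qed.

Let root_up_ge i j : node j < node i -> node j <= root_up i.
Proof. by move=> ji; rewrite le_max pred_node_ge. Qed.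

Let root_down_ge i : node i <= root_down i.
Proof.
rewrite le_min le_max lexx orbT andbT.
by apply: le_bigmin => [|j /ltW//]; exact: ltW.
Qed.

Let root_down_le i j : node i < node j -> root_down i <= node j.
Proof. by move=> ji; rewrite ge_min next_node_le. Qed.

Let below := \big[Num.max/0]_(j | node j < node k) node j.

Let exists_below : exists j, node j < node k.
Proof.
apply/not_existsP => H; move: viol; rewrite /cdf_lt big_pred0.
  by rewrite ltNge ltW.
by move=> j; apply/negP; exact: H.
Qed.

(** The roots of [Q] are the possible sign changes of [D], which in general are the N nodes and the
    N - 1 gaps between them. Under the assumed violation [D] is negative on the whole gap from
    [below] to node [k] and remains so at node [k]; neither contributes a root, and the degree drops
    from 2N - 1 to 2N - 3, within reach of [discrepancy_orthogonal]. *)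
Let Q : {poly R} := ('X - below%:P) *
  (\prod_(i | node k < node i) (('X - (node i)%:P) * ('X - (root_up i)%:P)) *
   \prod_(i | node i < below) (('X - (node i)%:P) * ('X - (root_down i)%:P))).

Let below_node : exists2 b, below = node b & node b < node k.
Proof.
have [j0 j0k] := exists_below.
pose b := [arg max_(j > j0 | node j < node k) node j]%O.
have [bk bmax] : node b < node k /\ forall j, node j < node k -> node j <= node b.
  by rewrite /b; case: arg_maxP => // i ik H; split.
exists b => //; apply/eqP; rewrite eq_le; apply/andP; split.
  by apply: bigmax_le => //; exact: ltW.
exact: pred_node_ge.
Qed.

Let node_le_below i : node i < node k -> node i <= below.
Proof. exact: pred_node_ge. Qed.

Let Q_neq0 : Q != 0.
Proof.
rewrite mulf_neq0 ?polyXsubC_eq0// mulf_neq0//.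
  by apply/prodf_neq0 => i _; rewrite mulf_neq0 ?polyXsubC_eq0.
by apply/prodf_neq0 => i _; rewrite mulf_neq0 ?polyXsubC_eq0.
Qed.

Let size_pairs (P : pred 'I_N) (r : 'I_N -> R) :
  size (\prod_(i | P i) (('X - (node i)%:P) * ('X - (r i)%:P))) =
  #|P|.*2.+1.
Proof.
rewrite size_prod; last first.
  by move=> i _; rewrite mulf_neq0 ?polyXsubC_eq0.
rewrite (eq_bigr (fun _ => 3%N)); last first.
  by move=> i _; rewrite size_mul ?polyXsubC_eq0// !size_XsubC.
rewrite sum_nat_cond_const (_ : #|_| = #|P|); last first.
  by apply: eq_card => i; rewrite inE.
by move: #|P| => n; lia.
Qed.

Let size_Q : (size Q < N.*2)%N.
Proof.
have [b bb bk] := below_node.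
rewrite size_mul ?polyXsubC_eq0 ?mulf_neq0//; last 2 first.
- by apply/prodf_neq0 => i _; rewrite mulf_neq0 ?polyXsubC_eq0.
- by apply/prodf_neq0 => i _; rewrite mulf_neq0 ?polyXsubC_eq0.
rewrite size_XsubC size_mul; last 2 first.
- by apply/prodf_neq0 => i _; rewrite mulf_neq0 ?polyXsubC_eq0.
- by apply/prodf_neq0 => i _; rewrite mulf_neq0 ?polyXsubC_eq0.
rewrite !size_pairs.
set A := [pred i | node k < node i]; set B := [pred i | node i < below].
have cE (P : pred 'I_N) : (\sum_i P i = #|P|)%N.
  rewrite -sum1_card [RHS]big_mkcond; apply: eq_bigr => i _.
  by rewrite unfold_in; case: (P i).
(* The four classes of indices are disjoint, so the two products together have at most N - 2 pairs
   of factors. *)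
have : (\sum_(i < N) (A i + B i + (i == k) + (i == b)) <= \sum_(i < N) 1)%N.
  apply: leq_sum => i _; rewrite /= bb; have [->|ik] := eqVneq i k.
    by rewrite ltxx ltNge ltW//= eq_sym (_ : b == k = false)//; apply/negbTE/eqP => E;
      rewrite E ltxx in bk.
  have [->|ib] := eqVneq i b; first by rewrite ltxx ltNge ltW.
  have [ki|//] := ltP (node k) (node i); last by case: (_ < _).
  by rewrite ltNge (ltW (lt_trans bk ki)).
rewrite !big_split/= !cE sum1_card card_ord.
have c1 (l : 'I_N) : #|(fun i : 'I_N => i == l)| = 1%N.
  by rewrite -(card1 l); apply: eq_card.
rewrite !c1 add0n.
move: #|_| #|_| => m n; rewrite -[1%R]/1%N; lia.
Qed.

Let lower_pair x i : 0 <= x -> below <= x -> node i < below ->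
  0 <= (x - node i) * (x - root_down i).
Proof.
move=> x0 bx ib; have [b bb bk] := below_node.
rewrite mulr_ge0// subr_ge0.
  by rewrite (le_trans (ltW ib)).
by rewrite (le_trans _ bx)// bb root_down_le// -bb.
Qed.

Let upper_pair x i : x < node k -> node k < node i ->
  0 <= (x - node i) * (x - root_up i).
Proof.
move=> xk ki; rewrite mulr_le0// subr_le0.
  by rewrite ltW// (lt_trans xk).
by rewrite (le_trans (ltW xk))// root_up_ge.
Qed.

Let QE x : Q.[x] = (x - below) *
  (\prod_(i | node k < node i) ((x - node i) * (x - root_up i)) *
   \prod_(i | node i < below) ((x - node i) * (x - root_down i))).
Proof.
rewrite !hornerM hornerXsubC !horner_prod; congr (_ * (_ * _)).
  by apply: eq_bigr => i _; rewrite hornerM !hornerXsubC.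
by apply: eq_bigr => i _; rewrite hornerM !hornerXsubC.
Qed.

(** Three positions of [x]. From node [k] on, every pair of factors is nonnegative except possibly
    that of the first node [i0] beyond [x], where [x - node i0] is negative and [x - root_up i0] has
    the sign of [D]. Between [below] and node [k], all factors are nonnegative and [D] is negative.
    Left of [below] the argument is mirrored with the last node [j0] up to [x], and [x - below]
    supplies the minus sign. *)
Let Q_sign x : 0 <= x <= 1 -> Q.[x] * D x <= 0.
Proof.
move=> /andP[x0 x1]; rewrite QE; have [b bb bk] := below_node.
have [kx|xk] := leP (node k) x.
  have bx : below <= x by rewrite bb (le_trans (ltW bk)).
  have lo : 0 <= (x - below) *
      \prod_(i | node i < below) ((x - node i) * (x - root_down i)).
    rewrite mulr_ge0 ?subr_ge0// prodr_ge0// => i ib; exact: lower_pair.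
  suff up : \prod_(i | node k < node i) ((x - node i) * (x - root_up i)) * D x <= 0.
    rewrite (_ : _ * _ = ((x - below) *
      \prod_(i | node i < below) ((x - node i) * (x - root_down i))) *
      (\prod_(i | node k < node i) ((x - node i) * (x - root_up i)) * D x)); last by ring.
    exact: mulr_ge0_le0.
  have [[j xj]|none] := pselect (exists j, x < node j); last first.
    apply: mulr_ge0_le0.
      apply: prodr_ge0 => i ki.
      have ix : node i <= x by rewrite leNgt; apply/negP => H; apply: none; exists i.
      by rewrite mulr_ge0 ?subr_ge0// (le_trans (root_up_le i)).
    rewrite /D subr_le0 /cdf_le (eq_bigl xpredT) ?(sum_weight exactR)//.
    by move=> i; rewrite leNgt; apply/negP => H; apply: none; exists i.
  pose i0 := [arg min_(i < j | x < node i) node i]%O.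
  have [xi0 i0min] : x < node i0 /\ forall i, x < node i -> node i0 <= node i.
    by rewrite /i0; case: arg_minP => // i ik H; split.
  have gap i : node i < node i0 -> node i <= x.
    by rewrite leNgt => ii0; apply/negP => /i0min; rewrite leNgt ii0.
  rewrite (bigD1 i0)/=; last exact: le_lt_trans xi0.
  rewrite mulrC mulrA; apply: mulr_le0_ge0; last first.
    apply: prodr_ge0 => i /andP[ki ii0].
    have [ix|xi] := leP (node i) x.
      by rewrite mulr_ge0 ?subr_ge0// (le_trans (root_up_le i)).
    have i0i : node i0 < node i by rewrite lt_neqAle inj_eq// eq_sym ii0 i0min.
    rewrite mulr_le0 ?subr_le0 ?(ltW xi)//.
    by rewrite (le_trans (ltW xi0))// root_up_ge.
  have cdfE : cdf_le x = cdf_lt (node i0).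
    apply: eq_bigl => i; apply/idP/idP => [ix|/gap//]; exact: le_lt_trans xi0.
  rewrite mulrCA; apply: mulr_le0_ge0; first by rewrite subr_le0 ltW.
  rewrite /D cdfE; have [Wx|xW] := leP (cdf_lt (node i0)) x.
    rewrite mulr_ge0 ?subr_ge0//.
    by rewrite ge_max ge_min Wx pred_node_le.
  rewrite mulr_le0 ?subr_le0 ?(ltW xW)//.
  by rewrite le_max le_min (ltW xW) (ltW xi0) orbT.
have up : 0 <= \prod_(i | node k < node i) ((x - node i) * (x - root_up i)).
  by apply: prodr_ge0 => i ki; exact: upper_pair.
have [bx|xb] := leP below x.
  apply: mulr_ge0_le0.
    rewrite mulr_ge0 ?subr_ge0// mulr_ge0//.
    by apply: prodr_ge0 => i ib; exact: lower_pair.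
  rewrite /D subr_le0.
  suff -> : cdf_le x = cdf_lt (node k) by rewrite ltW// (lt_trans xk).
  apply: eq_bigl => i; apply/idP/idP => [ix|ik]; first exact: le_lt_trans xk.
  by rewrite (le_trans _ bx)// node_le_below.
suff lo : 0 <= \prod_(i | node i < below) ((x - node i) * (x - root_down i)) * D x.
  rewrite (_ : _ * _ = ((x - below) *
    \prod_(i | node k < node i) ((x - node i) * (x - root_up i))) *
    (\prod_(i | node i < below) ((x - node i) * (x - root_down i)) * D x)); last by ring.
  apply: mulr_le0_ge0 => //; apply: mulr_le0_ge0 => //.
  by rewrite subr_le0 ltW.
have [[j jx]|none] := pselect (exists j, node j <= x); last first.
  have xn i : x < node i by rewrite ltNge; apply/negP => H; apply: none; exists i.
  apply: mulr_ge0.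
    apply: prodr_ge0 => i ib.
    by rewrite mulr_le0 ?subr_le0// ltW// (lt_le_trans (xn i)).
  rewrite /D /cdf_le big_pred0 ?subr0// => i.
  by apply/negP => H; apply: none; exists i.
pose j0 := [arg max_(i > j | node i <= x) node i]%O.
have [j0x j0max] : node j0 <= x /\ forall i, node i <= x -> node i <= node j0.
  by rewrite /j0; case: arg_maxP => // i ik H; split.
have gap i : node j0 < node i -> x < node i.
  by rewrite ltNge => ii0; rewrite ltNge; apply: contra ii0 => /j0max.
rewrite (bigD1 j0)/=; last exact: le_lt_trans xb.
rewrite mulrC mulrA; apply: mulr_ge0; last first.
  apply: prodr_ge0 => i /andP[ib ij0].
  have [ix|xi] := leP (node i) x.
    have ij : node i < node j0 by rewrite lt_neqAle inj_eq// ij0 j0max.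
    by rewrite mulr_ge0 ?subr_ge0// (le_trans (root_down_le ij)).
  by rewrite mulr_le0 ?subr_le0 ?(ltW xi)// ltW// (lt_le_trans xi).
have cdfE : cdf_le x = cdf_le (node j0).
  apply: eq_bigl => i; apply/idP/idP => [/j0max//|ij]; exact: le_trans j0x.
rewrite mulrCA; apply: mulr_ge0; first by rewrite subr_ge0.
rewrite /D cdfE; have [Wx|xW] := leP (cdf_le (node j0)) x.
  rewrite mulr_ge0 ?subr_ge0//.
  by rewrite ge_min ge_max Wx j0x orbT.
rewrite mulr_le0 ?subr_le0 ?(ltW xW)//.
rewrite le_min le_max (ltW xW) andbT ltW// next_node_gt//.
by rewrite (lt_trans xk).
Qed.

Lemma no_violation : False.
Proof.
have [intQ QD0] := discrepancy_orthogonal size_Q.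
have [j0 _] := exists_below.
pose i0 := [arg min_(i < j0) node i]%O.
have i0min i : node i0 <= node i.
  by rewrite /i0; case: arg_minP => // l _ H; exact: H.
(* Up to half the smallest node no weight is counted, so [D x = x] and the integrand is a non-zero
   polynomial. Its strictly negative integral there contradicts the vanishing total. *)
pose e := node i0 / 2.
have e0 : 0 < e by rewrite divr_gt0.
have ei0 : e < node i0 by rewrite ltr_pdivrMr// ltr_pMr// ltr1n.
have e1 : e <= 1 by rewrite ltW// (lt_trans ei0).
move: QD0; rewrite (@Rint_split _ _ 0 1 e)// ?(ltW e0)//.
have -> : \int[mu]_(x in `[0, e]) (Q.[x] * D x) = \int[mu]_(x in `[0, e]) (Q * 'X).[x].
  apply: eq_Rintegral => x /set_mem/=; rewrite in_itv/= => /andP[x0 xe].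
  rewrite (hornerM Q 'X) hornerX /D /cdf_le big_pred0 ?subr0// => i.
  by apply/negbTE; rewrite -ltNge (le_lt_trans xe)// (lt_le_trans ei0).
have H1 : 0 < \int[mu]_(x in `[0, e]) (- (Q * 'X)).[x].
  apply: int_poly_gt0 => //; first by rewrite oppr_eq0 mulf_neq0// polyX_eq0.
  move=> x /[!in_itv]/= /andP[x0 xe]; rewrite hornerN oppr_ge0.
  have : Q.[x] * D x <= 0 by apply: Q_sign; rewrite x0 (le_trans xe).
  rewrite (hornerM Q 'X) hornerX /D /cdf_le big_pred0 ?subr0// => i.
  by apply/negbTE; rewrite -ltNge (le_lt_trans xe)// (lt_le_trans ei0).
have H2 : 0 <= \int[mu]_(x in `[e, 1]) (- (Q.[x] * D x)).
  apply: Rintegral_ge0 => x /=; rewrite in_itv/= => /andP[ex x1].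
  by rewrite oppr_ge0 Q_sign// x1 (le_trans (ltW e0)).
have H3 : \int[mu]_(x in `[e, 1]) (- (Q.[x] * D x)) =
    - \int[mu]_(x in `[e, 1]) (Q.[x] * D x).
  under eq_Rintegral do rewrite -mulN1r.
  rewrite RintegralZl ?mulN1r//.
  by apply: integrable_sub_itv intQ => //; exact: ltW.
move: H1 H2; rewrite int_polyN H3 oppr_gt0 oppr_ge0 => H1 H2 /eqP.
by rewrite lt_eqF// ltr_wnDr.
Qed.

End contradiction.

Lemma cdf_lt_node k : cdf_lt (node k) <= node k.
Proof. by rewrite leNgt; apply/negP => /no_violation. Qed.

Lemma exact_rule_reflect : exact_rule (fun k => 1 - node k) weight.
Proof.
move=> p sp.
have := @exactR (p \Po (1%:P - 'X)); rewrite size_comp_poly2; last first.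
  by rewrite -size_polyN opprB size_XsubC.
move=> /(_ sp); under [in X in _ = X]eq_bigr do
  rewrite horner_comp hornerD hornerN hornerX hornerC.
move=> <-.
rewrite [RHS](_ : _ = \int[mu]_(x in `[0, 1]) (p.[1 - x])); last first.
  by apply: eq_Rintegral => x _; rewrite horner_comp hornerD hornerN hornerX hornerC.
have := @Rintegration_by_substitution_onem R (horner p) 1.
rewrite /unstable.onem subrr ler01 lexx => -> //; apply: continuous_within_itv; exact: continuous_horner.
Qed.

End separation.

Section separation_dual.
Context {R : realType} (N : nat) (node weight : 'I_N -> R).
Hypothesis node_inj : injective node.
Hypothesis exactR : exact_rule node weight.
Hypothesis N_gt0 : (0 < N)%N.

(** Under x -> 1 - x the mass beyond a node becomes the mass below its mirror image. The bound for
    the reflected rule is complemented within the total weight 1. *)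
Lemma cdf_le_node k : node k <= cdf_le node weight (node k).
Proof.
have inj' : injective (fun k => 1 - node k).
  by move=> i j /addrI/oppr_inj/node_inj.
have := cdf_lt_node inj' (exact_rule_reflect exactR) N_gt0 k.
rewrite /cdf_lt /cdf_le => H.
have := sum_weight exactR N_gt0.
rewrite (bigID (fun i => node i <= node k))/=.
have E : \sum_(i | 1 - node i < 1 - node k) weight i =
    \sum_(i | ~~ (node i <= node k)) weight i.
  by apply: eq_bigl => i; rewrite -ltNge ltrD2l ltrN2.
by move: H; rewrite E; lra.
Qed.

Lemma cdf_le_lt k : cdf_le node weight (node k) = cdf_lt node weight (node k) + weight k.
Proof.
rewrite /cdf_le (bigD1 k)//= addrC; congr (_ + _).
by apply: eq_bigl => i; rewrite lt_neqAle inj_eq// andbC.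
Qed.

End separation_dual.

(** * Bound of the weights by the Christoffel function *)

Section peak_polynomial.
Context {R : realType}.
Notation mu := (@lebesgue_measure R).

(** As a polynomial in t = sin x this is sin((2m+1) x) / sin x, the Dirichlet kernel at 2x. The
    recursion is the addition formula for steps of 2x, with 2 cos 2x = 2 - 4 t^2. *)
Fixpoint dirichlet_poly (m : nat) : {poly R} :=
  match m with
  | 0 => 1
  | m'.+1 => match m' with
             | 0 => 3%:P - 4 *: 'X^2
             | m''.+1 => (2%:P - 4 *: 'X^2) * dirichlet_poly m' - dirichlet_poly m''
             end
  end.

Lemma dirichlet_polySS m : dirichlet_poly m.+2 =
  (2%:P - 4 *: 'X^2) * dirichlet_poly m.+1 - dirichlet_poly m.
Proof. by []. Qed.

Lemma nat_ind2 (P : nat -> Prop) : P 0%N -> P 1%N ->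
  (forall m, P m -> P m.+1 -> P m.+2) -> forall m, P m.
Proof.
move=> P0 P1 PS m; suff : P m /\ P m.+1 by case.
by elim: m => // m [Pm PmS]; split => //; exact: PS.
Qed.

Lemma size_dirichlet_poly m : (size (dirichlet_poly m) <= m.*2.+1)%N.
Proof.
have s2 (c : R) : (size (c%:P - 4 *: 'X^2)%R <= 3)%N.
  rewrite (leq_trans (size_polyD _ _))// geq_max size_polyN.
  rewrite (leq_trans (size_polyC_leq1 _))//.
  by rewrite (leq_trans (size_scale_leq _ _))// size_polyXn.
elim/nat_ind2: m => [||m ih0 ih1]; first by rewrite size_poly1.
  exact: s2.
rewrite dirichlet_polySS (leq_trans (size_polyD _ _))// geq_max size_polyN.
apply/andP; split; last by rewrite (leq_trans ih0)// ltnS leq_double; lia.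
rewrite (leq_trans (size_polyMleq _ _))//.
have := s2 2; move: ih1; move: (size _) (size _) => a b; lia.
Qed.

Lemma horner_cX2 (c x : R) : (c%:P - 4 *: 'X^2).[x] = c - 4 * x ^+ 2.
Proof. by rewrite hornerD hornerN hornerZ hornerC hornerXn. Qed.

Lemma dirichlet_poly0 m : (dirichlet_poly m).[0] = m.*2.+1%:R.
Proof.
elim/nat_ind2: m => [||m ih0 ih1]; first by rewrite /= hornerC.
  by rewrite /= horner_cX2 expr0n mulr0 subr0.
rewrite dirichlet_polySS hornerD hornerN hornerM horner_cX2 ih0 ih1 expr0n mulr0 subr0.
by rewrite !doubleS -!natr1; ring.
Qed.

Lemma dirichlet_poly_sin m x :
  (dirichlet_poly m).[sin x] * sin x = sin (m.*2.+1%:R * x).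
Proof.
elim/nat_ind2: m => [||m ih0 ih1]; first by rewrite /= hornerC !mul1r.
  have c2 : cos x * cos x = 1 - sin x * sin x.
    by rewrite -!expr2 -(cos2Dsin2 x) addrK.
  rewrite /= horner_cX2 (_ : 1.*2.+1%:R * x = x + (x + x)); last first.
    by rewrite (_ : 1.*2.+1 = 3)//; ring.
  rewrite !sinD cosD [RHS](_ : _ = 3 * sin x * (cos x * cos x) - sin x * (sin x * sin x));
    last by ring.
  by rewrite c2; ring.
rewrite dirichlet_polySS hornerD hornerN hornerM horner_cX2 mulrBl -!mulrA ih0 ih1.
set y := m.+1.*2.+1%:R * x.
have -> : m.+2.*2.+1%:R * x = y + (x + x).
  by rewrite /y !doubleS -!natr1; ring.
have -> : m.*2.+1%:R * x = y - (x + x).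
  by rewrite /y !doubleS -!natr1; ring.
rewrite !sinD cosN sinN sinD cosD.
have -> : cos x * cos x = 1 - sin x ^+ 2 by rewrite -expr2 -(cos2Dsin2 x) addrK.
ring.
Qed.

Lemma norm_sinM_le n (x : R) : `|sin (n%:R * x)| <= n%:R * `|sin x|.
Proof.
elim: n => [|n ih]; first by rewrite !mul0r sin0 normr0.
rewrite -natr1 mulrDl mul1r sinD (le_trans (ler_normD _ _))// mulrDl mul1r.
apply: lerD.
  by rewrite normrM (le_trans _ ih)// ler_piMr// ler_norml cos_geN1 cos_le1.
by rewrite normrM ler_piMl// ler_norml cos_geN1 cos_le1.
Qed.

Lemma dirichlet_poly_bounds m (t : R) : -1 <= t <= 1 ->
  `|(dirichlet_poly m).[t] * t| <= 1 /\
  `|(dirichlet_poly m).[t]| <= m.*2.+1%:R.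
Proof.
move=> t1; have tE : t = sin (asin t) by rewrite asinK.
have e : (dirichlet_poly m).[t] * t = sin (m.*2.+1%:R * asin t).
  by rewrite -dirichlet_poly_sin -tE.
split; first by rewrite e ler_norml sin_geN1 sin_le1.
have [->|t0] := eqVneq t 0; first by rewrite dirichlet_poly0 ger0_norm.
rewrite -(ler_pM2r (_ : 0 < `|t|)) ?normr_gt0// -normrM.
by rewrite e {2}tE norm_sinM_le.
Qed.

(** The squared Dirichlet polynomial at (u - v) / 2 has height (2m+1)^2 at u = v and decays like 4 /
    (u - v)^2. Its even part in u is a polynomial in u^2 of half the degree. The substitution x =
    u^2 sharpens the peak near x = 0, and this is the source of the square root in the weight
    bound. *)
Lemma peak_polynomial m (v : R) : 0 <= v <= 1 ->
  exists q : {poly R}, [/\ (size q <= m.*2.+1)%N,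
    m.*2.+1%:R ^+ 2 / 2 <= q.[v ^+ 2] &
    forall u, 0 <= u <= 1 ->
      [/\ 0 <= q.[u ^+ 2], q.[u ^+ 2] <= m.*2.+1%:R ^+ 2 &
          q.[u ^+ 2] * (u - v) ^+ 2 <= 4]].
Proof.
move=> /andP[v0 v1].
pose r := dirichlet_poly m; pose h := (r \Po (2^-1 *: ('X - v%:P))) ^+ 2.
have hE u : h.[u] = r.[(u - v) / 2] ^+ 2.
  by rewrite /h horner_exp horner_comp hornerZ hornerXsubC mulrC.
have qE u : (even_poly h).[u ^+ 2] = (h.[u] + h.[- u]) / 2.
  rewrite -{2 3}(poly_even_odd h) !hornerD !hornerM !horner_comp !hornerX hornerXn.
  by rewrite hornerXn sqrrN; field.
have h0 u : 0 <= h.[u] by rewrite hE sqr_ge0.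
have rb u : -1 <= u <= 1 -> h.[u] <= m.*2.+1%:R ^+ 2 /\ h.[u] * (u - v) ^+ 2 <= 4.
  move=> /andP[u0 u1]; rewrite hE.
  have [|r1 r2] := @dirichlet_poly_bounds m ((u - v) / 2); first by apply/andP; split; lra.
  rewrite -/r in r1 r2; split.
    by rewrite -real_normK ?num_real// lerXn2r ?nnegrE.
  rewrite (_ : _ * _ = (r.[(u - v) / 2] * ((u - v) / 2)) ^+ 2 * 4); last by field.
  by rewrite ler_piMl// -real_normK ?num_real// expr_le1.
exists (even_poly h); split.
- rewrite (leq_trans (size_even_poly _))//.
  have sh : (size h <= m.*2.*2.+1)%N.
    rewrite (leq_trans (size_poly_exp_leq _ _))//.
    have sl : (size (2^-1 *: ('X - v%:P)) <= 2)%N.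
      by rewrite (leq_trans (size_scale_leq _ _))// size_XsubC.
    have := size_comp_poly_leq r (2^-1 *: ('X - v%:P)).
    have := size_dirichlet_poly m; rewrite -/r.
    move: sl; move: (size _) (size r) (size _) => a b c ha hb hc.
    have : (b.-1 * c.-1 <= b.-1)%N by nia.
    by lia.
  by move: (size h) sh => a; rewrite uphalfE; lia.
- rewrite qE ler_pM2r// hE subrr mul0r dirichlet_poly0 lerDl//.
- move=> u /andP[u0 u1]; rewrite qE.
  have [|a1 a2] := rb u; first by apply/andP; split; lra.
  have [|b1 b2] := rb (- u); first by apply/andP; split; lra.
  have := h0 u; have := h0 (- u); split; [lra|lra|].
  (* The mirrored term peaks at -v, which is farther from [u] than [v] is, since both are
     nonnegative. *)
  suff : h.[- u] * (u - v) ^+ 2 <= h.[- u] * (- u - v) ^+ 2 by lra.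
  apply: ler_wpM2l => //; nra.
Qed.

Lemma cauchy_kernel_integral (a eps : R) : 0 < eps ->
  mu.-integrable `[0, 1] (EFin \o (fun x => (eps ^+ 2 + (x - a) ^+ 2)^-1)) /\
  \int[mu]_(x in `[0, 1]) (eps ^+ 2 + (x - a) ^+ 2)^-1 <= pi / eps.
Proof.
move=> e0; have pos x : 0 < eps ^+ 2 + (x - a) ^+ 2.
  by rewrite ltr_pwDl ?exprn_gt0// sqr_ge0.
have cf : continuous (fun x : R => (eps ^+ 2 + (x - a) ^+ 2)^-1).
  have pE x : eps ^+ 2 + (x - a) ^+ 2 = ((eps ^+ 2)%:P + ('X - a%:P) ^+ 2).[x].
    by rewrite hornerD hornerC horner_exp hornerXsubC.
  move=> x; apply: cvgV; first by rewrite gt_eqF.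
  rewrite pE; under eq_fun do rewrite pE.
  exact: continuous_horner.
split; first by apply/cont_integrable/continuous_within_itv.
have -> : \int[mu]_(x in `[0, 1]) (eps ^+ 2 + (x - a) ^+ 2)^-1 =
    atan ((1 - a) / eps) / eps - atan ((0 - a) / eps) / eps.
  apply: (@FTC2_closed R (fun x => atan ((x - a) / eps) / eps)) => //.
  move=> x _.
  have d1 : is_derive x 1 (fun x => (x - a) / eps) eps^-1.
    by apply: is_derive_eq; rewrite oppr0 addr0 scaler0 add0r /GRing.scale/= mulr1.
  have d2 : is_derive x 1 (atan \o (fun x => (x - a) / eps))
      ((1 + ((x - a) / eps) ^+ 2)^-1 * eps^-1).
    by apply: is_derive1_comp.
  have d3 : is_derive x 1 (fun x => atan ((x - a) / eps) / eps)
      (eps^-1 *: ((1 + ((x - a) / eps) ^+ 2)^-1 * eps^-1)).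
    rewrite (_ : (fun x => _) = eps^-1 \*: (atan \o (fun x => (x - a) / eps))).
      exact: is_deriveZ.
    by apply/funext => y /=; rewrite mulrC.
  apply: (is_derive_eq d3); rewrite /GRing.scale/=.
  have := pos x; move=> /lt0r_neq0 px; field.
  by rewrite px gt_eqF// andbT.
  exact: continuous_within_itv.
rewrite -mulrBl ler_pM2r ?invr_gt0//.
have := atan_ltpi2 ((1 - a) / eps); have := atan_gtNpi2 ((0 - a) / eps); lra.
Qed.

(** The Christoffel bound is tested with the peak polynomial at v = sqrt(node). Its square is
    dominated by 33 (v n + 1)^2 times a Cauchy kernel of width [eps], with integral at most pi /
    eps; dividing by the squared peak n^4 / 4 gives 132 = 4 * 33. *)
Lemma exact_rule_weight_le N (node weight : 'I_N -> R) (m : nat) k :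
  injective node -> exact_rule node weight -> (m.*2.+1 <= N)%N ->
  weight k <= 132 * pi * (Num.sqrt (node k) * m.*2.+1%:R + 1) / m.*2.+1%:R ^+ 2.
Proof.
move=> inj ex mN; have /andP[n0 n1] := node_in01 inj ex k.
set v := Num.sqrt (node k); have v2 : v ^+ 2 = node k by rewrite sqr_sqrtr// ltW.
have v0 : 0 <= v by exact: sqrtr_ge0.
have v1 : v <= 1 by rewrite -sqrtr1 ler_wsqrtr// ltW.
set n : R := m.*2.+1%:R; have n_ge1 : 1 <= n by rewrite ler1n.
have n_gt0 : 0 < n by rewrite (lt_le_trans ltr01).
have [|q [sq qv qb]] := @peak_polynomial m v; first by rewrite v0 v1.
have := christoffel_bound inj ex k (leq_trans sq mN).
(* A width 1/n in u corresponds to a width of order v/n + 1/n^2 in x = u^2. *)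
set eps := (v * n + 1) / n ^+ 2.
have vn : 0 < v * n + 1 by rewrite ltr_wpDl// mulr_ge0// ltW.
have e0 : 0 < eps by rewrite divr_gt0// exprn_gt0.
have [intC leC] := cauchy_kernel_integral (node k) e0.
have b1 : \int[mu]_(x in `[0, 1]) (q ^+ 2).[x] <= 33 * (v * n + 1) ^+ 2 * (pi / eps).
  apply: (@le_trans _ _ (\int[mu]_(x in `[0, 1])
      (33 * (v * n + 1) ^+ 2 * (eps ^+ 2 + (x - node k) ^+ 2)^-1))).
    apply: le_Rintegral => //; first exact: poly_integrable.
      exact: integrable_ZlR.
    move=> x /=; rewrite in_itv/= => /andP[x0 x1].
    have xE : x = Num.sqrt x ^+ 2 by rewrite sqr_sqrtr.
    have [|q0 q1 q2] := qb (Num.sqrt x).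
      by rewrite sqrtr_ge0 -sqrtr1 ler_wsqrtr.
    rewrite -xE in q0 q1 q2.
    rewrite ler_pdivlMr; last by rewrite ltr_pwDl ?exprn_gt0// sqr_ge0.
    rewrite horner_exp mulrDr.
    have E1 : q.[x] ^+ 2 * eps ^+ 2 <= (v * n + 1) ^+ 2.
      rewrite -exprMn lerXn2r ?nnegrE ?(ltW vn)//; first by rewrite mulr_ge0// ltW.
      by rewrite /eps mulrA ler_pdivrMr ?exprn_gt0// mulrC ler_wpM2l// ltW.
    have E2 : q.[x] ^+ 2 * (x - node k) ^+ 2 <= 32 * (v * n + 1) ^+ 2.
      rewrite -v2 {2}xE; set u := Num.sqrt x in q2 *.
      have -> : u ^+ 2 - v ^+ 2 = (u - v) * (2 * v + (u - v)) by ring.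
      set y := u - v in q2 *; set Q := q.[x] in q0 q1 q2 *.
      (* The first term is paid with one factor [Q <= n ^+ 2] and one factor [Q * y ^+ 2 <= 4], the
         second with two factors of the latter kind. *)
      have : (y * (2 * v + y)) ^+ 2 <= 8 * v ^+ 2 * y ^+ 2 + 2 * y ^+ 4.
        by have := sqr_ge0 (2 * v * y - y ^+ 2); nra.
      move=> /(ler_wpM2l (sqr_ge0 Q)) /le_trans; apply.
      have F1 : Q ^+ 2 * y ^+ 2 <= 4 * n ^+ 2.
        rewrite expr2 -mulrA mulrC; apply: ler_pM => //.
        by rewrite mulr_ge0// sqr_ge0.
      have F2 : Q ^+ 2 * y ^+ 4 <= 16.
        rewrite (_ : _ * _ = (Q * y ^+ 2) ^+ 2); last by ring.
        rewrite (_ : 16 = 4 ^+ 2); last by ring.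
        by rewrite lerXn2r ?nnegrE// mulr_ge0// sqr_ge0.
      have F3 : Q ^+ 2 * (8 * v ^+ 2 * y ^+ 2 + 2 * y ^+ 4) <= 8 * v ^+ 2 * (4 * n ^+ 2) + 32.
        rewrite mulrDr (_ : Q ^+ 2 * (8 * v ^+ 2 * y ^+ 2) = 8 * v ^+ 2 * (Q ^+ 2 * y ^+ 2));
          last by ring.
        apply: lerD; last by lra.
        by apply: ler_wpM2l => //; rewrite mulr_ge0// sqr_ge0.
      apply: (le_trans F3); have : 0 <= v * n by rewrite mulr_ge0// ltW.
      nra.
    lra.
  by rewrite RintegralZl// ler_wpM2l// mulr_ge0// sqr_ge0.
move=> /le_trans/(_ b1) H.
have qk : (n ^+ 2 / 2) ^+ 2 <= q.[node k] ^+ 2.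
  rewrite lerXn2r ?nnegrE ?divr_ge0 ?sqr_ge0//.
    by apply: (le_trans _ (_ : n ^+ 2 / 2 <= _)); rewrite ?divr_ge0 ?sqr_ge0// -v2.
  by rewrite -v2.
have := ler_wpM2l (ltW (weight_gt0 inj ex k)) qk => /le_trans/(_ H).
rewrite -ler_pdivlMr; last by rewrite exprn_gt0// divr_gt0// exprn_gt0.
move=> /le_trans; apply; rewrite /eps le_eqVlt; apply/orP; left; apply/eqP.
have h1 : v * n + 1 != 0 by rewrite gt_eqF.
have h2 : n != 0 by rewrite gt_eqF.
clear -h1 h2; clearbody n v.
by field; rewrite h1 h2.
Qed.

(* The bound on the smallest node absorbs the additive [N^-2] left by
   [exact_rule_weight_le]. *)
Lemma gauss_legendre_weight_le N (node weight : 'I_N -> R) k :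
  gauss_legendre node weight ->
  weight k <= 1320 * pi * Num.sqrt (node k) / N%:R.
Proof.
move=> gl; have ex := gauss_legendre_exact gl.
have inj : injective node by case: gl.
have n0 l : 0 < node l by have /andP[] := node_in01 inj ex l.
have N0 : (0 < N)%N by case: (N) k => // -[].
have NR : 0 < N%:R :> R by rewrite ltr0n.
(* Then 2m + 1 is the largest odd number up to N, and it is at least N / 2. *)
pose m := N.-1./2.
have mN : (m.*2.+1 <= N)%N by rewrite /m; lia.
have Nm : (N <= m.*2.+1.*2)%N by rewrite /m; lia.
apply: (le_trans (exact_rule_weight_le k inj ex mN)).
set n : R := m.*2.+1%:R; have n_gt0 : 0 < n by rewrite ltr0n.
have Nn : N%:R <= 2 * n by rewrite -natrM ler_nat mul2n.
set v := Num.sqrt _.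
have v0 : 0 <= v by exact: sqrtr_ge0.
have nv : N%:R^-1 <= 2 * v.
  have : (N%:R^-1) ^+ 2 <= (2 * v) ^+ 2.
    rewrite exprMn sqr_sqrtr ?(ltW (n0 k))//.
    apply: (@le_trans _ _ (4 * ((N * N.+1)%:R)^-1)); last first.
      by rewrite (_ : 2 ^+ 2 = 4) ?ler_wpM2l//; [exact: gauss_legendre_node_ge gl n0 k|ring].
    have N1 : 1 <= N%:R :> R by rewrite ler1n.
    rewrite natrM -[N.+1%:R]natr1; move: (N%:R) N1 NR => x x1 x0.
    rewrite (_ : x^-1 ^+ 2 = 1 / (x * x)); last by field; rewrite gt_eqF.
    have x2 : 0 < x + 1 by rewrite addr_gt0.
    by rewrite ler_pdivrMr ?mulr_gt0// mulrAC ler_pdivlMr ?mulr_gt0//; nra.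
  by rewrite ler_pXn2r// nnegrE ?invr_ge0 ?mulr_ge0// ltW.
have nN : n^-1 <= 2 * N%:R^-1.
  by rewrite -[2]invrK -invfM lef_pV2 ?posrE ?mulr_gt0// ler_pdivrMl.
have nV0 : 0 < n^-1 by rewrite invr_gt0.
rewrite (_ : 132 * pi * (v * n + 1) / n ^+ 2 = 132 * pi * (v * n^-1 + n^-1 ^+ 2)); last first.
  by field; rewrite gt_eqF.
(* The factor is 10 = 2 + 8: v / n <= 2 v / N, and 1 / n^2 <= 4 / N^2 <= 8 v / N by [nv]. *)
rewrite (_ : 1320 * pi * v / N%:R = 132 * pi * (10 * v * N%:R^-1)); last by ring.
rewrite ler_wpM2l//; first by rewrite mulr_ge0// pi_ge0.
by move: (n^-1) (N%:R^-1) nN nv nV0 v0 => b a *; nra.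
Qed.

End peak_polynomial.

(** * Discrepancy of the Gauss-Legendre rule *)

Section gauss_discrepancy.
Context {R : realType}.

Context (N : nat) (node weight : 'I_N -> R).
Hypothesis gl : gauss_legendre node weight.
Hypothesis N_gt0 : (0 < N)%N.
Variable A : R.
Hypothesis A_gt0 : 0 < A.
Hypothesis weight_le : forall k, weight k <= A * Num.sqrt (node k) / N%:R.

Let inj : injective node. Proof. by case: gl. Qed.
Let ex : exact_rule node weight := gauss_legendre_exact gl.
Let n01 k : 0 < node k < 1 := node_in01 inj ex k.
Let w0 k : 0 < weight k := weight_gt0 inj ex k.

(** Separation is applied at the largest node below [x]; passing from strict to weak inequality at
    that node costs one weight. *)
Lemma cdf_lt_upper x : 0 < x ->
  cdf_lt node weight x - x <= A * Num.sqrt x / N%:R.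
Proof.
move=> x0; have [[j jx]|none] := pselect (exists j, node j < x); last first.
  rewrite /cdf_lt big_pred0; last first.
    by move=> i; apply/negP => H; apply: none; exists i.
  apply: (@le_trans _ _ 0); first by rewrite sub0r oppr_le0 ltW.
  by rewrite divr_ge0// mulr_ge0 ?sqrtr_ge0//; exact: ltW.
pose k := [arg max_(i > j | node i < x) node i]%O.
have [kx kmax] : node k < x /\ forall i, node i < x -> node i <= node k.
  by rewrite /k; case: arg_maxP => // i ik H; split.
have -> : cdf_lt node weight x = cdf_le node weight (node k).
  by apply: eq_bigl => i; apply/idP/idP => [/kmax//|ik]; exact: le_lt_trans kx.
rewrite cdf_le_lt//.
have := cdf_lt_node inj ex N_gt0 k.
have := weight_le k.
have : A * Num.sqrt (node k) / N%:R <= A * Num.sqrt x / N%:R.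
  rewrite ler_wpM2r ?invr_ge0// ler_wpM2l//; first exact: ltW.
  by rewrite ler_wsqrtr// ltW.
lra.
Qed.

(** For the lower bound the mass below [x] is at least the next node minus its weight. That weight
    is controlled by the square root of the next node, which therefore has to be compared with
    sqrt(x). *)
Lemma gauss_discrepancy x : 0 < x <= 1 ->
  `|cdf_lt node weight x - x| <= 3 * A * Num.sqrt x / N%:R.
Proof.
move=> /andP[x0 x1]; have up := cdf_lt_upper x0.
have a0 : 0 < A / N%:R by rewrite divr_gt0 // ltr0n.
have r0 : 0 < Num.sqrt x by rewrite sqrtr_gt0.
have rE : Num.sqrt x ^+ 2 = x by rewrite sqr_sqrtr// ltW.
have cdf0 : 0 <= cdf_lt node weight x by apply: sumr_ge0 => i _; exact: ltW.
rewrite mulrAC (_ : 3 * A / N%:R = 3 * (A / N%:R)); last by rewrite mulrA.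
rewrite mulrAC in up.
set a := A / N%:R in a0 up *; set r := Num.sqrt x in r0 rE up *.
rewrite ler_norml; apply/andP; split; last by nra.
have [[j xj]|none] := pselect (exists j, x <= node j); last first.
  rewrite /cdf_lt (eq_bigl xpredT) ?(sum_weight ex)//; first by nra.
  by move=> i; rewrite ltNge; apply/negP => H; apply: none; exists i.
pose l := [arg min_(i < j | x <= node i) node i]%O.
have [xl lmin] : x <= node l /\ forall i, x <= node i -> node l <= node i.
  by rewrite /l; case: arg_minP => // i ik H; split.
have E : cdf_lt node weight x = cdf_lt node weight (node l).
  apply: eq_bigl => i; apply/idP/idP => [ix|]; first exact: lt_le_trans xl.
  by rewrite !ltNge; apply: contra => /lmin.
have := cdf_le_node inj ex N_gt0 l; rewrite cdf_le_lt// -E => H1.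
have := weight_le l; rewrite mulrAC -/a => H2.
have s0 : 0 <= Num.sqrt (node l) by exact: sqrtr_ge0.
have sE : Num.sqrt (node l) ^+ 2 = node l.
  by rewrite sqr_sqrtr// ltW//; case/andP: (n01 l).
set s := Num.sqrt (node l) in s0 sE H2.
(* The upper bound at [x] and the lower bound at the next node give s^2 - r^2 <= a (r + s). *)
have H3 : s <= r + 2 * a.
  rewrite leNgt; apply/negP => H.
  have : s ^+ 2 <= r ^+ 2 + a * r + a * s by rewrite sE rE; nra.
  nra.
(* If r < a, then x = r^2 <= a r and a nonnegative mass suffices; otherwise s <= 3 r. *)
have [ar|ra] := leP a r; last by nra.
nra.
Qed.

Lemma inv_le_dyadic_sum n (m : R) : 4^-1 ^+ n <= m -> m < 1 ->
  m^-1 <= \sum_(i < n) 4 ^+ i.+1 * (m < 4^-1 ^+ i)%R%:R.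
Proof.
move=> + m1; elim: n => [|n ih]; first by rewrite expr0 leNgt m1.
move=> nm; rewrite big_ord_recr/=.
have s0 : 0 <= \sum_(i < n) 4 ^+ i.+1 * (m < 4^-1 ^+ i)%R%:R :> R.
  by apply: sumr_ge0 => i _; rewrite mulr_ge0.
have [H|H] := leP (4^-1 ^+ n) m; first by rewrite mulr0 addr0 ih.
rewrite mulr1; apply: (@le_trans _ _ (4 ^+ n.+1)); last by rewrite lerDr.
have p0 : 0 < (4^-1 : R) ^+ n.+1 by rewrite exprn_gt0.
rewrite -[leRHS]invrK lef_pV2 ?posrE ?invr_gt0 ?exprn_gt0//.
  by rewrite -exprVn.
exact: lt_le_trans nm.
Qed.

(** Nodes are sorted by the scales 4^-i, whose square roots are powers of 2. By the discrepancy
    bound the i-th scale contributes at most 4 + 12 A 2^i / N. Since every node is at least 1 / (N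
    (N + 1)), the scales stop at 2^n > N: the geometric part sums to at most 24 A, the constants to
    4 n <= 8 log_2 N. *)
Lemma gauss_sum_inv_le : (2 <= N)%N ->
  \sum_k weight k / node k <= (8 + 24 * A) / ln 2 * ln N%:R.
Proof.
move=> N2; have NR : 0 < N%:R :> R by rewrite ltr0n.
pose p := trunc_log 2 N; pose n := p.+1.
have pN : (2 ^ p <= N)%N by apply: trunc_logP.
have Nn : (N < 2 ^ n)%N by apply: trunc_log_ltn.
have ln2 : 0 < ln 2 :> R by rewrite ln_gt0// ltr1n.
have p_le : p%:R * ln 2 <= ln N%:R :> R.
  rewrite mulr_natl -lnXn// ler_ln ?posrE ?exprn_gt0//.
  by rewrite -natrX ler_nat.
have ln_le : ln 2 <= ln N%:R :> R by rewrite ler_ln ?posrE// ler_nat.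
have node_ge k : 4^-1 ^+ n <= node k.
  apply: le_trans (gauss_legendre_node_ge gl _ k); last by move=> l; case/andP: (n01 l).
  rewrite exprVn lef_pV2 ?posrE ?exprn_gt0// ?ltr0n ?muln_gt0 ?N_gt0//.
  rewrite -natrX ler_nat -[4%N]/(2 * 2)%N expnMn.
  by apply: leq_mul => //; exact: ltnW.
apply: (@le_trans _ _ (\sum_(i < n) 4 ^+ i.+1 * cdf_lt node weight (4^-1 ^+ i))).
  apply: (@le_trans _ _ (\sum_k weight k *
      \sum_(i < n) 4 ^+ i.+1 * (node k < 4^-1 ^+ i)%R%:R)).
    apply: ler_sum => k _; rewrite ler_wpM2l//; first exact: ltW.
    by apply: inv_le_dyadic_sum => //; case/andP: (n01 k).
  under eq_bigr do rewrite mulr_sumr.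
  rewrite exchange_big/=; apply: ler_sum => i _.
  rewrite le_eqVlt; apply/orP; left; apply/eqP.
  rewrite /cdf_lt [in RHS]big_mkcond mulr_sumr; apply: eq_bigr => k _.
  by case: ifP => _; rewrite ?mulr1 ?mulr0// mulrC.
apply: (@le_trans _ _ (\sum_(i < n) (4 + 12 * A / N%:R * 2 ^+ i))).
  apply: ler_sum => i _.
  have y0 : 0 < (4^-1 : R) ^+ i by rewrite exprn_gt0.
  have y1 : (4^-1 : R) ^+ i <= 1 by rewrite exprn_ile1// invf_le1// ler1n.
  have /andP[_ H] : 0 < (4^-1 : R) ^+ i <= 1 by rewrite y0.
  have := @gauss_discrepancy (4^-1 ^+ i); rewrite y0 y1 => /(_ isT).
  have -> : Num.sqrt ((4^-1 : R) ^+ i) = 2^-1 ^+ i.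
    have -> : (4^-1 : R) = 2^-1 ^+ 2 by rewrite exprVn -natrX.
    by rewrite -exprM mulnC exprM sqrtr_sqr ger0_norm// exprn_ge0.
  move=> /ler_normlP[_]; rewrite lerBlDl => /(ler_wpM2l (_ : 0 <= 4 ^+ i.+1)) => /(_ (exprn_ge0 _ _)).
  move=> /(_ (ltac:(by []))) /le_trans; apply.
  have ab : 2 ^+ i * 2^-1 ^+ i = 1 :> R by rewrite -exprMn divff// expr1n.
  have -> : 4 ^+ i.+1 = 4 * (2 ^+ i * 2 ^+ i) :> R by rewrite exprS -exprMn -natrM.
  have -> : 4^-1 ^+ i = 2^-1 ^+ i * 2^-1 ^+ i :> R by rewrite -exprMn -invfM -natrM.
  rewrite [leLHS](_ : _ = 4 * (2 ^+ i * 2^-1 ^+ i) * (2 ^+ i * 2^-1 ^+ i) +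
    12 * A / N%:R * 2 ^+ i * (2 ^+ i * 2^-1 ^+ i)); last by ring.
  by rewrite ab !mulr1.
rewrite big_split/= sumr_const card_ord -mulr_sumr.
have geo : \sum_(i < n) 2 ^+ i <= 2 * N%:R :> R.
  have -> : \sum_(i < n) 2 ^+ i = 2 ^+ n - 1 :> R.
    rewrite (subrX1 2 n) (_ : 2 - 1 = 1 :> R) ?mul1r//; ring.
  rewrite lerBlDr (@le_trans _ _ (2 * N%:R))// ?lerDl//.
  by rewrite exprS ler_pM2l// -natrX ler_nat.
have H1 : 12 * A / N%:R * \sum_(i < n) 2 ^+ i <= 24 * A.
  have := ler_wpM2l (_ : 0 <= 12 * A / N%:R) geo.
  move=> /(_ (ltac:(by rewrite divr_ge0// mulr_ge0// ltW))) /le_trans; apply.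
  rewrite le_eqVlt; apply/orP; left; apply/eqP; field.
  by rewrite gt_eqF.
have H2 : 1 <= ln N%:R / ln 2 :> R by rewrite ler_pdivlMr// mul1r.
have H3 : p%:R <= ln N%:R / ln 2 :> R by rewrite ler_pdivlMr.
have nE : n%:R = p%:R + 1 :> R by rewrite -natr1.
rewrite -[4 *+ n]mulr_natr nE [leRHS](_ : _ = (8 + 24 * A) * (ln N%:R / ln 2)); last by ring.
move: H1 H2 H3; set z := ln N%:R / ln 2; set y := (_ * \sum_(i < n) _) => H1 H2 H3.
have : 24 * A <= 24 * A * z by rewrite ler_peMr// mulr_ge0// ltW.
lra.
Qed.

End gauss_discrepancy.

(** * Quadrature of the exponential integral *)

Section exponential_integral.
Context {R : realType}.
Notation mu := (@lebesgue_measure R).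
Implicit Types (z t T a b : R).

Lemma is_derive_cts (f : R -> R) (x d : R) : is_derive x 1 f d -> {for x, continuous f}.
Proof.
move=> df; apply: differentiable_continuous; apply/derivable1_diffP.
exact: ex_derive.
Qed.

Lemma is_derive_expN z t :
  is_derive t 1 (fun t => expR (- (t * z))) (- z * expR (- (t * z))).
Proof.
apply: is_derive_eq.
by rewrite scaler0 add0r /GRing.scale/= mulr1 mulrN mulrC mulNr.
Qed.

Lemma continuous_expN z : continuous (fun t => expR (- (t * z))).
Proof. move=> t; exact: is_derive_cts (is_derive_expN z t). Qed.

Lemma cvg_expN z : 0 < z -> expR (- (t * z)) @[t --> +oo] --> (0 : R).
Proof.
move=> z0; apply: (@cvg_comp _ _ _ (fun t : R => t * z) (fun t => expR (- t)) _ (+oo)).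
  by apply: gt0_cvgMly => //; exact: cvg_id.
exact: cvgr_expR.
Qed.

Lemma exp_tail z T : 0 < z ->
  mu.-integrable `[T, +oo[ (EFin \o (fun t => expR (- (t * z)))) /\
  \int[mu]_(t in `[T, +oo[) expR (- (t * z)) = expR (- (T * z)) / z.
Proof.
move=> z0.
have E : (\int[mu]_(t in `[T, +oo[) (expR (- (t * z)))%:E =
    (0 : R)%:E - (- (expR (- (T * z)) / z))%:E)%E.
  apply: (@ge0_continuous_FTC2y _ _ (fun t => - (expR (- (t * z)) / z))).
  - by move=> x _; exact: expR_ge0.
  - by apply: continuous_subspaceT; exact: continuous_expN.
  - rewrite -oppr0; apply: cvgN; rewrite -(mul0r z^-1).
    by apply: cvgMl; exact: cvg_expN.
  - by move=> x _; apply: ex_derive.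
  - apply: cvg_at_right_filter; apply: cvgN; apply: cvgMl; exact: continuous_expN.
  - move=> x _; rewrite derive1E.
    have d : is_derive x 1 (fun t => - (expR (- (t * z)) / z)) (expR (- (x * z))).
      apply: is_derive_eq; rewrite /GRing.scale/=; field.
      by rewrite gt_eqF.
    exact: derive_val.
split; last by rewrite /Rintegral E -EFinB/= sub0r opprK.
apply/integrableP; split.
  apply/measurable_EFinP; apply: measurable_funTS.
  by apply: continuous_measurable_fun; exact: continuous_expN.
under eq_integral do rewrite /= ger0_norm ?expR_ge0//.
by rewrite E -EFinB ltry.
Qed.

Definition E1_density z t := expR (- (t * z)) / t.

Lemma E1_density_cts z t : 0 < t -> {for t, continuous (E1_density z)}.
Proof.
move=> t0; apply: cvgM; first exact: continuous_expN.
by apply: cvgV; [rewrite gt_eqF|exact: cvg_id].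
Qed.

Lemma measurable_E1_density z : measurable_fun `[1 : R, +oo[%classic (E1_density z).
Proof.
apply: (@measurable_funS _ _ _ _ (`]0 : R, +oo[%classic)) => //.
  by apply: subset_itvr; rewrite bnd_simp.
apply: open_continuous_measurable_fun => // x; rewrite inE/= in_itv/= andbT.
exact: E1_density_cts.
Qed.

Lemma E1_density_bounds z t : 1 <= t -> 0 <= E1_density z t <= expR (- (t * z)).
Proof.
move=> t1; have t0 : 0 < t by rewrite (lt_le_trans ltr01).
rewrite divr_ge0 ?expR_ge0 ?(ltW t0)//=.
by rewrite ler_pdivrMr// ler_peMr// expR_ge0.
Qed.

Lemma integrable_E1_density z : 0 < z ->
  mu.-integrable `[1, +oo[ (EFin \o E1_density z).
Proof.
move=> z0; apply: integrable_le_bound => //; last by have [H _] := exp_tail 1 z0; exact: H.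
  exact: measurable_E1_density.
move=> x /=; rewrite in_itv/= andbT => x1.
by have /andP[? ?] := E1_density_bounds z x1; rewrite ger0_norm.
Qed.

Lemma E1E z : E1 z = \int[mu]_(t in `[1, +oo[) E1_density z t.
Proof. by []. Qed.

(** The inequality 1 - e^{-t(b-a)} <= t (b - a) cancels the factor 1/t of the density and leaves the
    exponential integral of e^{-ta}, at most 1/a. *)
Lemma E1_le a b : 0 < a -> a <= b -> 0 <= E1 a - E1 b <= (b - a) / a.
Proof.
move=> a0 ab; have b0 := lt_le_trans a0 ab.
have intB := integrable_E1_density b0; have intA := integrable_E1_density a0.
rewrite !E1E -RintegralB//; have [intE E] := exp_tail 1 a0.
have key t : 1 <= t -> 0 <= E1_density a t - E1_density b t <= (b - a) * expR (- (t * a)).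
  move=> t1; have t0 : 0 < t by rewrite (lt_le_trans ltr01).
  rewrite /E1_density -mulrBl; apply/andP; split.
    by rewrite divr_ge0 ?(ltW t0)// subr_ge0 ler_expR lerN2 ler_wpM2l// ltW.
  rewrite ler_pdivrMr//.
  have -> : expR (- (t * b)) = expR (- (t * a)) * expR (- (t * (b - a))).
    by rewrite -expRD; congr expR; ring.
  have := expR_ge1Dx (- (t * (b - a))); have := expR_gt0 (- (t * a)).
  by move: (expR _) (expR _) => x y; nra.
apply/andP; split.
  by apply: Rintegral_ge0 => t /=; rewrite in_itv/= andbT => /key/andP[].
apply: (@le_trans _ _ (\int[mu]_(t in `[1, +oo[) ((b - a) * expR (- (t * a))))).
  apply: le_Rintegral => //; first exact: integrable_BR.
    exact: integrable_ZlR.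
  by move=> t /=; rewrite in_itv/= andbT => /key/andP[].
rewrite RintegralZl// E ler_wpM2l ?subr_ge0// ler_piMl ?invr_ge0 ?(ltW a0)//.
by rewrite -[leRHS]expR0 ler_expR oppr_le0 mul1r ltW.
Qed.

Lemma E1_lip d a b : 0 < d -> d <= a -> d <= b -> `|E1 a - E1 b| <= `|a - b| / d.
Proof.
move=> d0 da db; wlog ab : a b da db / a <= b.
  move=> H; have [/H->//|/ltW/H] := leP a b.
  by rewrite distrC [`|b - a|]distrC; apply.
have a0 := lt_le_trans d0 da.
have /andP[H1 H2] := E1_le a0 ab.
rewrite ger0_norm// distrC ger0_norm ?subr_ge0// (le_trans H2)//.
by rewrite ler_wpM2l ?subr_ge0// lef_pV2.
Qed.

Lemma E1_cts z : 0 < z -> {for z, continuous (@E1 R)}.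
Proof.
move=> z0; apply/cvgrPdist_le => /= e e0; near=> y.
have yz : `|z - y| < Num.min (z / 2) (e * (z / 2)).
  near: y; apply/nbhs_ballP; exists (Num.min (z / 2) (e * (z / 2))) => //=.
  by rewrite lt_min (mulr_gt0 e0) ?divr_gt0.
move: yz; rewrite lt_min => /andP[yz1 yz2].
have y2 : z / 2 <= y by move: yz1 => /ltr_normlP[]; lra.
rewrite (le_trans (@E1_lip (z / 2) z y _ _ y2)) ?divr_gt0//.
  by rewrite ler_pdivrMr// ler_peMr ?ler1n// ltW.
by rewrite ler_pdivrMr ?divr_gt0// ltW.
Unshelve. all: end_near. Qed.

(* [t |-> - t e^(-tz)] is a primitive of this function; its value at [t = 1/m] is
   the kernel [e^(-z/m) / m] of the direction [m]. *)
Definition kernel_density z t := (t * z - 1) * expR (- (t * z)).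

Lemma is_derive_kernel z t :
  is_derive t 1 (fun t => - (t * expR (- (t * z)))) (kernel_density z t).
Proof.
apply: is_derive_eq; rewrite /GRing.scale/= /kernel_density; ring.
Qed.

Lemma kernel_density_cts z : continuous (kernel_density z).
Proof.
move=> t; apply: cvgM; last exact: continuous_expN.
by apply: cvgB; [apply: cvgMl; exact: cvg_id|exact: cvg_cst].
Qed.

Lemma int_kernel_density z a b : a <= b ->
  \int[mu]_(t in `[a, b]) kernel_density z t =
  a * expR (- (a * z)) - b * expR (- (b * z)).
Proof.
move=> ab; have -> : a * expR (- (a * z)) - b * expR (- (b * z)) =
    - (b * expR (- (b * z))) - - (a * expR (- (a * z))) by ring.
apply: (@FTC2_closed R (fun t => - (t * expR (- (t * z)))) (kernel_density z)) => //.
  by move=> t _; exact: is_derive_kernel.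
by apply: continuous_within_itv; exact: kernel_density_cts.
Qed.

(** In the variable m = 1/t, the factor 1 - 1/t is the mass of the directions above m under the
    uniform measure. The quadrature kernel has the same form with 1 - [cdf_lt node weight t^-1] in
    its place, so that only the discrepancy of the rule will remain in the difference. *)
Lemma int_E1_density_by_parts z T : 1 <= T ->
  [/\ mu.-integrable `[1, T] (EFin \o (fun t => kernel_density z t * (1 - t^-1))),
      mu.-integrable `[1, T] (EFin \o E1_density z) &
  \int[mu]_(t in `[1, T]) E1_density z t =
  \int[mu]_(t in `[1, T]) (kernel_density z t * (1 - t^-1)) +
  (T - 1) * expR (- (T * z))].
Proof.
move=> T1; pose g t := (t * z - z - 1) * expR (- (t * z)).
have cg : continuous g.
  move=> t; apply: cvgM; last exact: continuous_expN.
  apply: cvgB; last exact: cvg_cst.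
  by apply: cvgB; [apply: cvgMl; exact: cvg_id|exact: cvg_cst].
have intg : mu.-integrable `[1, T] (EFin \o g).
  by apply: cont_integrable; exact: continuous_within_itv.
have Ig : \int[mu]_(t in `[1, T]) g t = - ((T - 1) * expR (- (T * z))).
  rewrite (_ : - _ = - ((T - 1) * expR (- (T * z))) - - ((1 - 1) * expR (- (1 * z)))); last by ring.
  apply: (@FTC2_closed R (fun t => - ((t - 1) * expR (- (t * z)))) g) => //.
    move=> t _; apply: is_derive_eq; rewrite /GRing.scale/= /g; ring.
  exact: continuous_within_itv.
have intk : mu.-integrable `[1, T] (EFin \o (fun t => kernel_density z t * (1 - t^-1))).
  apply: cont_integrable; apply: continuous_in_subspaceT => t.
  rewrite inE/= in_itv/= => /andP[t1 _].
  apply: cvgM; first exact: kernel_density_cts.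
  apply: cvgB; first exact: cvg_cst.
  by apply: cvgV; [rewrite gt_eqF// (lt_le_trans ltr01)|exact: cvg_id].
have E : {in `[1, T]%classic, E1_density z =1
    (fun t => kernel_density z t * (1 - t^-1) - g t)}.
  move=> t; rewrite inE/= in_itv/= => /andP[t1 _].
  rewrite /E1_density /kernel_density /g; field.
  by rewrite gt_eqF// (lt_le_trans ltr01).
split => //.
  have := @integrable_BR _ _ _ mu _ (measurable_itv _) _ _ intk intg.
  by apply: eq_integrable => // t tT /=; rewrite E.
rewrite (@eq_Rintegral _ _ _ mu _ _ _ E) RintegralB// Ig; ring.
Qed.

(** With u = t z, (1 + u)^2 <= 4 (1 + u/2)^2 <= 4 e^u. *)
Lemma norm_kernel_density_le z t : 0 < z -> 0 < t ->
  `|kernel_density z t| <= 4 / (1 + t * z).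
Proof.
move=> z0 t0; have u0 : 0 < t * z by rewrite mulr_gt0.
rewrite /kernel_density; move: (t * z) u0 => u u0.
rewrite ler_pdivlMr ?addr_gt0// normrM [X in _ * X * _]ger0_norm ?expR_ge0//.
rewrite expRN mulrAC ler_pdivrMr ?expR_gt0//.
have e2 : (1 + u / 2) ^+ 2 <= expR u.
  have -> : expR u = expR (u / 2) ^+ 2 by rewrite -expRM_natl; congr expR; field.
  by rewrite lerXn2r ?nnegrE ?expR_ge0 ?addr_ge0 ?divr_ge0 ?(ltW u0)// expR_ge1Dx.
have : `|u - 1| <= u + 1 by rewrite ler_norml; apply/andP; split; lra.
move: (expR u) e2 (`|u - 1|) => e e2 v; nra.
Qed.

(** A primitive is (2 / sqrt z) atan(sqrt(z t)). The singularity z^{-1/2} of the quadrature error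
    originates here. *)
Lemma int_inv_sqrt_le z T : 0 < z -> 1 <= T ->
  mu.-integrable `[1, T] (EFin \o (fun t => ((1 + t * z) * Num.sqrt t)^-1)) /\
  \int[mu]_(t in `[1, T]) ((1 + t * z) * Num.sqrt t)^-1 <= pi / Num.sqrt z.
Proof.
move=> z0 T1; set r := Num.sqrt z; have r0 : 0 < r by rewrite sqrtr_gt0.
have rz : r * r = z by rewrite -expr2 sqr_sqrtr// ltW.
have cf : {within `[1, T], continuous (fun t => ((1 + t * z) * Num.sqrt t)^-1)}.
  apply: continuous_in_subspaceT => t; rewrite inE/= in_itv/= => /andP[t1 _].
  have t0 : 0 < t by rewrite (lt_le_trans ltr01).
  apply: cvgV.
    by rewrite mulf_neq0// gt_eqF ?sqrtr_gt0// addr_gt0// mulr_gt0.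
  apply: cvgM; last by apply: sqrt_continuous.
  by apply: cvgD; [exact: cvg_cst|apply: cvgMl; exact: cvg_id].
split; first exact: cont_integrable.
pose F t := 2 / r * atan (r * Num.sqrt t).
have -> : \int[mu]_(t in `[1, T]) ((1 + t * z) * Num.sqrt t)^-1 = F T - F 1.
  apply: (@FTC2_closed R F) => // t; rewrite in_itv/= => /andP[t1 _].
  have t0 : 0 < t by rewrite (lt_le_trans ltr01).
  have d1 : is_derive t 1 (fun t => r * Num.sqrt t) (r * (2 * Num.sqrt t)^-1).
    by have := is_derive1_sqrt t0 => ds; apply: (@is_deriveZ _ _ _ (@Num.sqrt R) r).
  have d2 : is_derive t 1 (atan \o (fun t => r * Num.sqrt t))
     ((1 + (r * Num.sqrt t) ^+ 2)^-1 * (r * (2 * Num.sqrt t)^-1)).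
    by apply: is_derive1_comp.
  have d3 : is_derive t 1 F (2 / r * ((1 + (r * Num.sqrt t) ^+ 2)^-1 * (r * (2 * Num.sqrt t)^-1))).
    exact: (@is_deriveZ _ _ _ (atan \o (fun t => r * Num.sqrt t)) (2 / r)).
  apply: (is_derive_eq d3).
  rewrite exprMn expr2 rz sqr_sqrtr ?(ltW t0)//.
  have s0 : 0 < Num.sqrt t by rewrite sqrtr_gt0.
  have p0 : 0 < 1 + z * t by rewrite addr_gt0// mulr_gt0.
  rewrite (mulrC t z); clearbody r; clear F d1 d2 d3; move: (Num.sqrt t) s0 => s s0; field.
  by rewrite !gt_eqF.
have h1 : atan (r * Num.sqrt T) <= pi / 2 := ltW (atan_ltpi2 _).
have h2 : 0 <= atan (r * Num.sqrt 1).
  by rewrite -(@atan0 R) le_atan// mulr_ge0 ?sqrtr_ge0// ltW.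
rewrite /F -mulrBr (@le_trans _ _ (2 / r * (pi / 2)))//.
  by rewrite ler_wpM2l ?divr_ge0 ?(ltW r0)//; lra.
rewrite le_eqVlt; apply/orP; left; apply/eqP; field.
by rewrite gt_eqF.
Qed.

Section quadrature_of_E1.
Context (N : nat) (node weight : 'I_N -> R).
Hypothesis inj : injective node.
Hypothesis ex : exact_rule node weight.
Hypothesis N_gt0 : (0 < N)%N.
Variable B : R.
Hypothesis B_ge0 : 0 <= B.
Hypothesis discr : forall x, 0 < x <= 1 ->
  `|cdf_lt node weight x - x| <= B * Num.sqrt x.

Let n0 k : 0 < node k. Proof. by case/andP: (node_in01 inj ex k). Qed.
Let n1 k : node k < 1. Proof. by case/andP: (node_in01 inj ex k). Qed.

Definition quad_kernel z : R := \sum_k weight k / node k * expR (- (z / node k)).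

(** All reciprocals of nodes lie in [1, T], so the whole kernel is recovered from an integral over
    this interval. The boundary terms (T - 1) e^{-Tz} and T e^{-Tz} of the two integrations by parts
    leave one e^{-Tz}. *)
Lemma E1_quadrature_truncated z T : 0 < z -> 1 <= T -> (forall k, (node k)^-1 <= T) ->
  `|\int[mu]_(t in `[1, T]) E1_density z t - quad_kernel z| <=
  4 * B * pi / Num.sqrt z + expR (- (T * z)).
Proof.
move=> z0 T1 nT; have [intk intE ->] := int_E1_density_by_parts z T1.
have inth : mu.-integrable `[1, T] (EFin \o kernel_density z).
  by apply: cont_integrable; apply: continuous_within_itv; exact: kernel_density_cts.
pose S t := \sum_k weight k * (kernel_density z t * ((node k)^-1 <= t)%R%:R).
have intSk k : mu.-integrable `[1, T]
    (EFin \o (fun t => weight k * (kernel_density z t * ((node k)^-1 <= t)%R%:R))).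
  by apply: integrable_ZlR => //; exact: integrable_step.
have intS : mu.-integrable `[1, T] (EFin \o S).
  by apply: integrable_sum_fun.
have IS : \int[mu]_(t in `[1, T]) S t = quad_kernel z - T * expR (- (T * z)).
  rewrite Rint_sum//; under eq_bigr => k _.
    rewrite RintegralZl//; last exact: integrable_step.
    rewrite Rint_step//; last by rewrite invf_ge1// ltW.
    rewrite int_kernel_density// mulrBr; over.
  rewrite sumrB -mulr_suml (sum_weight ex)// mul1r; congr (_ - _).
  by apply: eq_bigr => k _; rewrite mulrA (mulrC (node k)^-1 z).
have SE t : 1 <= t -> kernel_density z t * (1 - t^-1) - S t =
    kernel_density z t * (cdf_lt node weight t^-1 - t^-1).
  move=> t1; have t0 : 0 < t by rewrite (lt_le_trans ltr01).
  have -> : S t = kernel_density z t * (1 - cdf_lt node weight t^-1).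
    rewrite -(sum_weight ex)// (bigID (fun k => node k < t^-1))/= [X in X - _]addrC addrK.
    rewrite /S [in RHS]big_mkcond mulr_sumr; apply: eq_bigr => k _.
    have -> : ((node k)^-1 <= t) = ~~ (node k < t^-1).
      by rewrite -leNgt -[in RHS](invrK (node k)) lef_pV2 ?posrE ?invr_gt0.
    by case: ifP => _; rewrite ?mulr1 ?mulr0// mulrC.
  ring.
have [intI II] := int_inv_sqrt_le z0 T1.
have main : `|\int[mu]_(t in `[1, T]) (kernel_density z t * (1 - t^-1) - S t)| <=
    4 * B * pi / Num.sqrt z.
  have intd := @integrable_BR _ _ _ mu _ (measurable_itv _) _ _ intk intS.
  apply: (@le_trans _ _ (\int[mu]_(t in `[1, T])
      (4 * B * ((1 + t * z) * Num.sqrt t)^-1))).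
    apply: Rint_norm_le => //; last exact: integrable_ZlR.
      by move/measurable_int/measurable_EFinP : intd.
    move=> t /=; rewrite in_itv/= => /andP[t1 _]; rewrite SE//.
    have t0 : 0 < t by rewrite (lt_le_trans ltr01).
    rewrite normrM invfM.
    rewrite [leRHS](_ : _ = 4 / (1 + t * z) * (B * (Num.sqrt t)^-1)); last by ring.
    apply: ler_pM => //; first exact: norm_kernel_density_le.
    rewrite (le_trans (discr _))// ?invr_gt0 ?t0 ?invf_le1//.
    by rewrite sqrtrV// ltW.
  by rewrite RintegralZl// -[leRHS]mulrA ler_wpM2l// mulr_ge0.
move: main; rewrite RintegralB// IS.
set I := \int[mu]_(_ in _) _ => main.
rewrite (_ : _ - _ = I - (quad_kernel z - T * expR (- (T * z))) - expR (- (T * z))); last by ring.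
rewrite (le_trans (ler_normB _ _))// lerD// ger0_norm ?expR_ge0//.
Qed.

Lemma E1_quadrature z : 0 < z ->
  `|E1 z - quad_kernel z| <= 4 * B * pi / Num.sqrt z.
Proof.
move=> z0; apply/ler_addgt0Pl => e e0.
(* The sum dominates each reciprocal of a node. The last entry makes e^{-Tz} (1 + 1/z), which covers
   the boundary term and the tail of [E1], at most [e], because e^{Tz} >= T z. *)
pose T := Num.max 1 (Num.max (\sum_k (node k)^-1) ((1 + z^-1) / (z * e))).
have T1 : 1 <= T by rewrite le_max lexx.
have T0 : 0 < T by rewrite (lt_le_trans ltr01).
have nT k : (node k)^-1 <= T.
  rewrite /T !le_max; apply/orP; right; apply/orP; left.
  rewrite (bigD1 k)//= lerDl sumr_ge0// => i _; by rewrite invr_ge0 ltW.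
have Te : (1 + z^-1) / (z * e) <= T by rewrite /T !le_max lexx !orbT.
have := E1_quadrature_truncated z0 T1 nT.
have intE := integrable_E1_density z0.
have := @Rintegral_itvB R (E1_density z) (BLeft 1) (BInfty _ false) T intE.
rewrite !bnd_simp => /(_ T1 isT); rewrite -E1E => tailE.
have [intT IT] := exp_tail T z0.
have tail0 : 0 <= \int[mu]_(t in `]T, +oo[) E1_density z t.
  apply: Rintegral_ge0 => t /=; rewrite in_itv/= andbT => Tt.
  by have /andP[] := E1_density_bounds z (le_trans T1 (ltW Tt)).
have tail1 : \int[mu]_(t in `]T, +oo[) E1_density z t <= expR (- (T * z)) / z.
  rewrite -IT -Rintegral_itv_obnd_cbnd; last first.
    by apply: integrableS intT => //; apply: subset_itvr; rewrite bnd_simp.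
  apply: le_Rintegral => //.
  - apply: integrableS intE => //; apply: subset_itvr; by rewrite bnd_simp.
  - apply: integrableS intT => //; apply: subset_itvr; by rewrite bnd_simp.
  - move=> t /=; rewrite in_itv/= andbT => Tt.
    by have /andP[] := E1_density_bounds z (le_trans T1 (ltW Tt)).
have small : expR (- (T * z)) * (1 + z^-1) <= e.
  rewrite expRN mulrC ler_pdivrMr ?expR_gt0//.
  have h : T * z <= expR (T * z).
    by rewrite (le_trans _ (expR_ge1Dx _))// lerDr.
  apply: (@le_trans _ _ (e * (T * z))); last by rewrite ler_wpM2l// ltW.
  rewrite (_ : e * (T * z) = T * (z * e)); last by ring.
  by rewrite -ler_pdivrMr// mulr_gt0.
move: tailE tail0 tail1 small; rewrite mulrDr mulr1.
set x := (X in _ = X); set y := (X in _ - X = _) => tailE tail0 tail1 small H.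
rewrite (_ : E1 z - _ = (y - quad_kernel z) + x); last by rewrite -tailE; ring.
rewrite (le_trans (ler_normD _ _))// (ger0_norm tail0); lra.
Qed.

End quadrature_of_E1.
End exponential_integral.

(** * The Crank-Nicolson (diamond difference) step *)

Section kernel_integrals.
Context {R : realType}.
Notation mu := (@lebesgue_measure R).

Lemma continuous_sqrt_dist (x e : R) :
  continuous (fun y => Num.sqrt (`|x - y| + e)).
Proof.
move=> y; apply: (@continuous_comp _ _ _ (fun y => `|x - y| + e) Num.sqrt).
  apply: cvgD; last exact: cvg_cst.
  by apply: cvg_norm; apply: cvgB; [exact: cvg_cst|exact: cvg_id].
exact: sqrt_continuous.
Qed.

(** The shift by [e] makes the integrand continuous, so explicit primitives apply on either side of
    [x]. The bound does not involve [e], as monotone convergence requires. *)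
Lemma int_regularized_inv_sqrt (x e : R) : 0 <= x <= 1 -> 0 < e <= 1 ->
  \int[mu]_(y in `[0, 1]) (Num.sqrt (`|x - y| + e))^-1 <= 8.
Proof.
move=> /andP[x0 x1] /andP[e0 e1].
have cf : continuous (fun y => (Num.sqrt (`|x - y| + e))^-1).
  move=> y; apply: cvgV; last exact: continuous_sqrt_dist.
  by rewrite gt_eqF// sqrtr_gt0 ltr_wpDl.
have sq2 (y : R) : y <= 2 -> Num.sqrt y <= 2.
  move=> y2; rewrite -[leRHS](@ger0_norm _ 2)// -sqrtr_sqr ler_wsqrtr//.
  by rewrite (le_trans y2)// expr2; lra.
rewrite (@Rint_split _ _ 0 1 x)//; last exact/cont_integrable/continuous_within_itv.
have L : \int[mu]_(y in `[0, x]) (Num.sqrt (`|x - y| + e))^-1 =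
    - (2 * Num.sqrt (x - x + e)) - - (2 * Num.sqrt (x - 0 + e)).
  apply: (@FTC2_closed R (fun y => - (2 * Num.sqrt (x - y + e)))) => //; last first.
    exact: continuous_within_itv.
  move=> y; rewrite in_itv/= => /andP[_ yx].
  have p : 0 < x - y + e by rewrite ltr_wpDl// subr_ge0.
  rewrite ger0_norm ?subr_ge0//.
  have d1 : is_derive y 1 (fun y => x - y + e) (-1).
    by apply: is_derive_eq; ring.
  have d2 := is_derive1_sqrt p.
  have d3 : is_derive y 1 (Num.sqrt \o (fun y => x - y + e)) ((2 * Num.sqrt (x - y + e))^-1 * -1).
    exact: is_derive1_comp.
  have d4 : is_derive y 1 (fun y => - (2 * Num.sqrt (x - y + e)))
     (- (2 * ((2 * Num.sqrt (x - y + e))^-1 * -1))).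
    by apply: is_deriveN; apply: (@is_deriveZ _ _ _ (Num.sqrt \o (fun y => x - y + e)) 2).
  apply: (is_derive_eq d4); field.
  by rewrite gt_eqF// sqrtr_gt0.
have Rt : \int[mu]_(y in `[x, 1]) (Num.sqrt (`|x - y| + e))^-1 =
    2 * Num.sqrt (1 - x + e) - 2 * Num.sqrt (x - x + e).
  apply: (@FTC2_closed R (fun y => 2 * Num.sqrt (y - x + e))) => //; last first.
    exact: continuous_within_itv.
  move=> y; rewrite in_itv/= => /andP[xy _].
  have p : 0 < y - x + e by rewrite ltr_wpDl// subr_ge0.
  rewrite distrC ger0_norm ?subr_ge0//.
  have d1 : is_derive y 1 (fun y => y - x + e) 1.
    by apply: is_derive_eq; ring.
  have d2 := is_derive1_sqrt p.
  have d3 : is_derive y 1 (Num.sqrt \o (fun y => y - x + e)) ((2 * Num.sqrt (y - x + e))^-1 * 1).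
    exact: is_derive1_comp.
  have d4 : is_derive y 1 (fun y => 2 * Num.sqrt (y - x + e))
     (2 * ((2 * Num.sqrt (y - x + e))^-1 * 1)).
    by apply: (@is_deriveZ _ _ _ (Num.sqrt \o (fun y => y - x + e)) 2).
  apply: (is_derive_eq d4); field.
  by rewrite gt_eqF// sqrtr_gt0.
rewrite L Rt; have := sqrtr_ge0 (x - x + e).
have := sq2 (x - 0 + e); have := sq2 (1 - x + e); lra.
Qed.

Lemma int_inv_sqrt_dist (x : R) : 0 <= x <= 1 ->
  mu.-integrable `[0, 1] (EFin \o (fun y => (Num.sqrt `|x - y|)^-1)) /\
  \int[mu]_(y in `[0, 1]) (Num.sqrt `|x - y|)^-1 <= 8.
Proof.
move=> x01; pose e (n : nat) : R := n.+1%:R^-1.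
have e01 n : 0 < e n <= 1 by rewrite invr_gt0 ltr0n invf_le1// ler1n.
have e0 n : 0 < e n by case/andP: (e01 n).
pose g n y := (Num.sqrt (`|x - y| + e n))^-1.
have g0 n y : 0 <= g n y by rewrite invr_ge0 sqrtr_ge0.
have cg n : continuous (g n).
  move=> y; apply: cvgV; last exact: continuous_sqrt_dist.
  by rewrite gt_eqF// sqrtr_gt0 ltr_wpDl.
have mg n : measurable_fun `[0 : R, 1]%classic (EFin \o g n).
  apply/measurable_EFinP; apply: measurable_funTS; exact: continuous_measurable_fun.
have ndg y : nondecreasing_seq (fun n => (g n y)%:E).
  move=> n k nk; rewrite lee_fin lef_pV2 ?posrE ?sqrtr_gt0 ?ltr_wpDl//.
  by rewrite ler_wsqrtr// lerD2l lef_pV2 ?posrE// ler_nat ltnS.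
have mf : measurable_fun `[0 : R, 1]%classic (fun y => (Num.sqrt `|x - y|)^-1).
  apply: measurable_funTS.
  have c : measurable_fun setT (fun y : R => Num.sqrt `|x - y|).
    apply: continuous_measurable_fun => y.
    have -> : (fun y => Num.sqrt `|x - y|) = (fun y => Num.sqrt (`|x - y| + 0)).
      by apply/funext => u; rewrite addr0.
    exact: continuous_sqrt_dist.
  have mV : measurable_fun setT (@GRing.inv R).
    have -> : setT = [set~ 0] `|` [set (0 : R)] by rewrite setUC setUv.
    apply/measurable_funU => //; first exact: measurableC.
    split; last exact: measurable_fun_set1.
    apply: open_continuous_measurable_fun.
      apply: closed_openC; apply: accessible_closed_set1.
      exact/hausdorff_accessible/norm_hausdorff.
    move=> y; rewrite inE/= => /eqP y0; by apply: cvgV; [exact: y0|exact: cvg_id].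
  exact: (measurableT_comp mV c).
have f0 y : 0 <= (Num.sqrt `|x - y|)^-1 by rewrite invr_ge0 sqrtr_ge0.
have E := @monotone_convergence _ _ _ mu `[0, 1]%classic (measurable_itv _)
  (fun n y => (g n y)%:E) mg (fun n y _ => (ltac:(by rewrite lee_fin))) (fun y _ => ndg y).
have le8 : (\int[mu]_(y in `[0%R, 1%R]) ((Num.sqrt `|x - y|)^-1)%:E <= 8%:E)%E.
  apply: (@le_trans _ _ (\int[mu]_(y in `[0%R, 1%R]) limn (fun n => (g n y)%:E))%E).
    apply: ge0_le_integral => //.
    - exact/measurable_EFinP.
    - apply: (emeasurable_fun_cvg (fun n y => (g n y)%:E)) => [n|y _]; first exact: mg.
      exact: ereal_nondecreasing_is_cvgn.
    (* At [y = x] the integrand is 0, the inverse of 0, while the regularised values diverge; only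
       an inequality is claimed. *)
    - move=> y _; have [<-|xy] := eqVneq x y.
        rewrite subrr normr0 sqrtr0 invr0; apply: lime_ge.
          exact: ereal_nondecreasing_is_cvgn.
        by apply: nearW => n; rewrite lee_fin.
      rewrite le_eqVlt; apply/orP; left; apply/eqP/esym; apply: cvg_lim => //.
      apply: cvg_EFin; first exact: nearW.
      apply: cvgV; first by rewrite gt_eqF// sqrtr_gt0 normr_gt0 subr_eq0.
      apply: (@cvg_comp _ _ _ (fun n => `|x - y| + e n) Num.sqrt _ (nbhs `|x - y|)); last exact: sqrt_continuous.
      have H : `|x - y| + e n @[n --> \oo] --> `|x - y| + 0.
        by apply: cvgD; [exact: cvg_cst|exact: cvg_harmonic].
      by rewrite addr0 in H; exact: H.
  rewrite E; apply: lime_le.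
    apply: ereal_nondecreasing_is_cvgn => n k nk; apply: ge0_le_integral => //.
    - by move=> y _; rewrite lee_fin.
    - exact: mg.
    - exact: mg.
    - by move=> y _; exact: ndg.
  apply: nearW => n; have := int_regularized_inv_sqrt x01 (e01 n).
  rewrite -lee_fin /Rintegral fineK//.
  apply: integrable_fin_num => //.
  by apply: (@cont_integrable _ (g n) 0 1); exact: continuous_within_itv.
have intf : mu.-integrable `[0, 1] (EFin \o (fun y => (Num.sqrt `|x - y|)^-1)).
  apply/integrableP; split; first exact/measurable_EFinP.
  under eq_integral do rewrite /= ger0_norm//.
  by rewrite (le_lt_trans le8)// ltry.
split=> //; rewrite -lee_fin /Rintegral fineK//; exact: integrable_fin_num.
Qed.

Lemma int_exp_affine (t d s a b : R) : s != 0 -> a <= b ->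
  \int[mu]_(y in `[a, b]) (t * expR (- (t * (d + s * (y - a))))) =
  (expR (- (t * d)) - expR (- (t * (d + s * (b - a))))) / s.
Proof.
move=> s0 ab.
have -> : (expR (- (t * d)) - expR (- (t * (d + s * (b - a))))) / s =
  - (expR (- (t * (d + s * (b - a)))) / s) - - (expR (- (t * (d + s * (a - a)))) / s).
  by rewrite subrr mulr0 addr0; ring.
apply: (@FTC2_closed R (fun y => - (expR (- (t * (d + s * (y - a)))) / s))) => //.
  move=> y _; apply: is_derive_eq; rewrite /GRing.scale/=; field.
  exact: s0.
apply: continuous_within_itv => y; apply: cvgMr.
by apply: (@is_derive_cts _ (fun x => expR (- (t * (d + s * (x - a)))))).
Qed.

Lemma continuous_exp_dist (t x : R) : continuous (fun y => t * expR (- (t * `|x - y|))).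
Proof.
move=> y; apply: cvgMr.
apply: (@continuous_comp _ _ _ (fun y => - (t * `|x - y|)) expR); last exact: continuous_expR.
apply: cvgN; apply: cvgMr.
by apply: cvg_norm; apply: cvgB; [exact: cvg_cst|exact: cvg_id].
Qed.

(** The prefactor [t] balances the decay rate, hence uniformity in the direction: a sum over
    directions costs no more than its coefficients. *)
Lemma int_exp_dist (t m x : R) : 0 < m -> 0 <= x <= 1 ->
  \int[mu]_(y in `[0, 1]) (t * expR (- (t * (m * `|x - y|)))) <= 2 / m.
Proof.
move=> m0 /andP[x0 x1].
have cE : (fun y => t * expR (- (t * (m * `|x - y|)))) =
    (fun y => m^-1 * (t * m * expR (- (t * m * `|x - y|)))).
  apply/funext => y; rewrite [in RHS]mulrA [m^-1 * _]mulrCA mulVf ?mulr1 ?gt_eqF//.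
  by rewrite mulrA.
rewrite (@Rint_split _ _ 0 1 x)//; last first.
  rewrite cE; apply: cont_integrable; apply: continuous_within_itv => y.
  by apply: cvgMr; exact: continuous_exp_dist.
have -> : \int[mu]_(y in `[0, x]) (t * expR (- (t * (m * `|x - y|)))) =
    \int[mu]_(y in `[0, x]) (t * expR (- (t * (m * x + (- m) * (y - 0))))).
  apply: eq_Rintegral => y; rewrite inE/= in_itv/= => /andP[_ yx].
  by rewrite ger0_norm ?subr_ge0//; congr (_ * expR _); ring.
have -> : \int[mu]_(y in `[x, 1]) (t * expR (- (t * (m * `|x - y|)))) =
    \int[mu]_(y in `[x, 1]) (t * expR (- (t * (0 + m * (y - x))))).
  apply: eq_Rintegral => y; rewrite inE/= in_itv/= => /andP[yx _].
  by rewrite distrC ger0_norm ?subr_ge0//; congr (_ * expR _); ring.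
rewrite !int_exp_affine ?oppr_eq0 ?gt_eqF//.
rewrite mulr0 oppr0 expR0 invrN mulrN -mulNr opprB.
rewrite [m * x + _](_ : _ = 0); last by ring.
rewrite mulr0 oppr0 expR0 -mulrDl ler_pM2r ?invr_gt0//.
have := expR_ge0 (- (t * (m * x))); have := expR_ge0 (- (t * (0 + m * (1 - x)))); lra.
Qed.

End kernel_integrals.

(** * The diamond difference recursion against the exponential recursion *)

Section crank_nicolson.
Context {R : realType}.

(* Both [1/(1 + 2a)] and [1 - 2a] enclose the two sides within [2a^2]. *)
Lemma cayley_exp_le (a : R) : 0 <= a ->
  `|(1 - a) / (1 + a) - expR (- (2 * a))| <= 2 * a ^+ 2.
Proof.
move=> a0; have p1 : 0 < 1 + a by lra.
have p2 : 0 < 1 + 2 * a by lra.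
have E1 : 1 - 2 * a <= expR (- (2 * a)) by exact: expR_ge1Dx.
have E2 : expR (- (2 * a)) <= (1 + 2 * a)^-1.
  by rewrite expRN lef_pV2 ?posrE ?expR_gt0// expR_ge1Dx.
have r1 : (1 - a) / (1 + a) <= 1 - 2 * a + 2 * a ^+ 2.
  by rewrite ler_pdivrMr//; nra.
have r2 : (1 + 2 * a)^-1 - 2 * a ^+ 2 <= (1 - a) / (1 + a).
  rewrite ler_pdivlMr// mulrBl -(ler_pM2r p2) mulrBl.
  rewrite (_ : (1 + 2 * a)^-1 * (1 + a) * (1 + 2 * a) = 1 + a); last first.
    by field; rewrite gt_eqF.
  nra.
rewrite ler_norml; apply/andP; split; lra.
Qed.

(** The error is multiplied by r = (1 - x) / (1 + x) and receives (r - e^{-2x}) (A - q). For x <= 1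
    this new term is O(x^2) against a damping 1 - |r| >= x; for x > 1 it is O(1) against a damping
    of at least 1/x. Both balance at O(alpha). No bound on x is imposed, which matters since x is
    the cell thickness divided by a possibly tiny direction cosine. *)
Lemma crank_nicolson_error (M : nat) (al q a A : nat -> R) (alpha Q : R) :
  (forall j, (j < M)%N -> 0 <= al j <= alpha) ->
  (forall j, (j < M)%N -> `|q j| <= Q) ->
  a 0%N = 0 -> A 0%N = 0 -> 0 <= Q -> 0 <= alpha ->
  (forall j, (j < M)%N -> a j.+1 * (1 + al j) = (1 - al j) * a j + 2 * al j * q j) ->
  (forall j, (j < M)%N ->
    A j.+1 = expR (- (2 * al j)) * A j + (1 - expR (- (2 * al j))) * q j) ->
  forall j, (j <= M)%N -> `|A j| <= Q /\ `|a j - A j| <= 4 * Q * alpha.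
Proof.
move=> hal hq a0 A0 Q0 alpha0 ha hA; elim=> [_|j ih jM].
  by rewrite a0 A0 subrr normr0; split => //; rewrite !mulr_ge0.
have [ihA ihe] := ih (ltnW jM).
have /andP[l0 l1] := hal j jM; have qQ := hq j jM.
have p1 : 0 < 1 + al j by lra.
set x := al j in l0 l1 p1 *; set E := expR (- (2 * x)).
have E0 : 0 <= E := expR_ge0 _.
have E1 : E <= 1 by rewrite -expR0 ler_expR oppr_le0 mulr_ge0.
have AE := hA j jM; rewrite -/x -/E in AE; split.
  rewrite AE (le_trans (ler_normD _ _))// !normrM (ger0_norm E0).
  rewrite [`|1 - E|]ger0_norm ?subr_ge0//.
  have := ler_wpM2l E0 ihA; have := ler_wpM2l (_ : 0 <= 1 - E) qQ.
  rewrite subr_ge0 => /(_ E1); lra.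
have aE : a j.+1 = (1 - x) / (1 + x) * a j + (1 - (1 - x) / (1 + x)) * q j.
  have := ha j jM; rewrite -/x => H; apply: (mulIf (lt0r_neq0 p1)); rewrite H; field.
  by rewrite gt_eqF.
set r := (1 - x) / (1 + x) in aE *.
have -> : a j.+1 - A j.+1 = r * (a j - A j) + (r - E) * (A j - q j).
  by rewrite aE AE; ring.
have rE := cayley_exp_le l0; rewrite -/r -/E in rE.
set B := 4 * Q * alpha in ihe *.
have AQ : `|A j - q j| <= 2 * Q by rewrite (le_trans (ler_normB _ _))//; lra.
rewrite (le_trans (ler_normD _ _))// (normrM r) (normrM (r - E)).
suff : `|r| * B + `|r - E| * (2 * Q) <= B.
  apply: le_trans; apply: lerD; first by rewrite ler_wpM2l.
  by rewrite ler_wpM2l.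
have [x1|x1] := leP x 1.
  have r0 : 0 <= r by rewrite divr_ge0 ?subr_ge0// ltW.
  have r1 : x <= 1 - r.
    rewrite /r (_ : 1 - _ = 2 * x / (1 + x)); last by field; rewrite gt_eqF.
    by rewrite ler_pdivlMr//; nra.
  rewrite (ger0_norm r0).
  have h1 : `|r - E| * (2 * Q) <= 2 * x ^+ 2 * (2 * Q) by rewrite ler_wpM2r// mulr_ge0.
  have h2 : x * B <= (1 - r) * B by rewrite ler_wpM2r// !mulr_ge0.
  have h3 : x * (Q * x) <= x * (Q * alpha) by rewrite ler_wpM2l// ler_wpM2l.
  rewrite /B in h2 *; nra.
have r1 : x^-1 <= 1 - `|r|.
  have rn : `|r| = (x - 1) / (1 + x).
    rewrite /r normrM [`|(1 + x)^-1|]ger0_norm ?invr_ge0 ?(ltW p1)//.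
    by rewrite ler0_norm ?opprB// subr_le0 ltW.
  rewrite rn (_ : 1 - _ = 2 / (1 + x)); last by field; rewrite gt_eqF.
  have x0 : 0 < x by lra.
  by rewrite ler_pdivlMr// ler_pdivrMl//; lra.
have r2 : `|r - E| <= 2.
  have : `|r| <= 1 by have : 0 <= x^-1 by [rewrite invr_ge0]; lra.
  by rewrite !ler_norml => /andP[? ?]; apply/andP; split; lra.
have h1 : `|r - E| * (2 * Q) <= 2 * (2 * Q) by rewrite ler_wpM2r// mulr_ge0.
have h2 : x^-1 * B <= (1 - `|r|) * B by rewrite ler_wpM2r// /B !mulr_ge0.
have h3 : 4 * Q <= x^-1 * B.
  have x0 : 0 < x by lra.
  by rewrite [x^-1 * _]mulrC ler_pdivlMr// /B ler_wpM2l// mulr_ge0.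
lra.
Qed.

End crank_nicolson.

(** * Regularity of the scalar flux *)

Section finite_exceptions.
Context {R : realType}.
Notation mu := (@lebesgue_measure R).
Variables (D : set (measurableTypeR R)) (mD : measurable D).

Lemma int_point (p : R) :
  mu.-integrable D (EFin \o (fun y => (y == p)%:R)) /\
  \int[mu]_(y in D) (y == p)%:R = 0.
Proof.
have E : (fun y => (y == p)%:R) = \1_[set p] :> (R -> R).
  apply/funext => y; rewrite indicE; have [->|/eqP yp] := eqVneq y p.
    by rewrite mem_set.
  by rewrite memNset.
have mu0 : mu (D `&` [set p]) = 0%E.
  apply: (@subset_measure0 _ _ _ mu _ [set p]) => //; first exact: measurableI.
  exact: lebesgue_measure_set1.
have I0 : (\int[mu]_(y in D) (\1_[set p] y)%:E = 0)%E.
  by rewrite integral_indic// setIC.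
split; last by rewrite E /Rintegral I0.
apply/integrableP; split.
  by apply/measurable_EFinP; rewrite E; exact: measurable_indic.
under eq_integral do rewrite /= ger0_norm//.
by have := I0; rewrite -E => ->; rewrite ltry.
Qed.

(* The bound may fail at finitely many points; needed because [E1 0 = 0]. *)
Lemma Rint_norm_le_except (s : seq R) (f g : R -> R) : measurable_fun D f ->
  (forall y, D y -> y \notin s -> `|f y| <= g y) -> (forall y, 0 <= g y) ->
  mu.-integrable D (EFin \o g) ->
  mu.-integrable D (EFin \o f) /\
  `|\int[mu]_(y in D) f y| <= \int[mu]_(y in D) g y.
Proof.
move=> mf fg g0 intg; pose g' y := g y + \sum_(p <- s) `|f p| * (y == p)%:R.
have intp p : mu.-integrable D (EFin \o (fun y => `|f p| * (y == p)%:R)).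
  by apply: integrable_ZlR => //; have [] := int_point p.
have ints : mu.-integrable D (EFin \o (fun y => \sum_(p <- s) `|f p| * (y == p)%:R)).
  exact: integrable_sum_fun.
have intg' : mu.-integrable D (EFin \o g') by exact: integrable_DR.
have fg' y : D y -> `|f y| <= g' y.
  have pos (r : seq R) : 0 <= \sum_(p <- r) `|f p| * (y == p)%:R.
    by apply: sumr_ge0 => p _; apply: mulr_ge0.
  move=> Dy; have [ys|ys] := boolP (y \in s); last first.
    by rewrite (le_trans (fg y Dy ys))// lerDl.
  by rewrite /g' (big_rem y)//= eqxx mulr1 addrCA lerDl addr_ge0.
split; first exact: (integrable_le_bound mD mf fg' intg').
rewrite (le_trans (Rint_norm_le mD mf fg' intg'))// RintegralD// Rint_sum//.
rewrite big1 ?addr0// => p _; have [H1 H2] := int_point p.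
by rewrite RintegralZl// H2 mulr0.
Qed.

End finite_exceptions.

Section measurability.
Context {R : realType}.

Lemma measurable_oo_cc (f : R -> R) (a b : R) :
  (forall y, a < y < b -> {for y, continuous f}) ->
  measurable_fun (`[a, b]%classic : set R) f.
Proof.
move=> cf; have [ab|ba] := leP a b; last first.
  by rewrite set_itv_ge ?bnd_simp -?ltNge//; exact: measurable_fun_set0.
have mo : measurable_fun (`]a, b[%classic : set R) f.
  apply: open_continuous_measurable_fun => // y; rewrite inE/= in_itv/=.
  exact: cf.
exact/measurable_fun_itv_bndo_bndcP/measurable_fun_itv_obnd_cbndP.
Qed.

Lemma measurable_cc_cat (f : R -> R) (a b c : R) : a <= b -> b <= c ->
  measurable_fun (`[a, b]%classic : set R) f ->
  measurable_fun (`[b, c]%classic : set R) f ->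
  measurable_fun (`[a, c]%classic : set R) f.
Proof.
move=> ab bc m1 m2.
have -> : `[a, c]%classic = `[a, b]%classic `|` `[b, c]%classic :> set R.
  apply/seteqP; split => x /=; rewrite !in_itv/=.
    move=> /andP[ax xc]; have [xb|bx] := leP x b; first by left; rewrite ax.
    by right; rewrite ltW.
  move=> [/andP[-> xb]|/andP[bx ->]]; first by rewrite (le_trans xb).
  by rewrite andbT (le_trans ab).
by apply/measurable_funU.
Qed.

End measurability.

Section optical_depth.
Context {R : realType}.
Notation mu := (@lebesgue_measure R).

Lemma integrable_cst_itv (c a b : R) : mu.-integrable `[a, b] (EFin \o (fun=> c)).
Proof. by apply: cont_integrable; apply: continuous_within_itv => x; exact: cvg_cst. Qed.

Notation I := (`[0, 1]%classic : set R).
Variables (sigma : R -> R) (m S : R).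
Hypothesis m_gt0 : 0 < m.
Hypothesis msigma : measurable_fun I sigma.
Hypothesis sigma_bnd : forall x, 0 <= x <= 1 -> m <= sigma x <= S.

Let mS : m <= S.
Proof. by have /andP[h1 h2] := @sigma_bnd 0 (ltac:(by rewrite lexx ler01)); exact: le_trans h2. Qed.

Lemma integrable_sigma a b : 0 <= a -> b <= 1 ->
  mu.-integrable `[a, b] (EFin \o sigma).
Proof.
move=> a0 b1; apply: (@integrable_sub_itv _ _ 0 1) => //.
apply: (@integrable_le_bound _ _ _ mu _ _ _ (fun=> S)) => //; last exact: integrable_cst_itv.
move=> x /=; rewrite in_itv/= => /sigma_bnd/andP[h1 h2].
by rewrite ger0_norm// (le_trans _ h1)// ltW.
Qed.

Lemma Rint_cst_itv (c a b : R) : a <= b -> \int[mu]_(x in `[a, b]) c = c * (b - a).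
Proof.
rewrite le_eqVlt => /predU1P[->|ab]; first by rewrite set_itv1 Rintegral_set1 subrr mulr0.
by rewrite Rintegral_cst ?measurable_itv//= lebesgue_measure_itv/= lte_fin ab.
Qed.

Lemma int_sigma_bnd a b : 0 <= a -> a <= b -> b <= 1 ->
  m * (b - a) <= \int[mu]_(x in `[a, b]) sigma x <= S * (b - a).
Proof.
move=> a0 ab b1; rewrite -!(Rint_cst_itv _ ab); apply/andP; split.
  apply: le_Rintegral => //; [exact: integrable_cst_itv|exact: integrable_sigma|].
  move=> x /=; rewrite in_itv/= => /andP[ax xb].
  by have /andP[] := @sigma_bnd x (ltac:(by rewrite (le_trans a0 ax) (le_trans xb b1))).
apply: le_Rintegral => //; [exact: integrable_sigma|exact: integrable_cst_itv|].
move=> x /=; rewrite in_itv/= => /andP[ax xb].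
by have /andP[] := @sigma_bnd x (ltac:(by rewrite (le_trans a0 ax) (le_trans xb b1))).
Qed.

Definition depth (x : R) : R := \int[mu]_(y in `[0, x]) sigma y.

Lemma depthB a b : 0 <= a -> a <= b -> b <= 1 ->
  depth b - depth a = \int[mu]_(x in `[a, b]) sigma x.
Proof.
move=> a0 ab b1; rewrite /depth (@Rint_split _ sigma 0 b a)//; last exact: integrable_sigma.
by rewrite addrAC subrr add0r.
Qed.

Lemma tauE x y : 0 <= x <= 1 -> 0 <= y <= 1 -> tau sigma x y = depth y - depth x.
Proof.
move=> /andP[x0 x1] /andP[y0 y1]; rewrite /tau.
have [xy|/ltW yx] := leP x y; first by rewrite depthB.
by rewrite -depthB// opprB.
Qed.

Lemma tau_bnd x y : 0 <= x <= 1 -> 0 <= y <= 1 ->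
  m * `|x - y| <= `|tau sigma x y| <= S * `|x - y|.
Proof.
move=> x01 y01; rewrite tauE//; wlog xy : x y x01 y01 / x <= y.
  move=> H; have [|/ltW yx] := leP x y; first exact: H.
  by rewrite distrC [`|_ - depth x|]distrC; exact: H.
move: x01 y01 => /andP[x0 x1] /andP[y0 y1].
have /andP[h1 h2] := int_sigma_bnd x0 xy y1.
rewrite depthB// distrC ger0_norm ?subr_ge0// ger0_norm ?h1//.
by rewrite (le_trans _ h1)// mulr_ge0 ?subr_ge0// ltW.
Qed.

Lemma depth_lip x y : 0 <= x <= 1 -> 0 <= y <= 1 ->
  `|depth x - depth y| <= S * `|x - y|.
Proof. by move=> x01 y01; have /andP[_] := tau_bnd x01 y01; rewrite tauE// distrC. Qed.

Lemma depth_cts y : 0 < y < 1 -> {for y, continuous depth}.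
Proof.
move=> /andP[y0 y1]; have S0 : 0 < S by exact: lt_le_trans mS.
apply/cvgrPdist_le => /= e e0; near=> z.
have zy : `|y - z| < Num.min (Num.min y (1 - y)) (e / S).
  near: z; apply/nbhs_ballP; exists (Num.min (Num.min y (1 - y)) (e / S)) => //=.
  by rewrite !lt_min y0 subr_gt0 y1 divr_gt0.
move: zy; rewrite !lt_min => /andP[/andP[h1 h2] h3].
have z01 : 0 <= z <= 1.
  by move: h1 h2 => /ltr_normlP[? ?] /ltr_normlP[? ?]; apply/andP; split; lra.
rewrite (le_trans (depth_lip _ z01))// ?(ltW y0) ?(ltW y1)//.
by rewrite mulrC -ler_pdivlMr// ltW.
Unshelve. all: end_near. Qed.

Lemma E1_tau_measurable x : 0 <= x <= 1 ->
  measurable_fun I (fun y => E1 `|tau sigma x y|).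
Proof.
move=> x01; have cf y : 0 < y < 1 -> y != x ->
    {for y, continuous (fun y => E1 `|depth y - depth x|)}.
  move=> y01 yx; have y01' : 0 <= y <= 1 by case/andP: y01 => ? ?; rewrite !ltW.
  apply: (@continuous_comp _ _ _ (fun y => `|depth y - depth x|) (@E1 R)).
    by apply: cvg_norm; apply: cvgB; [exact: depth_cts|exact: cvg_cst].
  apply: E1_cts; have /andP[h _] := tau_bnd x01 y01'.
  rewrite -tauE//; apply: lt_le_trans h.
  by rewrite mulr_gt0// normr_gt0 subr_eq0 eq_sym.
apply: (eq_measurable_fun (fun y => E1 `|depth y - depth x|)).
  by move=> y; rewrite inE/= in_itv/= => y01; rewrite tauE.
have /andP[x0 x1] := x01.
apply: (@measurable_cc_cat _ _ 0 x 1) => //.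
  apply: measurable_oo_cc => y /andP[y0 yx]; apply: cf; last by rewrite lt_eqF.
  by rewrite y0 (lt_le_trans yx).
apply: measurable_oo_cc => y /andP[xy y1]; apply: cf; last by rewrite gt_eqF.
by rewrite y1 (le_lt_trans x0).
Qed.

Lemma subr_split (p q r s : R) : p - q = (p - r) - (q - s) + (r - s).
Proof. by ring. Qed.

Section flux_regularity.
Variables (N : nat) (node weight : 'I_N -> R) (C0 : R).
Hypothesis node_gt0 : forall k, 0 < node k.
Hypothesis weight_gt0 : forall k, 0 < weight k.
Hypothesis C0_ge0 : 0 <= C0.
Hypothesis quad : forall z, 0 < z ->
  `|E1 z - quad_kernel node weight z| <= C0 / Num.sqrt z.
Variables (g phi : R -> R) (Gam : R).
Hypothesis mg : measurable_fun I g.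
Hypothesis g_bnd : forall x, 0 <= x <= 1 -> `|g x| <= Gam.
Hypothesis phiE : forall x, 0 <= x <= 1 ->
  phi x = 2^-1 * \int[mu]_(y in I) (E1 `|tau sigma x y| * g y).

Let K := quad_kernel node weight.
Let L := \sum_k weight k / node k.

Lemma quad_kernel_bnd z : 0 <= z -> 0 <= K z <= L.
Proof.
move=> z0; apply/andP; split.
  by apply: sumr_ge0 => k _; rewrite mulr_ge0 ?expR_ge0// divr_ge0// ltW.
apply: ler_sum => k _; rewrite ler_piMr ?divr_ge0 ?(ltW (weight_gt0 k)) ?(ltW (node_gt0 k))//.
by rewrite -[leRHS]expR0 ler_expR oppr_le0 divr_ge0// ltW.
Qed.

Lemma quad_at_tau x y : 0 <= x <= 1 -> 0 <= y <= 1 -> x != y ->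
  `|E1 `|tau sigma x y| - K `|tau sigma x y| | <=
  C0 / Num.sqrt m * (Num.sqrt `|x - y|)^-1.
Proof.
move=> x01 y01 xy; have /andP[h _] := tau_bnd x01 y01.
have p : 0 < m * `|x - y| by rewrite mulr_gt0// normr_gt0 subr_eq0.
have p' := lt_le_trans p h.
rewrite (le_trans (quad p'))// -mulrA -invfM ler_wpM2l//.
rewrite -sqrtrM ?(ltW m_gt0)// lef_pV2 ?posrE ?sqrtr_gt0//.
by rewrite ler_wsqrtr.
Qed.

Let Gam0 : 0 <= Gam.
Proof. by apply: le_trans (@g_bnd 0 _) => //; rewrite lexx ler01. Qed.

Let L0 : 0 <= L.
Proof. by apply: sumr_ge0 => k _; rewrite divr_ge0// ltW. Qed.

(** The quadrature estimate itself provides the majorant: [E1] is at most the bounded quadrature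
    kernel plus a multiple of the integrable inverse square root. *)
Lemma integrable_E1_tau x : 0 <= x <= 1 ->
  mu.-integrable I (EFin \o (fun y => E1 `|tau sigma x y| * g y)).
Proof.
move=> x01; have [intd _] := int_inv_sqrt_dist x01.
have := @Rint_norm_le_except _ I (measurable_itv _) [:: x]
  (fun y => E1 `|tau sigma x y| * g y)
  (fun y => Gam * (C0 / Num.sqrt m * (Num.sqrt `|x - y|)^-1 + L)).
case=> //.
- by apply: measurable_funM => //; exact: E1_tau_measurable.
- move=> y /=; rewrite in_itv/= inE => y01 yx.
  rewrite normrM mulrC; apply: ler_pM => //; first exact: g_bnd.
  rewrite -[X in `|X|](subrK (K `|tau sigma x y|)) (le_trans (ler_normD _ _))//.
  apply: lerD; first by apply: quad_at_tau => //; rewrite eq_sym.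
  have /andP[k0 k1] := quad_kernel_bnd (normr_ge0 (tau sigma x y)).
  by rewrite ger0_norm.
- move=> y; rewrite mulr_ge0// addr_ge0// mulr_ge0 ?invr_ge0 ?sqrtr_ge0//.
  by rewrite divr_ge0 ?sqrtr_ge0.
- apply: integrable_ZlR => //; apply: integrable_DR => //; last exact: integrable_cst_itv.
  exact: integrable_ZlR.
Qed.

(** Keeping both exponentials makes the bound symmetric in the two points, so that no order of the
    depths has to be tracked under the integral. *)
Lemma exp_diff_le (t a b c d : R) : 0 <= t -> c <= a -> d <= b ->
  `|expR (- (t * a)) - expR (- (t * b))| <=
  t * `|a - b| * (expR (- (t * c)) + expR (- (t * d))).
Proof.
move=> t0; wlog ab : a b c d / a <= b.
  move=> H ca db; have [ab|/ltW ba] := leP a b; first exact: H.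
  by rewrite distrC [`|a - b|]distrC [expR (- (t * c)) + _]addrC; apply: H.
move=> ca db; rewrite ger0_norm; last by rewrite subr_ge0 ler_expR lerN2 ler_wpM2l.
rewrite distrC ger0_norm ?subr_ge0//.
have -> : expR (- (t * b)) = expR (- (t * a)) * expR (- (t * (b - a))).
  by rewrite -expRD; congr expR; ring.
have h1 := expR_ge1Dx (- (t * (b - a))).
have h2 : expR (- (t * a)) <= expR (- (t * c)) by rewrite ler_expR lerN2 ler_wpM2l.
have h3 := expR_ge0 (- (t * a)); have h4 := expR_ge0 (- (t * d)).
have h5 : 0 <= t * (b - a) by rewrite mulr_ge0// subr_ge0.
move: (expR (- (t * a))) (expR (- (t * c))) (expR (- (t * d))) (expR _) (t * (b - a)) h1 h2 h3 h4 h5.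
by move=> A C D E F *; nra.
Qed.

(** At both points [E1] is replaced by the quadrature kernel, at the cost of two inverse square
    roots with integral at most 8 each. The difference of the two kernels is then a sum of
    differences of exponentials, where [exp_diff_le] and [int_exp_dist] give 4 / m per direction.
    The prefactor 1/2 halves 16 and 4. *)
Lemma flux_modulus x x' : 0 <= x <= 1 -> 0 <= x' <= 1 ->
  `|phi x - phi x'| <=
  Gam * (8 * C0 / Num.sqrt m + 2 * (S / m) * `|x - x'| * L).
Proof.
move=> x01 x'01; rewrite !phiE// -mulrBr -RintegralB//; try exact: integrable_E1_tau.
rewrite normrM ger0_norm ?invr_ge0//.
have [intx Ix] := int_inv_sqrt_dist x01; have [intx' Ix'] := int_inv_sqrt_dist x'01.
have intE z t : 0 <= z <= 1 ->
   mu.-integrable I (EFin \o (fun y => t * expR (- (t * (m * `|z - y|))))).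
  move=> z01; apply: cont_integrable; apply: continuous_within_itv.
  have -> : (fun y => t * expR (- (t * (m * `|z - y|)))) =
      (fun y => m^-1 * (t * m * expR (- (t * m * `|z - y|)))).
    apply/funext => y; rewrite [in RHS]mulrA [m^-1 * _]mulrCA mulVf ?mulr1 ?gt_eqF//.
    by rewrite mulrA.
  by move=> y; apply: cvgMr; exact: continuous_exp_dist.
pose t k := (node k)^-1.
have t0 k : 0 < t k by rewrite invr_gt0.
pose E k (z y : R) := t k * expR (- (t k * (m * `|z - y|))).
pose cc := C0 / Num.sqrt m.
have cc0 : 0 <= cc by rewrite divr_ge0 ?sqrtr_ge0.
have S0 : 0 <= S by rewrite (le_trans _ mS)// ltW.
pose G y := Gam * (cc * ((Num.sqrt `|x - y|)^-1 + (Num.sqrt `|x' - y|)^-1) +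
   \sum_k weight k * t k * (S * `|x - x'|) * (E k x y + E k x' y)).
have E0 k z y : 0 <= E k z y by rewrite mulr_ge0 ?expR_ge0// ltW.
have ck0 k : 0 <= weight k * t k * (S * `|x - x'|).
  by rewrite mulr_ge0 ?mulr_ge0// ltW.
have intEk k : mu.-integrable I (EFin \o (fun y => E k x y + E k x' y)).
  by apply: integrable_DR => //; exact: intE.
have int1 : mu.-integrable I (EFin \o
    (fun y => (Num.sqrt `|x - y|)^-1 + (Num.sqrt `|x' - y|)^-1)).
  exact: integrable_DR.
have int2 : mu.-integrable I (EFin \o
    (fun y => \sum_k weight k * t k * (S * `|x - x'|) * (E k x y + E k x' y))).
  by apply: integrable_sum_fun => // k _; exact: integrable_ZlR.
have int1' : mu.-integrable I (EFin \o
    (fun y => cc * ((Num.sqrt `|x - y|)^-1 + (Num.sqrt `|x' - y|)^-1))).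
  exact: integrable_ZlR.
have intG : mu.-integrable I (EFin \o G).
  by apply: integrable_ZlR => //; exact: integrable_DR.
have := @Rint_norm_le_except _ I (measurable_itv _) [:: x; x']
  (fun y => E1 `|tau sigma x y| * g y - E1 `|tau sigma x' y| * g y) G.
case=> //.
- by apply: measurable_funB; apply: measurable_funM => //; exact: E1_tau_measurable.
- move=> y /=; rewrite in_itv/= !inE negb_or => y01 /andP[yx yx'].
  rewrite -mulrBl normrM mulrC; apply: ler_pM => //; first exact: g_bnd.
  set a : R := `|tau sigma x y|; set b : R := `|tau sigma x' y|.
  rewrite (subr_split (E1 a) (E1 b) (K a) (K b)).
  rewrite (le_trans (ler_normD _ _))// lerD//.
    rewrite (le_trans (ler_normB _ _))// mulrDr lerD//.
      by apply: quad_at_tau => //; rewrite eq_sym.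
    by apply: quad_at_tau => //; rewrite eq_sym.
  rewrite /K /quad_kernel -sumrB (le_trans (ler_norm_sum _ _ _))//; apply: ler_sum => k _.
  rewrite -mulrBr normrM ger0_norm ?divr_ge0 ?(ltW (weight_gt0 k)) ?(ltW (node_gt0 k))//.
  rewrite -!mulrA ler_wpM2l ?(ltW (weight_gt0 k))// ler_wpM2l ?(ltW (t0 k))//.
  rewrite ![_ / node k]mulrC -/(t k).
  have ha : m * `|x - y| <= a by have /andP[] := tau_bnd x01 y01.
  have hb : m * `|x' - y| <= b by have /andP[] := tau_bnd x'01 y01.
  apply: (le_trans (exp_diff_le (ltW (t0 k)) ha hb)).
  have ab : `|a - b| <= S * `|x - x'|.
    rewrite (le_trans (ler_dist_dist _ _))// !tauE//.
    rewrite (_ : depth y - depth x - _ = depth x' - depth x); last by ring.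
    by rewrite distrC; exact: depth_lip.
  rewrite (_ : S * (`|x - x'| * _) = t k * (S * `|x - x'|) *
    (expR (- (t k * (m * `|x - y|))) + expR (- (t k * (m * `|x' - y|))))); last first.
    by rewrite /E; ring.
  by rewrite ler_wpM2r ?addr_ge0 ?expR_ge0// ler_wpM2l// ltW.
- move=> y; rewrite mulr_ge0// addr_ge0//.
    by rewrite mulr_ge0// addr_ge0// invr_ge0 sqrtr_ge0.
  by apply: sumr_ge0 => k _; rewrite mulr_ge0// addr_ge0.
move=> _ H; apply: (@le_trans _ _ (2^-1 * \int[mu]_(y in I) G y)).
  by rewrite ler_wpM2l// invr_ge0.
rewrite /G RintegralZl//; last exact: integrable_DR.
rewrite RintegralD// RintegralZl// RintegralD// Rint_sum//; last first.
  by move=> k; exact: integrable_ZlR.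
rewrite mulrCA ler_wpM2l//.
have b1 : cc * (\int[mu]_(y in I) (Num.sqrt `|x - y|)^-1 +
   \int[mu]_(y in I) (Num.sqrt `|x' - y|)^-1) <= cc * 16.
  by rewrite ler_wpM2l//; lra.
have b2 : \sum_k \int[mu]_(y in I) (weight k * t k * (S * `|x - x'|) * (E k x y + E k x' y)) <=
    4 * (S / m) * `|x - x'| * L.
  rewrite /L mulr_sumr; apply: ler_sum => k _.
  rewrite RintegralZl// RintegralD//; try exact: intE.
  have := int_exp_dist (t k) m_gt0 x01; have := int_exp_dist (t k) m_gt0 x'01.
  rewrite -/(E k x) => e1 e2.
  apply: (@le_trans _ _ (weight k * t k * (S * `|x - x'|) * (2 / m + 2 / m))).
    by rewrite ler_wpM2l// lerD.
  by rewrite le_eqVlt /t; apply/orP; left; apply/eqP; ring.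
rewrite mulrDr (_ : 8 * C0 / Num.sqrt m = 8 * cc); last by rewrite mulrA.
lra.
Qed.

End flux_regularity.
End optical_depth.

(** * Consistency at the mesh nodes *)

Section partition_geometry.
Context {R : realType}.
Notation mu := (@lebesgue_measure R).
Variable xs : seq R.
Hypothesis xs_part : itv_partition 0 1 xs.

Lemma pt0 : pt xs 0 = 0. Proof. by []. Qed.

Lemma pt_size : pt xs (size xs) = 1.
Proof. by rewrite /pt (itv_partition_nth_size _ xs_part). Qed.

Lemma pt_lt j : (j < size xs)%N -> pt xs j < pt xs j.+1.
Proof. by move=> jM; case: xs_part => /(pathP 1)/(_ j jM). Qed.

Lemma pt_le i j : (i <= j)%N -> (j <= size xs)%N -> pt xs i <= pt xs j.
Proof.
elim: j => [|j ih]; first by rewrite leqn0 => /eqP ->.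
rewrite leq_eqVlt => /predU1P[-> //|]; rewrite ltnS => ij jM.
by rewrite (le_trans (ih ij (ltnW jM)))// ltW// pt_lt.
Qed.

Lemma pt01 j : (j <= size xs)%N -> 0 <= pt xs j <= 1.
Proof. by move=> jM; rewrite -{1}pt0 pt_le//= -pt_size pt_le. Qed.

Lemma step_gt0 j : (j < size xs)%N -> 0 < step xs j.
Proof. by move=> jM; rewrite subr_gt0 pt_lt. Qed.

Lemma step_le_diam j : (j < size xs)%N -> step xs j <= diam xs.
Proof. by move=> jM; rewrite /diam (bigD1 (Ordinal jM))//= le_max lexx. Qed.

Lemma mid_in_cell j : (j < size xs)%N -> pt xs j < mid xs j < pt xs j.+1.
Proof. by move=> /pt_lt; rewrite /mid => h; apply/andP; split; lra. Qed.

Lemma size_part_gt0 : (0 < size xs)%N.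
Proof.
have := pt_size; case: (size xs) => // /eqP.
by rewrite pt0 eq_sym oner_eq0.
Qed.

Lemma diam_gt0 : 0 < diam xs.
Proof. exact: lt_le_trans (step_gt0 size_part_gt0) (step_le_diam size_part_gt0). Qed.

Lemma Rint_cells (f : R -> R) : mu.-integrable `[0, 1] (EFin \o f) ->
  \int[mu]_(y in `[0, 1]) f y =
  \sum_(j < size xs) \int[mu]_(y in `[pt xs j, pt xs j.+1]) f y.
Proof.
move=> intf; have H n : (n <= size xs)%N -> \int[mu]_(y in `[0, pt xs n]) f y =
    \sum_(j < n) \int[mu]_(y in `[pt xs j, pt xs j.+1]) f y.
  elim: n => [_|n ih nM]; first by rewrite big_ord0 pt0 set_itv1 Rintegral_set1.
  have /andP[p0 _] := pt01 (ltnW nM); have /andP[_ p1] := pt01 nM.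
  rewrite big_ord_recr/= -ih ?(ltnW nM)//; apply: Rint_split => //.
    exact/ltW/pt_lt.
  exact: integrable_sub_itv intf.
by rewrite -H// pt_size.
Qed.

Lemma cell_index_exists x : 0 <= x -> x < 1 ->
  exists2 j, (j < size xs)%N & pt xs j <= x < pt xs j.+1.
Proof.
move=> x0 x1; have H n : (n <= size xs)%N -> x < pt xs n ->
    exists2 j, (j < size xs)%N & pt xs j <= x < pt xs j.+1.
  elim: n => [_|n ih nM xn]; first by rewrite pt0 ltNge x0.
  have [nx|xn'] := leP (pt xs n) x; last exact: ih (ltnW nM) xn'.
  by exists n => //; rewrite nx.
by apply: (H (size xs)) => //; rewrite pt_size.
Qed.

End partition_geometry.

Section node_consistency.
Context {R : realType}.
Notation mu := (@lebesgue_measure R).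
Notation I := (`[0, 1]%classic : set R).
Variable xs : seq R.
Hypothesis xs_part : itv_partition 0 1 xs.
Variables (sigma : R -> R) (m S delta : R).
Hypothesis m_gt0 : 0 < m.
Hypothesis msigma : measurable_fun I sigma.
Hypothesis sigma_bnd : forall x, 0 <= x <= 1 -> m <= sigma x <= S.
Hypothesis delta_ge0 : 0 <= delta.

Let M := size xs.
Let x_ := pt xs.
Let sg j := sigma (mid xs j).

Hypothesis sigma_osc : forall j y, (j < M)%N -> x_ j < y < x_ j.+1 ->
  `|sigma y - sg j| <= delta.

Let mid01 j : (j < M)%N -> 0 <= mid xs j <= 1.
Proof.
move=> jM; have /andP[h1 h2] := mid_in_cell xs_part jM.
have /andP[h3 _] := pt01 xs_part (ltnW jM); have /andP[_ h4] := pt01 xs_part jM.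
by apply/andP; split; [exact: le_trans (ltW h1)|exact: le_trans (ltW h2) _].
Qed.

Let sg_bnd j : (j < M)%N -> m <= sg j <= S.
Proof. by move=> jM; exact/sigma_bnd/mid01. Qed.

Let sg_gt0 j : (j < M)%N -> 0 < sg j.
Proof. by move=> /sg_bnd/andP[h _]; exact: lt_le_trans h. Qed.

Definition mesh_depth j := \sum_(l < j) sg l * step xs l.
Notation Th := mesh_depth.

Lemma mesh_depthS j : Th j.+1 = Th j + sg j * step xs j.
Proof. by rewrite /Th big_ord_recr. Qed.

Lemma depth_cell j a b : (j < M)%N -> x_ j <= a -> a <= b -> b <= x_ j.+1 ->
  `|depth sigma b - depth sigma a - sg j * (b - a)| <= delta * (b - a).
Proof.
move=> jM ja ab bj.
have /andP[x0 _] := pt01 xs_part (ltnW jM); have /andP[_ x1] := pt01 xs_part jM.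
have a0 : 0 <= a := le_trans x0 ja; have b1 : b <= 1 := le_trans bj x1.
rewrite (depthB m_gt0 msigma sigma_bnd)// -!(Rint_cst_itv _ ab).
have ints := integrable_sigma m_gt0 msigma sigma_bnd a0 b1.
have intc := integrable_cst_itv (sg j) a b.
rewrite -RintegralB//.
have := @Rint_norm_le_except _ `[a, b]%classic (measurable_itv _) [:: a; b]
  (fun y => sigma y - sg j) (fun=> delta).
case=> //.
- by have /measurable_int/measurable_EFinP := @integrable_BR _ _ _ mu _ (measurable_itv _) _ _ ints intc.
- move=> y /=; rewrite in_itv/= !inE negb_or => /andP[ay yb] /andP[ya yb'].
  apply: sigma_osc => //; apply/andP; split.
    by rewrite (le_lt_trans ja)// lt_neqAle eq_sym ya.
  by rewrite (lt_le_trans _ bj)// lt_neqAle yb'.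
- exact: integrable_cst_itv.
Qed.

Lemma depth_nodes i j : (i <= j)%N -> (j <= M)%N ->
  `|(depth sigma (x_ j) - depth sigma (x_ i)) - (Th j - Th i)| <= delta * (x_ j - x_ i) /\
  m * (x_ j - x_ i) <= Th j - Th i.
Proof.
elim: j => [|j ih].
  by rewrite leqn0 => /eqP -> _; rewrite !subrr normr0 !mulr0.
rewrite leq_eqVlt => /predU1P[-> _|]; first by rewrite !subrr normr0 !mulr0.
rewrite ltnS => ij jM; have [h1 h2] := ih ij (ltnW jM).
have lt := pt_lt xs_part jM; rewrite -/(x_ j) -/(x_ j.+1) in lt.
have h3 := depth_cell jM (lexx _) (ltW lt) (lexx _).
have /andP[h4 _] := sg_bnd jM.
have h5 : m * (x_ j.+1 - x_ j) <= sg j * (x_ j.+1 - x_ j).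
  by rewrite ler_wpM2r// subr_ge0 ltW.
rewrite mesh_depthS /step -/(x_ j) -/(x_ j.+1); split; last by lra.
move: h1 h3; move: (depth sigma _) (depth sigma _) (depth sigma _) => D1 D2 D3.
move: (sg j * _) (Th j) (Th i) => s T1 T2 h1 h3.
rewrite (_ : D1 - D2 - _ = (D3 - D2 - (T1 - T2)) + (D1 - D3 - s)); last by ring.
rewrite (le_trans (ler_normD _ _))//; lra.
Qed.

(** The signed optical depth from node [i] to a point [y] of cell [j], for the coefficient frozen at
    the midpoints. *)
Definition cell_depth i j y := Th j + sg j * (y - x_ j) - Th i.

(** Both bounds are proportional to the distance, so that [E1_lip] turns them into delta / m however
    close [y] is to the node. *)
Lemma cell_depth_approx i j y : (i <= M)%N -> (j < M)%N -> x_ j <= y <= x_ j.+1 ->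
  `|(depth sigma y - depth sigma (x_ i)) - cell_depth i j y| <= delta * `|x_ i - y| /\
  m * `|x_ i - y| <= `|cell_depth i j y|.
Proof.
move=> iM jM /andP[jy yj]; have /andP[h4 _] := sg_bnd jM; rewrite /cell_depth.
have lt := pt_lt xs_part jM; rewrite -/(x_ j) -/(x_ j.+1) in lt.
have [ij|ji] := leqP i j.
  have [h1 h2] := depth_nodes ij (ltnW jM).
  have h3 := depth_cell jM (lexx _) jy yj.
  have h5 : m * (y - x_ j) <= sg j * (y - x_ j) by rewrite ler_wpM2r// subr_ge0.
  have xi : x_ i <= x_ j by apply: pt_le => //; exact: ltnW.
  have -> : `|x_ i - y| = y - x_ i.
    by rewrite distrC ger0_norm// subr_ge0 (le_trans xi).
  split; last by rewrite (le_trans _ (ler_norm _))//; lra.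
  move: h1 h3; move: (depth sigma _) (depth sigma _) (depth sigma _) => D1 D2 D3.
  move: (sg j * _) (Th j) (Th i) => s T1 T2 h1 h3.
  rewrite (_ : D1 - D2 - _ = (D3 - D2 - (T1 - T2)) + (D1 - D3 - s)); last by ring.
  rewrite (le_trans (ler_normD _ _))//; lra.
have [h1 h2] := depth_nodes ji iM.
have h3 := depth_cell jM jy yj (lexx _).
have h5 : m * (x_ j.+1 - y) <= sg j * (x_ j.+1 - y) by rewrite ler_wpM2r// subr_ge0.
have xi : x_ j.+1 <= x_ i by apply: pt_le.
have -> : `|x_ i - y| = x_ i - y by rewrite ger0_norm// subr_ge0 (le_trans yj).
have TE := mesh_depthS j; rewrite /step -/(x_ j) -/(x_ j.+1) in TE.
split; last first.
  by rewrite -normrN (le_trans _ (ler_norm _))//; lra.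
have -> : Th j + sg j * (y - x_ j) = Th j.+1 - sg j * (x_ j.+1 - y) by rewrite TE; ring.
move: h1 h3; move: (depth sigma _) (depth sigma _) (depth sigma _) => D1 D2 D3.
move: (sg j * _) (Th j.+1) (Th i) => s T1 T2 h1 h3.
rewrite (_ : D1 - D3 - _ = - ((D3 - D2 - (T2 - T1)) + (D2 - D1 - s))); last by ring.
by rewrite normrN (le_trans (ler_normD _ _))//; lra.
Qed.

(** The exact angular flux at node [i] in direction 1/t, with coefficient frozen on each cell,
    source-to-coefficient ratio [q j] and no inflow from the left. [backward_flux] is its
    counterpart for the opposite direction, without inflow from the right. *)
Definition forward_flux (t : R) (q : nat -> R) i :=
  \sum_(j < i) q j * (expR (- (t * (Th i - Th j.+1))) - expR (- (t * (Th i - Th j)))).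

Definition backward_flux (t : R) (q : nat -> R) i :=
  \sum_(i <= j < M) q j * (expR (- (t * (Th j - Th i))) - expR (- (t * (Th j.+1 - Th i)))).

Lemma forward_fluxS t q i : forward_flux t q i.+1 =
  expR (- (t * (sg i * step xs i))) * forward_flux t q i +
  (1 - expR (- (t * (sg i * step xs i)))) * q i.
Proof.
rewrite /forward_flux big_ord_recr/= subrr mulr0 oppr0 expR0 mulr_sumr; congr (_ + _).
  apply: eq_bigr => j _; rewrite mulrCA; congr (_ * _).
  by rewrite [RHS]mulrBr -!expRD mesh_depthS; congr (expR _ - expR _); ring.
by rewrite mulrC mesh_depthS; congr ((1 - expR _) * _); ring.
Qed.

Lemma backward_fluxS t q i : (i < M)%N -> backward_flux t q i =
  expR (- (t * (sg i * step xs i))) * backward_flux t q i.+1 +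
  (1 - expR (- (t * (sg i * step xs i)))) * q i.
Proof.
move=> iM; rewrite /backward_flux big_ltn// subrr mulr0 oppr0 expR0 mulr_sumr addrC.
congr (_ + _); last by rewrite mulrC mesh_depthS; congr ((1 - expR _) * _); ring.
apply: eq_bigr => j _; rewrite mulrCA; congr (_ * _).
by rewrite [RHS]mulrBr -!expRD [Th i.+1]mesh_depthS; congr (expR _ - expR _); ring.
Qed.

Let Th_le i j : (i <= j)%N -> (j <= M)%N -> Th i <= Th j.
Proof.
move=> ij jM; have [_] := depth_nodes ij jM.
rewrite -(subr_ge0 (Th i)); apply: le_trans.
by rewrite mulr_ge0 ?(ltW m_gt0)// subr_ge0 pt_le.
Qed.

Definition cell_weight (t : R) i j : R :=
  if (i <= j)%N then expR (- (t * (Th j - Th i))) - expR (- (t * (Th j.+1 - Th i)))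
  else expR (- (t * (Th i - Th j.+1))) - expR (- (t * (Th i - Th j))).

Lemma cell_weight_sum t (q : nat -> R) i : (i <= M)%N ->
  \sum_(j < M) q j * cell_weight t i j = forward_flux t q i + backward_flux t q i.
Proof.
move=> iM; rewrite -(big_mkord xpredT (fun j => q j * cell_weight t i j)).
rewrite (big_cat_nat (leq0n i) iM)/= big_mkord; congr (_ + _).
  by apply: eq_bigr => j _; rewrite /cell_weight leqNgt ltn_ord.
by apply: eq_big_nat => j /andP[ij _]; rewrite /cell_weight ij.
Qed.

(** On either side of the node the sum telescopes to at most 1. With total weight 1 and the
    prefactor 1/2 of the scalar flux, an error in the source is passed on with constant exactly
    1. *)
Lemma cell_weight_total t i : 0 <= t -> (i <= M)%N ->
  \sum_(j < M) cell_weight t i j <= 2.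
Proof.
move=> t0 iM; have := cell_weight_sum t (fun=> 1) iM.
under eq_bigr do rewrite mul1r.
move=> ->; rewrite /forward_flux /backward_flux.
under eq_bigr do rewrite mul1r; under [X in _ + X]eq_bigr do rewrite mul1r.
have h1 : \sum_(j < i) (expR (- (t * (Th i - Th j.+1))) - expR (- (t * (Th i - Th j)))) <= 1.
  rewrite -(big_mkord xpredT (fun j => expR (- (t * (Th i - Th j.+1))) - expR (- (t * (Th i - Th j))))).
  rewrite telescope_sumr// subrr mulr0 oppr0 expR0 lerBlDr lerDl expR_ge0//.
have h2 : \sum_(i <= j < M) (expR (- (t * (Th j - Th i))) - expR (- (t * (Th j.+1 - Th i)))) <= 1.
  rewrite (eq_bigr (fun j => - expR (- (t * (Th j.+1 - Th i))) - - expR (- (t * (Th j - Th i))))); last first.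
    by move=> j _; rewrite opprK addrC.
  rewrite telescope_sumr// subrr mulr0 oppr0 expR0 opprK addrC lerBlDr lerDl expR_ge0//.
lra.
Qed.

Lemma int_cell_exp t i j : (i <= M)%N -> (j < M)%N ->
  \int[mu]_(y in `[x_ j, x_ j.+1]) (t * expR (- (t * `|cell_depth i j y|))) =
  cell_weight t i j / sg j.
Proof.
move=> iM jM; have s0 := sg_gt0 jM.
have lt := pt_lt xs_part jM; rewrite -/(x_ j) -/(x_ j.+1) in lt.
have TE := mesh_depthS j; rewrite /step -/(x_ j) -/(x_ j.+1) in TE.
rewrite /cell_weight; case: ifPn => [ij|]; last rewrite -ltnNge => ji.
  have -> : \int[mu]_(y in `[x_ j, x_ j.+1]) (t * expR (- (t * `|cell_depth i j y|))) =
     \int[mu]_(y in `[x_ j, x_ j.+1]) (t * expR (- (t * ((Th j - Th i) + sg j * (y - x_ j))))).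
    apply: eq_Rintegral => y; rewrite inE/= in_itv/= => /andP[jy yj].
    rewrite /cell_depth addrAC ger0_norm// addr_ge0//.
      by rewrite subr_ge0 Th_le// ltnW.
    by rewrite mulr_ge0 ?subr_ge0// ltW.
  rewrite int_exp_affine ?(ltW lt)// ?gt_eqF// TE.
  by congr ((_ - expR _) / _); ring.
have -> : \int[mu]_(y in `[x_ j, x_ j.+1]) (t * expR (- (t * `|cell_depth i j y|))) =
   \int[mu]_(y in `[x_ j, x_ j.+1]) (t * expR (- (t * ((Th i - Th j) + (- sg j) * (y - x_ j))))).
  apply: eq_Rintegral => y; rewrite inE/= in_itv/= => /andP[jy yj].
  have : Th j.+1 <= Th i by exact: Th_le.
  have : sg j * (y - x_ j) <= sg j * (x_ j.+1 - x_ j).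
    by rewrite ler_wpM2l ?(ltW s0)// lerD2r.
  rewrite TE /cell_depth => h1 h2; rewrite -normrN ger0_norm; last by lra.
  by congr (_ * expR _); ring.
rewrite int_exp_affine ?(ltW lt)// ?oppr_eq0 ?gt_eqF// invrN mulrN -mulNr opprB TE.
by congr ((expR _ - _) / _); ring.
Qed.

Section node_estimate.
Variables (N : nat) (node weight : 'I_N -> R) (C0 : R).
Hypothesis node_gt0 : forall k, 0 < node k.
Hypothesis weight_gt0 : forall k, 0 < weight k.
Hypothesis weight_sum : \sum_k weight k = 1.
Hypothesis C0_ge0 : 0 <= C0.
Hypothesis quad : forall z, 0 < z ->
  `|E1 z - quad_kernel node weight z| <= C0 / Num.sqrt z.
Variables (g phi : R -> R) (Gam : R).
Hypothesis mg : measurable_fun I g.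
Hypothesis g_bnd : forall x, 0 <= x <= 1 -> `|g x| <= Gam.
Hypothesis phiE : forall x, 0 <= x <= 1 ->
  phi x = 2^-1 * \int[mu]_(y in I) (E1 `|tau sigma x y| * g y).
Variables (gj : nat -> R) (B : R).
Hypothesis B_ge0 : 0 <= B.
Hypothesis gj_close : forall j y, (j < M)%N -> x_ j < y < x_ j.+1 ->
  `|g y - gj j| <= B * sg j.

Let K := quad_kernel node weight.
Let Kc i j y := K `|cell_depth i j y|.

Let Kc_integrable i j a b : mu.-integrable `[a, b] (EFin \o Kc i j).
Proof.
have H k : mu.-integrable `[a, b]
    (EFin \o (fun y => weight k / node k * expR (- (`|cell_depth i j y| / node k)))).
  apply: cont_integrable; apply: continuous_within_itv => y; apply: cvgMr.
  apply: (@continuous_comp _ _ _ (fun y => - (`|cell_depth i j y| / node k)) expR);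
    last exact: continuous_expR.
  apply: cvgN; apply: cvgMl; apply: cvg_norm; apply: cvgB; last exact: cvg_cst.
  apply: cvgD; first exact: cvg_cst.
  by apply: cvgMr; apply: cvgB; [exact: cvg_id|exact: cvg_cst].
by rewrite /Kc /K /quad_kernel; exact: integrable_sum_fun.
Qed.

Lemma int_cell_quad_kernel i j : (i <= M)%N -> (j < M)%N ->
  \int[mu]_(y in `[x_ j, x_ j.+1]) Kc i j y =
  \sum_k weight k * (cell_weight (node k)^-1 i j / sg j).
Proof.
move=> iM jM; have cE k : continuous (fun y => (node k)^-1 *
    expR (- ((node k)^-1 * `|cell_depth i j y|))).
  move=> y; apply: cvgMr.
  apply: (@continuous_comp _ _ _ (fun y => - ((node k)^-1 * `|cell_depth i j y|)) expR);
    last exact: continuous_expR.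
  apply: cvgN; apply: cvgMr; apply: cvg_norm; apply: cvgB; last exact: cvg_cst.
  apply: cvgD; first exact: cvg_cst.
  by apply: cvgMr; apply: cvgB; [exact: cvg_id|exact: cvg_cst].
have intE k : mu.-integrable `[x_ j, x_ j.+1] (EFin \o (fun y => (node k)^-1 *
    expR (- ((node k)^-1 * `|cell_depth i j y|)))).
  by apply: cont_integrable; exact: continuous_within_itv.
transitivity (\int[mu]_(y in `[x_ j, x_ j.+1]) (\sum_k weight k * ((node k)^-1 *
    expR (- ((node k)^-1 * `|cell_depth i j y|))))).
  apply: eq_Rintegral => y _; apply: eq_bigr => k _.
  by rewrite mulrA [`|_| / _]mulrC.
rewrite Rint_sum//; last by move=> k; exact: integrable_ZlR.
by apply: eq_bigr => k _; rewrite RintegralZl// int_cell_exp.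
Qed.

Let cc := C0 / Num.sqrt m.

Let cc_ge0 : 0 <= cc. Proof. by rewrite divr_ge0 ?sqrtr_ge0. Qed.

Let Gam_ge0 : 0 <= Gam.
Proof. by apply: le_trans (@g_bnd 0 _) => //; rewrite lexx ler01. Qed.

Let K_ge0 z : 0 <= K z.
Proof.
by apply: sumr_ge0 => k _; rewrite mulr_ge0 ?expR_ge0// divr_ge0// ltW.
Qed.

Let rough i y := delta / m + cc * (Num.sqrt `|x_ i - y|)^-1.

Let rough_integrable i : (i <= M)%N -> mu.-integrable `[0, 1] (EFin \o rough i).
Proof.
move=> iM; have [H _] := int_inv_sqrt_dist (pt01 xs_part iM).
apply: integrable_DR => //; first exact: integrable_cst_itv.
exact: integrable_ZlR.
Qed.

Lemma cell_estimate i j : (i <= M)%N -> (j < M)%N ->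
  `|\int[mu]_(y in `[x_ j, x_ j.+1]) (E1 `|tau sigma (x_ i) y| * g y) -
    gj j * \int[mu]_(y in `[x_ j, x_ j.+1]) Kc i j y| <=
  Gam * \int[mu]_(y in `[x_ j, x_ j.+1]) rough i y +
  B * (sg j * \int[mu]_(y in `[x_ j, x_ j.+1]) Kc i j y).
Proof.
move=> iM jM; have xi01 := pt01 xs_part iM; rewrite -/(x_ i) in xi01.
have /andP[xj0 _] := pt01 xs_part (ltnW jM); have /andP[_ xj1] := pt01 xs_part jM.
have lt := pt_lt xs_part jM; rewrite -/(x_ j) -/(x_ j.+1) in lt xj0 xj1.
have int1 := integrable_E1_tau m_gt0 msigma sigma_bnd node_gt0 weight_gt0 C0_ge0 quad
  mg g_bnd xi01.
have int1' := integrable_sub_itv xj0 xj1 int1.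
have int2 := Kc_integrable i j (x_ j) (x_ j.+1).
have int3 := integrable_sub_itv xj0 xj1 (rough_integrable iM).
have int2' : mu.-integrable `[x_ j, x_ j.+1] (EFin \o (fun y => gj j * Kc i j y)).
  exact: integrable_ZlR.
rewrite -RintegralZl// -RintegralB//.
have intf := @integrable_BR _ _ _ mu _ (measurable_itv _) _ _ int1' int2'.
have intb1 : mu.-integrable `[x_ j, x_ j.+1] (EFin \o (fun y => Gam * rough i y)).
  exact: integrable_ZlR.
have intb2 : mu.-integrable `[x_ j, x_ j.+1] (EFin \o (fun y => B * sg j * Kc i j y)).
  exact: integrable_ZlR.
rewrite mulrA -[X in _ <= X + _]RintegralZl// -[X in _ <= _ + X]RintegralZl//.
rewrite -RintegralD//.
have := @Rint_norm_le_except _ `[x_ j, x_ j.+1]%classic (measurable_itv _) [:: x_ j; x_ j.+1]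
  (fun y => E1 `|tau sigma (x_ i) y| * g y - gj j * Kc i j y)
  (fun y => Gam * rough i y + B * sg j * Kc i j y).
case=> //.
- by move/measurable_int/measurable_EFinP : intf.
- move=> y /=; rewrite in_itv/= !inE negb_or => yj /andP[yn1 yn2].
  have /andP[jy yj1] := yj.
  have y01 : 0 <= y <= 1 by rewrite (le_trans xj0 jy) (le_trans yj1 xj1).
  have yo : x_ j < y < x_ j.+1 by rewrite !lt_neqAle jy yj1 eq_sym yn1 yn2.
  have xy : x_ i != y.
    apply/eqP => E; have [ij|ji] := leqP i j.
      have : x_ i <= x_ j by apply: pt_le => //; exact: ltnW.
      by rewrite E leNgt; case/andP: yo => ->.
    have : x_ j.+1 <= x_ i by apply: pt_le.
    by rewrite E leNgt; case/andP: yo => _ ->.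
  have d0 : 0 < `|x_ i - y| by rewrite normr_gt0 subr_eq0.
  have [a1 a2] := cell_depth_approx iM jM yj.
  have /andP[t1 _] := tau_bnd m_gt0 msigma sigma_bnd xi01 y01.
  set z : R := `|cell_depth i j y| in a2 *; set w : R := `|tau sigma (x_ i) y| in t1 *.
  have md0 : 0 < m * `|x_ i - y| by rewrite mulr_gt0.
  have z0 : 0 < z := lt_le_trans md0 a2.
  have b1 : `|E1 w - E1 z| <= delta / m.
    rewrite (le_trans (E1_lip md0 t1 a2))// ler_pdivrMr// mulrA divfK ?gt_eqF//.
    rewrite (le_trans (ler_dist_dist _ _))// (tauE m_gt0 msigma sigma_bnd)//.
  have b2 : `|E1 z - K z| <= cc * (Num.sqrt `|x_ i - y|)^-1.
    rewrite (le_trans (quad z0))// /cc -mulrA -invfM ler_wpM2l//.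
    by rewrite -sqrtrM ?(ltW m_gt0)// lef_pV2 ?posrE ?sqrtr_gt0// ler_wsqrtr.
  (* The kernel error is charged to the bounded source [g], the source error to the nonnegative
     frozen kernel, whose mass is controlled by [cell_weight_total]. *)
  have -> : E1 w * g y - gj j * Kc i j y =
      (E1 w - K z) * g y + K z * (g y - gj j).
    by rewrite /Kc -/z; move: (E1 w) (K z) => p q; ring.
  rewrite (le_trans (ler_normD _ _))// lerD//.
    rewrite normrM mulrC; apply: ler_pM => //; first exact: g_bnd.
    rewrite (_ : E1 w - K z = (E1 w - E1 z) + (E1 z - K z)); last first.
      by move: (E1 w) (E1 z) (K z) => p q r; ring.
    by rewrite (le_trans (ler_normD _ _))// lerD.
  rewrite normrM (ger0_norm (K_ge0 z)) mulrC /Kc -/z ler_wpM2r// gj_close//.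
- move=> y; rewrite addr_ge0// mulr_ge0//.
    by rewrite addr_ge0 ?divr_ge0 ?(ltW m_gt0)// mulr_ge0// invr_ge0 sqrtr_ge0.
    by apply: mulr_ge0 => //; exact/ltW/sg_gt0.
  exact: K_ge0.
- exact: (@integrable_DR _ _ _ mu _ (measurable_itv _) _ _ intb1 intb2).
Qed.


Let q j := gj j / sg j.

(** Sum of the cell estimates: the inverse square root integrates to at most 8, halved to 4, and [B]
    keeps the coefficient 1. The values [gj] are free; zero values will give the a priori bound of
    the flux, the discrete source the error recursion. *)
Lemma node_estimate i : (i <= M)%N ->
  `|phi (x_ i) - 2^-1 * \sum_k weight k *
     (forward_flux (node k)^-1 q i + backward_flux (node k)^-1 q i)| <=
  Gam * (delta / m + 4 * C0 / Num.sqrt m) + B.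
Proof.
move=> iM; have xi01 := pt01 xs_part iM; rewrite -/(x_ i) in xi01.
have int1 := integrable_E1_tau m_gt0 msigma sigma_bnd node_gt0 weight_gt0 C0_ge0 quad
  mg g_bnd xi01.
have sumE : \sum_k weight k *
     (forward_flux (node k)^-1 q i + backward_flux (node k)^-1 q i) =
    \sum_(j < M) gj j * \int[mu]_(y in `[x_ j, x_ j.+1]) Kc i j y.
  under eq_bigr => k _ do rewrite -cell_weight_sum// mulr_sumr.
  rewrite exchange_big/=; apply: eq_bigr => j _.
  rewrite int_cell_quad_kernel// mulr_sumr; apply: eq_bigr => k _.
  by rewrite /q; move: (sg j)^-1 (cell_weight _ _ _) => u v; ring.
rewrite phiE// sumE (Rint_cells xs_part)// -mulrBr normrM ger0_norm ?invr_ge0//.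
rewrite -sumrB.
have H : `|\sum_(j < M) (\int[mu]_(y in `[x_ j, x_ j.+1]) (E1 `|tau sigma (x_ i) y| * g y) -
    gj j * \int[mu]_(y in `[x_ j, x_ j.+1]) Kc i j y)| <=
    Gam * (delta / m + 8 * cc) + 2 * B.
  rewrite (le_trans (ler_norm_sum _ _ _))//.
  apply: (@le_trans _ _ (\sum_(j < M) (Gam * \int[mu]_(y in `[x_ j, x_ j.+1]) rough i y +
    B * (sg j * \int[mu]_(y in `[x_ j, x_ j.+1]) Kc i j y)))).
    by apply: ler_sum => j _; exact: cell_estimate.
  rewrite big_split/= -!mulr_sumr -(Rint_cells xs_part (rough_integrable iM)).
  have [intx Ix] := int_inv_sqrt_dist xi01.
  apply: lerD; first rewrite ler_wpM2l//.
    rewrite /rough RintegralD//; [|exact: integrable_cst_itv|exact: integrable_ZlR].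
    by rewrite (Rint_cst_itv (delta / m) ler01) RintegralZl// subr0 mulr1 lerD2l mulrC ler_wpM2r.
  rewrite mulrC ler_wpM2r//.
  apply: (@le_trans _ _ (\sum_k weight k * \sum_(j < M) cell_weight (node k)^-1 i j)).
    under [leRHS]eq_bigr do rewrite mulr_sumr.
    rewrite exchange_big/=; apply: ler_sum => j _; rewrite int_cell_quad_kernel// mulr_sumr.
    apply: ler_sum => k _; rewrite mulrCA (mulrC (sg j)) divfK//.
    by rewrite gt_eqF// sg_gt0.
  have -> : 2 = \sum_k weight k * 2 by rewrite -mulr_suml weight_sum mul1r.
  apply: ler_sum => k _.
  rewrite ler_wpM2l ?(ltW (weight_gt0 k))// cell_weight_total//.
  by rewrite invr_ge0 ltW.
have dm : 0 <= delta / m by rewrite divr_ge0// ltW.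
apply: (@le_trans _ _ (2^-1 * (Gam * (delta / m + 8 * cc) + 2 * B))).
  by rewrite ler_wpM2l// invr_ge0.
rewrite -mulrA -/cc; have := mulr_ge0 Gam_ge0 dm; lra.
Qed.

End node_estimate.
End node_consistency.

(** * The scheme against exact transport with frozen coefficients *)

Section discrete_comparison.
Context {R : realType}.
Variable xs : seq R.
Hypothesis xs_part : itv_partition 0 1 xs.
Variables (sigma sigmaS f : R -> R) (S : R).
Variables (N : nat) (node weight : 'I_N -> R) (psi : bool * 'I_N -> nat -> R).
Hypothesis node_gt0 : forall k, 0 < node k.
Hypothesis weight_gt0 : forall k, 0 < weight k.
Hypothesis sol : discrete_solution node weight xs sigma sigmaS f psi.

Let M := size xs.
Let sg j := sigma (mid xs j).
Hypothesis sg_bnd : forall j, (j < M)%N -> 0 < sg j <= S.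

Definition source j := sigmaS (mid xs j) * mid_flux weight psi j + f (mid xs j).
Let q j := source j / sg j.

Variable Q : R.
Hypothesis q_bnd : forall j, (j < M)%N -> `|q j| <= Q.

Lemma nodal_fluxE i : nodal_flux weight psi i =
  2^-1 * \sum_k weight k * (psi (false, k) i + psi (true, k) i).
Proof.
rewrite /nodal_flux; congr (_ * _).
transitivity (\sum_b \sum_k weight k * psi (b, k) i).
  by rewrite pair_bigA/=; apply: eq_bigr => -[b k] _.
by rewrite big_bool/= -big_split/=; apply: eq_bigr => k _; rewrite -mulrDr addrC.
Qed.

Lemma mid_fluxE i : mid_flux weight psi i =
  (nodal_flux weight psi i + nodal_flux weight psi i.+1) / 2.
Proof.
rewrite /mid_flux /nodal_flux -mulrDr -big_split/= -mulrA mulr_suml; congr (_ * _).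
by apply: eq_bigr => k _; rewrite -mulrDr mulrA [psi k i + _]addrC.
Qed.

(** Half the optical thickness of the cell along direction [k], the form in which the scheme is a
    step of [crank_nicolson_error]. *)
Let al k j := sg j * step xs j * (node k)^-1 / 2.
Let alpha k := S * diam xs * (node k)^-1 / 2.

Let al_bnd k j : (j < M)%N -> 0 <= al k j <= alpha k.
Proof.
move=> jM; have /andP[s0 sS] := sg_bnd jM; have h0 := step_gt0 xs_part jM.
have hd := step_le_diam jM.
apply/andP; split; first by rewrite !mulr_ge0 ?invr_ge0 ?ltW// ltW.
by rewrite /al /alpha !ler_pM2r ?invr_gt0//; apply: ler_pM => //; exact: ltW.
Qed.

Let Q_ge0 : 0 <= Q. Proof. exact: le_trans (q_bnd (size_part_gt0 xs_part)). Qed.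

Let alpha_ge0 k : 0 <= alpha k.
Proof.
by have /andP[h] := al_bnd k (size_part_gt0 xs_part); exact: le_trans.
Qed.

Let step_algebra (u v s h g p p' : R) : h != 0 -> v != 0 -> s != 0 ->
  u = v -> u * ((p' - p) / h) + s * ((p' + p) / 2) = g ->
  p' * (1 + s * h * v^-1 / 2) = (1 - s * h * v^-1 / 2) * p + 2 * (s * h * v^-1 / 2) * (g / s).
Proof. by move=> h0 v0 s0 -> <-; field; rewrite v0 s0 h0. Qed.

Lemma forward_error k i : (i <= M)%N ->
  `|psi (false, k) i - forward_flux xs sigma (node k)^-1 q i| <= 4 * Q * alpha k.
Proof.
move=> iM; have [eqn p0 _] := sol.
have := @crank_nicolson_error _ M (al k) q (psi (false, k))
  (forward_flux xs sigma (node k)^-1 q) (alpha k) Q.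
move=> /(_ _ _ _ _ Q_ge0 (alpha_ge0 k) _ _ i iM); case => //.
- by move=> j; exact: al_bnd.
- by rewrite /forward_flux big_ord0.
- move=> j jM; have /andP[s0 _] := sg_bnd jM.
  apply: step_algebra (eqn (false, k) j jM); rewrite ?gt_eqF//; first exact: step_gt0.
  by rewrite /dg_node/= expr0 mul1r.
- move=> j jM; rewrite forward_fluxS /=.
  have -> : (node k)^-1 * (sigma (mid xs j) * step xs j) = 2 * al k j; last by [].
  by rewrite /al /sg; field; rewrite gt_eqF.
Qed.

(** The sweep runs from the right end: its step [n] crosses cell [M - n.+1], from node [M - n] to
    node [M - n.+1]. *)
Lemma backward_error k i : (i <= M)%N ->
  `|psi (true, k) i - backward_flux xs sigma (node k)^-1 q i| <= 4 * Q * alpha k.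
Proof.
move=> iM; have [eqn _ pM] := sol.
have rev n : (n < M)%N -> (M - n.+1 < M)%N /\ (M - n.+1).+1 = (M - n)%N by lia.
have := @crank_nicolson_error _ M (fun n => al k (M - n.+1)) (fun n => q (M - n.+1))
  (fun n => psi (true, k) (M - n)%N)
  (fun n => backward_flux xs sigma (node k)^-1 q (M - n)) (alpha k) Q.
move=> /(_ _ _ _ _ Q_ge0 (alpha_ge0 k) _ _ (M - i)%N); rewrite subKn//.
case => //.
- by move=> j /rev[jM _]; exact: al_bnd.
- by move=> j /rev[jM _]; exact: q_bnd.
- by rewrite subn0.
- by rewrite subn0 /backward_flux big_geq.
- move=> j /rev[jM <-]; have /andP[s0 _] := sg_bnd jM.
  have h0 := step_gt0 xs_part jM; have n0 := node_gt0 k.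
  apply: step_algebra; rewrite ?gt_eqF//.
  rewrite -/(source _) /source; have <- := eqn (true, k) _ jM.
  by rewrite /dg_node/= expr1 mulN1r mulNr -mulrN -mulNr opprB [psi _ _ + psi _ _]addrC.
- move=> j /rev[jM jE]; rewrite backward_fluxS//= jE.
  have -> : (node k)^-1 * (sigma (mid xs (M - j.+1)) * step xs (M - j.+1)) =
    2 * al k (M - j.+1); last by [].
  by rewrite /al /sg; field; rewrite gt_eqF.
- exact: leq_subr.
Qed.

Lemma discrete_flux_error i : (i <= M)%N ->
  `|nodal_flux weight psi i - 2^-1 * \sum_k weight k *
     (forward_flux xs sigma (node k)^-1 q i + backward_flux xs sigma (node k)^-1 q i)|
  <= 2 * Q * S * diam xs * \sum_k weight k / node k.
Proof.
move=> iM; rewrite nodal_fluxE -mulrBr -sumrB normrM ger0_norm ?invr_ge0//.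
apply: (@le_trans _ _ (2^-1 * \sum_k weight k * (4 * Q * alpha k + 4 * Q * alpha k))).
  rewrite ler_wpM2l ?invr_ge0// (le_trans (ler_norm_sum _ _ _))//; apply: ler_sum => k _.
  rewrite -mulrBr normrM gtr0_norm// ler_wpM2l ?(ltW (weight_gt0 k))//.
  have e1 := forward_error k iM; have e2 := backward_error k iM.
  rewrite opprD addrACA (le_trans (ler_normD _ _))//; exact: lerD.
rewrite le_eqVlt; apply/orP; left; apply/eqP; rewrite !mulr_sumr.
by apply: eq_bigr => k _; rewrite /alpha; field; rewrite gt_eqF.
Qed.

End discrete_comparison.

(** * Piecewise Hoelder functions *)

Section suprema.
Context {R : realType}.
Implicit Types (g : R -> R) (I : set R).

Lemma bounded_onP I g : [bounded g x | x in I] -> exists C, forall x, I x -> `|g x| <= C.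
Proof.
by move=> [C [_ H]]; exists (C + 1) => x Ix; apply: (H (C + 1)) => //; rewrite ltrDl.
Qed.

Lemma bounded_on I g C : (forall x, I x -> `|g x| <= C) -> [bounded g x | x in I].
Proof.
move=> H; exists C; split; first exact: num_real.
by move=> D /ltW CD x /H h; exact: le_trans CD.
Qed.

Lemma le_supnorm I g x : [bounded g x | x in I] -> I x -> `|g x| <= supnorm I g.
Proof.
move=> /bounded_onP[C H] Ix; apply: ub_le_sup; last by exists x.
by exists C => _ [z Iz <-]; exact: H.
Qed.

Lemma supnorm_le I g c : I !=set0 -> (forall x, I x -> `|g x| <= c) -> supnorm I g <= c.
Proof.
move=> [x Ix] H; apply: ge_sup; first by exists `|g x|, x.
by move=> _ [z Iz <-]; exact: H.
Qed.

Lemma minval_maxval g x : [bounded g x | x in `[0, 1]] -> 0 <= x <= 1 ->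
  minval g <= g x <= maxval g.
Proof.
move=> /bounded_onP[C H] x01.
have gx : (g @` `[0, 1]) (g x) by exists x => //; rewrite /= in_itv.
apply/andP; split; [apply: ge_inf => // |apply: ub_le_sup => //].
  by exists (- C) => _ [z Iz <-]; have /ler_normlP[h _] := H z Iz; rewrite lerNl.
by exists C => _ [z Iz <-]; have /ler_normlP[] := H z Iz.
Qed.

End suprema.

Section piecewise_holder.
Context {R : realType}.
Variables (cs : seq R) (eta : R).
Hypothesis eta_gt0 : 0 < eta.
Hypothesis cs_part : itv_partition 0 1 cs.
Variable g : R -> R.
Hypothesis g_pw : in_pw cs eta g.
Let G := pw_norm cs eta g.

Lemma holder_norm_le_pw j : (j < size cs)%N -> holder_norm eta (cell cs j) g <= G.
Proof. by move=> jM; rewrite /G /pw_norm (bigD1 (Ordinal jM))//= le_max lexx. Qed.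

Lemma pw_norm_ge0 : 0 <= G.
Proof. by rewrite /G /pw_norm; elim/big_rec: _ => // i x _ x0; rewrite le_max x0 orbT. Qed.


Lemma holder_norm_bounds j x y : (j < size cs)%N -> cell cs j x -> cell cs j y ->
  x != y -> `|g x| + `|g x - g y| / `|x - y| `^ eta <= holder_norm eta (cell cs j) g.
Proof.
move=> jM xc yc xy; have [H _ _] := g_pw; have [b u] := H j jM.
apply: lerD; first exact: le_supnorm.
by apply: ub_le_sup => //; exists (x, y).
Qed.

Let other_point j x : (j < size cs)%N -> cell cs j x -> exists2 y, cell cs j y & x != y.
Proof.
move=> jM; rewrite /cell /= in_itv/= => /andP[h1 h2].
exists ((x + pt cs j.+1) / 2); last by rewrite lt_eqF//; lra.
by rewrite in_itv/=; apply/andP; split; lra.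
Qed.

Lemma pw_cell_bnd j x : (j < size cs)%N -> cell cs j x -> `|g x| <= G.
Proof.
move=> jM xc; have [y yc xy] := other_point jM xc.
rewrite (le_trans _ (holder_norm_le_pw jM))// (le_trans _ (holder_norm_bounds jM xc yc xy))//.
by rewrite lerDl divr_ge0// powR_ge0.
Qed.

Lemma pw_holder j x y : (j < size cs)%N -> cell cs j x -> cell cs j y ->
  `|g x - g y| <= G * `|x - y| `^ eta.
Proof.
move=> jM xc yc; have [->|xy] := eqVneq x y.
  by rewrite !subrr normr0 mulr_ge0 ?pw_norm_ge0 ?powR_ge0.
have h := holder_norm_bounds jM xc yc xy; have hG := holder_norm_le_pw jM.
rewrite -ler_pdivrMr; last by rewrite powR_gt0// normr_gt0 subr_eq0.
by rewrite (le_trans _ hG)// (le_trans _ h)// lerDr.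
Qed.

(** The value at a partition point is a one-sided limit of values in an adjacent open cell, so the
    bound passes to the limit. *)
Lemma pw_bnd x : 0 <= x <= 1 -> `|g x| <= G.
Proof.
move=> /andP[x0]; rewrite le_eqVlt => /predU1P[->|x1]; last first.
  have [j jM /andP[]] := cell_index_exists cs_part x0 x1.
  rewrite le_eqVlt => /predU1P[<- _|h1 h2]; last first.
    by apply: (pw_cell_bnd jM); rewrite /cell /= in_itv/= h1.
  have [_ H _] := g_pw; apply: (cvgr_to_le (cvg_norm (H j jM))).
  near=> z; apply: (pw_cell_bnd jM); rewrite /cell/= in_itv/=; apply/andP; split.
    by near: z; exact: nbhs_right_gt.
  by near: z; apply: nbhs_right_lt; exact: pt_lt.
have [_ _ H] := g_pw; apply: (cvgr_to_le (cvg_norm H)).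
have M0 := size_part_gt0 cs_part; have pM : ((size cs).-1 < size cs)%N by rewrite prednK.
have E : pt cs (size cs).-1.+1 = 1 by rewrite prednK// pt_size.
near=> z; apply: (pw_cell_bnd pM); rewrite /cell/= in_itv/= E; apply/andP; split.
  by near: z; apply: nbhs_left_gt; rewrite -[ltRHS]E; exact: pt_lt.
by near: z; exact: nbhs_left_lt.
Unshelve. all: end_near. Qed.

Lemma pw_continuous j y : (j < size cs)%N -> pt cs j < y < pt cs j.+1 ->
  {for y, continuous g}.
Proof.
move=> jM yc; apply/cvgrPdist_lt => /= e e0.
have G0 := pw_norm_ge0; have G1 : 0 < G + 1 by rewrite ltr_wpDl.
pose r := (e / (G + 1)) `^ eta^-1.
have r0 : 0 < r by rewrite powR_gt0// divr_gt0.
have yc' : y \in `]pt cs j, pt cs j.+1[ by rewrite in_itv.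
near=> z.
have zc : z \in `]pt cs j, pt cs j.+1[ by near: z; exact: near_in_itvoo.
have zr : `|y - z| < r.
  by near: z; apply/nbhs_ballP; exists r.
have := pw_holder jM yc' zc; move=> /le_lt_trans; apply.
have h : `|y - z| `^ eta <= e / (G + 1).
  have -> : e / (G + 1) = r `^ eta.
    by rewrite /r -powRrM mulVf ?gt_eqF// powRr1// divr_ge0 ?ltW.
  by apply: ge0_ler_powR; rewrite ?nnegrE// ltW.
apply: (@le_lt_trans _ _ (G * (e / (G + 1)))); first by rewrite ler_wpM2l.
by rewrite mulrA ltr_pdivrMr// mulrC mulrDr mulr1 ltrDl.
Unshelve. all: end_near. Qed.

Lemma pw_measurable : measurable_fun (`[0, 1]%classic : set R) g.
Proof.
have H n : (n <= size cs)%N -> measurable_fun (`[0, pt cs n]%classic : set R) g.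
  elim: n => [_|n ih nM]; first by rewrite pt0 set_itv1; exact: measurable_fun_set1.
  have /andP[p0 _] := pt01 cs_part (ltnW nM).
  apply: (measurable_cc_cat p0) (ih (ltnW nM)) _; first exact/ltW/pt_lt.
  by apply: measurable_oo_cc => y; exact: pw_continuous.
by have := H (size cs) (leqnn _); rewrite pt_size.
Qed.

Section mesh.
Variable xs : seq R.
Hypothesis xs_part : itv_partition 0 1 xs.
Hypothesis cs_xs : {subset cs <= xs}.

(** The right end of the partition cell that contains the left end of the mesh cell is itself a mesh
    node, so the mesh cell cannot reach beyond it. *)
Lemma mesh_cell_sub j : (j < size xs)%N -> exists2 i, (i < size cs)%N &
  pt cs i <= pt xs j /\ pt xs j.+1 <= pt cs i.+1.
Proof.
move=> jM; have /andP[p0 _] := pt01 xs_part (ltnW jM).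
have p1 : pt xs j < 1.
  by have /andP[_] := pt01 xs_part jM; apply: lt_le_trans; exact: pt_lt.
have [i iM /andP[h1 h2]] := cell_index_exists cs_part p0 p1; exists i => //; split => //.
have /cs_xs/(nthP 1)[l lM lE] : pt cs i.+1 \in cs by exact: mem_nth.
have lE' : pt xs l.+1 = pt cs i.+1 by [].
rewrite -lE'; apply: pt_le => //; rewrite leqNgt; apply/negP => lj.
by move: h2; rewrite ltNge -lE' pt_le// ltnW.
Qed.

Lemma pw_mesh_osc j x y : (j < size xs)%N -> pt xs j < x < pt xs j.+1 ->
  pt xs j < y < pt xs j.+1 -> `|g x - g y| <= G * diam xs `^ eta.
Proof.
move=> jM /andP[x1 x2] /andP[y1 y2]; have [i iM [h1 h2]] := mesh_cell_sub jM.
apply: (@le_trans _ _ (G * `|x - y| `^ eta)).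
  apply: (pw_holder iM); rewrite /cell/= in_itv/=; apply/andP; split.
  - exact: le_lt_trans x1.
  - exact: lt_le_trans h2.
  - exact: le_lt_trans y1.
  - exact: lt_le_trans h2.
rewrite ler_wpM2l ?pw_norm_ge0//; apply: ge0_ler_powR; rewrite ?nnegrE ?normr_ge0//.
- exact: ltW.
- exact/ltW/diam_gt0.
rewrite (le_trans _ (step_le_diam jM))// /step ler_norml; apply/andP; split; lra.
Qed.

End mesh.
End piecewise_holder.

Section positive_data.
Context {R : realType}.
Variables (sigmaS sigmaA : R -> R).
Hypothesis posS : bounded_positive sigmaS.
Hypothesis posA : bounded_positive sigmaA.
Let sigma x := sigmaS x + sigmaA x.

Lemma bounded_sum : [bounded sigma x | x in `[0, 1]].
Proof.
have [/bounded_onP[C hC] _] := posS; have [/bounded_onP[C' hC'] _] := posA.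
apply: (@bounded_on _ _ _ (C + C')) => x Ix.
by rewrite (le_trans (ler_normD _ _))// lerD ?hC ?hC'.
Qed.

Lemma minval_sum_gt0 : 0 < minval sigma.
Proof.
have [bS mS] := posS; have [bA mA] := posA.
apply: lt_le_trans mS _; apply: lb_le_inf.
  by exists (sigma 0), 0 => //=; rewrite in_itv/= lexx ler01.
move=> _ [x /= xI <-]; have x01 : 0 <= x <= 1 by rewrite in_itv in xI.
have /andP[h _] := minval_maxval bS x01; have /andP[h' _] := minval_maxval bA x01.
by rewrite /sigma (le_trans h)// lerDl (le_trans (ltW mA)).
Qed.

Lemma maxval_ge_minval g : [bounded g x | x in `[0, 1]] -> @minval R g <= maxval g.
Proof.
by move=> b; have /andP[h1 h2] := @minval_maxval _ g 0 b (ltac:(by rewrite lexx ler01));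
  exact: le_trans h2.
Qed.

Let ratio x := sigmaS x / sigma x.

(** The ratio is 1 - sigmaA / sigma, and the positive infimum of [sigmaA] keeps it away from 1
    uniformly. *)
Let ratio_le x : 0 <= x <= 1 -> 0 < ratio x <= 1 - minval sigmaA / maxval sigma.
Proof.
move=> x01; have [bS mS] := posS; have [bA mA] := posA.
have /andP[h _] := minval_maxval bS x01; have /andP[h' _] := minval_maxval bA x01.
have /andP[h1 h2] := minval_maxval bounded_sum x01.
have s0 : 0 < sigma x by rewrite (lt_le_trans minval_sum_gt0).
have S0 : 0 < maxval sigma by rewrite (lt_le_trans s0).
apply/andP; split; first by rewrite divr_gt0// (lt_le_trans mS).
have -> : ratio x = 1 - sigmaA x / sigma x.
  by rewrite /ratio -[sigmaS x](addrK (sigmaA x)) mulrBl divff ?gt_eqF.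
rewrite lerD2l lerN2; apply: ler_pM => //; rewrite ?invr_ge0; try exact: ltW.
by rewrite lef_pV2.
Qed.

Lemma albedo_bnd x : 0 <= x <= 1 -> sigmaS x <= supnorm `[0, 1] ratio * sigma x.
Proof.
move=> x01; have /andP[h1 _] := minval_maxval bounded_sum x01.
have s0 : 0 < sigma x by rewrite (lt_le_trans minval_sum_gt0).
rewrite -ler_pdivrMr// (le_trans (ler_norm _))//; apply: (@le_supnorm _ _ ratio); last by rewrite /= in_itv.
apply: (@bounded_on _ _ _ (1 - minval sigmaA / maxval sigma)) => z /=; rewrite in_itv/= => z01.
by have /andP[h2 h3] := ratio_le z01; rewrite gtr0_norm.
Qed.

Lemma albedo_lt1 : supnorm `[0, 1] ratio < 1.
Proof.
have [bA mA] := posA.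
have S0 : 0 < maxval sigma.
  exact: lt_le_trans minval_sum_gt0 (maxval_ge_minval bounded_sum).
apply: (@le_lt_trans _ _ (1 - minval sigmaA / maxval sigma)); last first.
  by rewrite ltrBlDr ltrDl divr_gt0.
apply: supnorm_le; first by exists 0; rewrite /= in_itv/= lexx ler01.
by move=> z /=; rewrite in_itv/= => z01; have /andP[h2 h3] := ratio_le z01; rewrite gtr0_norm.
Qed.

Lemma albedo_gt0 : 0 < supnorm `[0, 1] ratio.
Proof.
have z01 : 0 <= (0 : R) <= 1 by rewrite lexx ler01.
have := albedo_bnd z01; have [bS mS] := posS.
have /andP[h _] := minval_maxval bS z01; have /andP[h1 _] := minval_maxval bounded_sum z01.
have := minval_sum_gt0; rewrite -/sigma => p q.
rewrite -(pmulr_lgt0 _ (lt_le_trans p h1)); apply: lt_le_trans q.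
exact: lt_le_trans h.
Qed.

End positive_data.

(** * Error recursion *)

Section error_recursion.
Context {R : realType}.
Notation mu := (@lebesgue_measure R).
Notation I := (`[0, 1]%classic : set R).
Variable xs : seq R.
Hypothesis xs_part : itv_partition 0 1 xs.
Let M := size xs.
Variables (sigma sigmaS f phi : R -> R) (m S SS s F X : R).
Hypothesis m_gt0 : 0 < m.
Hypothesis msigma : measurable_fun I sigma.
Hypothesis sigma_bnd : forall x, 0 <= x <= 1 -> m <= sigma x <= S.
Hypothesis msigmaS : measurable_fun I sigmaS.
Hypothesis sigmaS_bnd : forall x, 0 <= x <= 1 -> 0 <= sigmaS x <= SS.
Hypothesis s01 : 0 <= s <= 1.
Hypothesis sigmaS_le : forall x, 0 <= x <= 1 -> sigmaS x <= s * sigma x.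
Hypothesis mf : measurable_fun I f.
Hypothesis f_bnd : forall x, 0 <= x <= 1 -> `|f x| <= F.
Hypothesis mphi : measurable_fun I phi.
Hypothesis phi_bnd : forall x, 0 <= x <= 1 -> `|phi x| <= X.
Hypothesis phiE : forall x, 0 <= x <= 1 -> phi x =
  2^-1 * \int[mu]_(y in I) (E1 `|tau sigma x y| * (sigmaS y * phi y + f y)).
Variables (delta deltaS deltaf : R).
Let in_cell j y := pt xs j < y < pt xs j.+1.
Hypothesis sigma_osc : forall j x y, (j < M)%N -> in_cell j x -> in_cell j y ->
  `|sigma x - sigma y| <= delta.
Hypothesis sigmaS_osc : forall j x y, (j < M)%N -> in_cell j x -> in_cell j y ->
  `|sigmaS x - sigmaS y| <= deltaS.
Hypothesis f_osc : forall j x y, (j < M)%N -> in_cell j x -> in_cell j y ->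
  `|f x - f y| <= deltaf.
Variables (N : nat) (node weight : 'I_N -> R) (C0 : R).
Hypothesis node_gt0 : forall k, 0 < node k.
Hypothesis weight_gt0 : forall k, 0 < weight k.
Hypothesis weight_sum : \sum_k weight k = 1.
Hypothesis C0_ge0 : 0 <= C0.
Hypothesis quad : forall z, 0 < z ->
  `|E1 z - quad_kernel node weight z| <= C0 / Num.sqrt z.
Variable psi : bool * 'I_N -> nat -> R.
Hypothesis sol : discrete_solution node weight xs sigma sigmaS f psi.

Let h := diam xs.
Let L := \sum_k weight k / node k.
Let g y := sigmaS y * phi y + f y.
Let Gam := SS * X + F.
(** [omega] bounds the variation of the flux over one mesh width, [kappa] the part of
    [node_estimate] that is independent of the chosen source values. *)
Let omega := Gam * (8 * C0 / Num.sqrt m + 2 * (S / m) * h * L).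
Let kappa := Gam * (delta / m + 4 * C0 / Num.sqrt m).

Let z01 : 0 <= (0 : R) <= 1. Proof. by rewrite lexx ler01. Qed.
Let F_ge0 : 0 <= F. Proof. exact: le_trans (f_bnd z01). Qed.
Let X_ge0 : 0 <= X. Proof. exact: le_trans (phi_bnd z01). Qed.
Let SS_ge0 : 0 <= SS. Proof. by have /andP[h1] := sigmaS_bnd z01; exact: le_trans. Qed.
Let S_ge0 : 0 <= S.
Proof. by have /andP[h1 h2] := sigma_bnd z01; rewrite (le_trans _ h2)// (le_trans _ h1)// ltW. Qed.
Let L_ge0 : 0 <= L. Proof. by apply: sumr_ge0 => k _; rewrite divr_ge0// ltW. Qed.
Let Gam_ge0 : 0 <= Gam. Proof. by rewrite addr_ge0// mulr_ge0. Qed.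
Let s_ge0 : 0 <= s. Proof. by case/andP: s01. Qed.

Let mid_cell j : (j < M)%N -> in_cell j (mid xs j).
Proof. exact: mid_in_cell. Qed.

Let cell01 j y : (j < M)%N -> in_cell j y -> 0 <= y <= 1.
Proof.
move=> jM /andP[h1 h2]; have /andP[h3 _] := pt01 xs_part (ltnW jM).
have /andP[_ h4] := pt01 xs_part jM.
by rewrite (le_trans h3 (ltW h1)) (le_trans (ltW h2) h4).
Qed.

Let delta_ge0 : 0 <= delta.
Proof.
have M0 := size_part_gt0 xs_part.
by apply: le_trans (sigma_osc M0 (mid_cell M0) (mid_cell M0)).
Qed.

Let mg : measurable_fun I g.
Proof. by apply: measurable_funD => //; exact: measurable_funM. Qed.

Let g_bnd x : 0 <= x <= 1 -> `|g x| <= Gam.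
Proof.
move=> x01; rewrite (le_trans (ler_normD _ _))// lerD ?f_bnd// normrM.
have /andP[a b] := sigmaS_bnd x01; apply: ler_pM => //; last exact: phi_bnd.
by rewrite ger0_norm.
Qed.

Lemma flux_variation x x' : 0 <= x <= 1 -> 0 <= x' <= 1 -> `|x - x'| <= h ->
  `|phi x - phi x'| <= omega.
Proof.
move=> x01 x'01 xx'; have := flux_modulus m_gt0 msigma sigma_bnd node_gt0 weight_gt0
  C0_ge0 quad mg g_bnd phiE x01 x'01.
move=> H; apply: le_trans H _; rewrite ler_wpM2l// lerD2l ler_wpM2r// ler_wpM2l//.
by rewrite mulr_ge0// divr_ge0// ltW.
Qed.

Let cell_of x : 0 <= x <= 1 -> exists2 j, (j < M)%N & pt xs j <= x <= pt xs j.+1.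
Proof.
move=> /andP[x0]; rewrite le_eqVlt => /predU1P[->|x1].
  have M0 := size_part_gt0 xs_part.
  have E : M.-1.+1 = M by rewrite prednK.
  exists M.-1; first by rewrite /M prednK.
  rewrite E pt_size// lexx andbT; have /andP[] := @pt01 _ _ xs_part M.-1 (leq_pred _).
  by [].
have [j jM /andP[h1 h2]] := cell_index_exists xs_part x0 x1.
by exists j => //; rewrite h1 ltW.
Qed.

Let near_node j x : (j < M)%N -> pt xs j <= x <= pt xs j.+1 ->
  `|x - pt xs j| <= h /\ `|x - pt xs j.+1| <= h.
Proof.
move=> jM /andP[h1 h2]; have := step_le_diam jM; rewrite /step -/h => h3.
by split; rewrite ler_norml; apply/andP; split; lra.
Qed.

Let sigma_mid j : (j < M)%N -> m <= sigma (mid xs j) <= S.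
Proof. by move=> jM; exact: sigma_bnd (cell01 jM (mid_cell jM)). Qed.

(** Brings an additive error into the form of a multiple of the midpoint coefficient, as
    [node_estimate] expects it. *)
Let gt0_Bdiv j B c : (j < M)%N -> 0 <= c ->
  B * sigma (mid xs j) + c <= (B + c / m) * sigma (mid xs j).
Proof.
move=> jM c0; have /andP[a _] := sigma_mid jM.
by rewrite mulrDl lerD2l -mulrA ler_peMr// mulrC ler_pdivlMr// mul1r.
Qed.

(* The coarse a priori bound is the consistency estimate with zero source values. *)
Lemma flux_bound x : 0 <= x <= 1 ->
  `|phi x| <= omega + kappa + (s * X + (s * delta * X + F) / m).
Proof.
move=> x01; have [j jM xj] := cell_of x01; have [xh _] := near_node jM xj.
have j01 := pt01 xs_part (ltnW jM).
have c0 : 0 <= s * delta * X + F by rewrite addr_ge0// !mulr_ge0.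
have B0 : 0 <= s * X + (s * delta * X + F) / m.
  by rewrite addr_ge0 ?mulr_ge0 ?invr_ge0// ltW.
have gB l y : (l < M)%N -> in_cell l y ->
    `|g y - 0| <= (s * X + (s * delta * X + F) / m) * sigma (mid xs l).
  move=> lM yl; rewrite subr0; have y01 := cell01 lM yl.
  apply: le_trans (gt0_Bdiv _ lM c0); rewrite (le_trans (ler_normD _ _))// addrA.
  rewrite lerD ?f_bnd// normrM; have /andP[a _] := sigmaS_bnd y01.
  have b := sigmaS_le y01; have o := sigma_osc lM yl (mid_cell lM).
  apply: (@le_trans _ _ (s * sigma y * X)).
    by apply: ler_pM => //; [rewrite ger0_norm|exact: phi_bnd].
  rewrite [leRHS](_ : _ = s * (sigma (mid xs l) + delta) * X); last by ring.
  rewrite ler_wpM2r// ler_wpM2l// addrC -lerBlDr.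
  exact: le_trans (ler_norm _) o.
have H := @node_estimate _ _ xs_part _ _ _ _ m_gt0 msigma sigma_bnd delta_ge0
  (fun j y jM yj => sigma_osc jM yj (mid_cell jM)) _ _ _ _ node_gt0 weight_gt0
  weight_sum C0_ge0 quad _ _ _ mg g_bnd phiE (fun=> 0) _ B0 gB j (ltnW jM).
have v := flux_variation x01 j01 xh.
have E : 2^-1 * \sum_k weight k * (forward_flux xs sigma (node k)^-1 (fun j0 : nat => 0 / sigma (mid xs j0)) j +
  backward_flux xs sigma (node k)^-1 (fun j0 : nat => 0 / sigma (mid xs j0)) j) = 0.
  rewrite big1 ?mulr0// => k _; rewrite /forward_flux /backward_flux !big1 ?addr0 ?mulr0//.
    by move=> i _; rewrite !mul0r.
  by move=> i _; rewrite !mul0r.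
rewrite E subr0 in H.
rewrite -(subrK (phi (pt xs j)) (phi x)) (le_trans (ler_normD _ _))// -addrA.
by apply: lerD => //; rewrite -addrA.
Qed.

Let v := nodal_flux weight psi.
Definition node_error : R := \big[Num.max/0]_(i < M.+1) `|phi (pt xs i) - v i|.
Notation E := node_error.

Let E_ge0 : 0 <= E.
Proof. by rewrite /E; elim/big_rec: _ => // i x _ x0; rewrite le_max x0 orbT. Qed.

Let le_E i : (i <= M)%N -> `|phi (pt xs i) - v i| <= E.
Proof. by move=> iM; rewrite /E (bigD1 (Ordinal (iM : (i < M.+1)%N)))//= le_max lexx. Qed.

Let flux_node j x : (j < M)%N -> pt xs j <= x <= pt xs j.+1 ->
  `|phi x - v j| <= omega + E /\ `|phi x - v j.+1| <= omega + E.
Proof.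
move=> jM xj; have [h1 h2] := near_node jM xj.
have j01 := pt01 xs_part (ltnW jM); have j101 := pt01 xs_part jM.
have x01 : 0 <= x <= 1.
  case/andP: xj => a b; case/andP: j01 => c _; case/andP: j101 => _ d.
  by rewrite (le_trans c a) (le_trans b d).
have v1 := flux_variation x01 j01 h1; have v2 := flux_variation x01 j101 h2.
have e1 := le_E (ltnW jM); have e2 := le_E jM; split.
  rewrite -(subrK (phi (pt xs j)) (phi x)) -addrA (le_trans (ler_normD _ _))//.
  exact: lerD.
rewrite -(subrK (phi (pt xs j.+1)) (phi x)) -addrA (le_trans (ler_normD _ _))//.
exact: lerD.
Qed.

Let convex_dist (a b c t e : R) : 0 <= t <= 1 -> `|a - b| <= e -> `|a - c| <= e ->
  `|a - (b + t * (c - b))| <= e.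
Proof.
move=> /andP[t0 t1] hb hc.
have -> : a - (b + t * (c - b)) = (1 - t) * (a - b) + t * (a - c) by ring.
rewrite (le_trans (ler_normD _ _))// !normrM (ger0_norm t0) ger0_norm ?subr_ge0//.
have := ler_wpM2l t0 hc; have := @ler_wpM2l _ (1 - t) _ _ _ hb; rewrite subr_ge0 => /(_ t1).
lra.
Qed.

(** The interpolant is a convex combination of two nodal values, each within [omega + E] of the flux
    at [x]; no derivative is involved. *)
Lemma interpolation_error phihN x : is_pw_linear_interpolant xs v phihN ->
  0 <= x <= 1 -> `|phi x - phihN x| <= omega + E.
Proof.
move=> lin x01; have [j jM xj] := cell_of x01; have [h1 h2] := flux_node jM xj.
have st := step_gt0 xs_part jM.
rewrite (lin j jM x)//; apply: convex_dist => //; case/andP: xj => a b.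
apply/andP; split; first by apply: divr_ge0; [rewrite subr_ge0|exact: ltW].
by rewrite ler_pdivrMr// mul1r /step lerD2r.
Qed.

Let mid_flux_close j y : (j < M)%N -> pt xs j <= y <= pt xs j.+1 ->
  `|phi y - mid_flux weight psi j| <= omega + E.
Proof.
move=> jM yj; have [h1 h2] := flux_node jM yj.
rewrite mid_fluxE -/v.
have -> : (v j + v j.+1) / 2 = v j + 2^-1 * (v j.+1 - v j) by field.
by apply: convex_dist => //; apply/andP; split; lra.
Qed.

(** Exact flux and scheme are both compared with frozen transport of the discrete source. In the
    source difference, [sigmaS (mid xs j)] times the flux error is at most [s * sigma (mid xs j)]
    times [omega + E], which puts the factor [s] in front of [E]; the rest is oscillation of the
    data. *)
Lemma node_error_recursion :
  E <= kappa + (s * (omega + E) + (deltaS * X + deltaf) / m) +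
    2 * ((Gam + SS * E) / m) * S * h * L.
Proof.
have M0 := size_part_gt0 xs_part.
have dS0 : 0 <= deltaS by apply: le_trans (sigmaS_osc M0 (mid_cell M0) (mid_cell M0)).
have df0 : 0 <= deltaf by apply: le_trans (f_osc M0 (mid_cell M0) (mid_cell M0)).
have oE : 0 <= omega + E.
  have := flux_variation z01 z01; rewrite !subrr normr0 => /(_ (ltW (diam_gt0 xs_part))) o0.
  exact: addr_ge0.
have c0 : 0 <= deltaS * X + deltaf by rewrite addr_ge0// mulr_ge0.
have GE0 : 0 <= Gam + SS * E by rewrite addr_ge0// mulr_ge0.
pose src := source xs sigmaS f weight psi.
have B0 : 0 <= s * (omega + E) + (deltaS * X + deltaf) / m.
  by rewrite addr_ge0// mulr_ge0// invr_ge0 ltW.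
have gB l y : (l < M)%N -> in_cell l y ->
    `|g y - src l| <= (s * (omega + E) + (deltaS * X + deltaf) / m) * sigma (mid xs l).
  move=> lM yl; have y01 := cell01 lM yl.
  have yl' : pt xs l <= y <= pt xs l.+1 by case/andP: yl => a b; rewrite !ltW.
  have m01 := cell01 lM (mid_cell lM).
  apply: le_trans (gt0_Bdiv _ lM c0).
  have -> : g y - src l = sigmaS (mid xs l) * (phi y - mid_flux weight psi l) +
      ((sigmaS y - sigmaS (mid xs l)) * phi y + (f y - f (mid xs l))).
    by rewrite /g /src /source; ring.
  have /andP[p0 _] := sigmaS_bnd m01.
  rewrite (le_trans (ler_normD _ _))// lerD//.
    rewrite normrM ger0_norm// [leRHS]mulrAC; apply: ler_pM => //; last exact: mid_flux_close.
    exact: sigmaS_le.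
  rewrite (le_trans (ler_normD _ _))// lerD//; last exact: f_osc (mid_cell lM).
  by rewrite normrM; apply: ler_pM => //; [exact: sigmaS_osc (mid_cell lM)|exact: phi_bnd].
(* The discrete flux is bounded through its own error. This brings the term [SS * E] into the
   recursion, to be absorbed by the smallness assumption. *)
have vb i : (i <= M)%N -> `|v i| <= X + E.
  move=> iM; have e := le_E iM; have p := phi_bnd (pt01 xs_part iM).
  rewrite (_ : v i = phi (pt xs i) - (phi (pt xs i) - v i)); last by ring.
  by rewrite (le_trans (ler_normB _ _))// lerD.
have srcb j : (j < M)%N -> `|src j / sigma (mid xs j)| <= (Gam + SS * E) / m.
  move=> jM; have m01 := cell01 jM (mid_cell jM); have /andP[a _] := sigma_mid jM.
  have sg0 : 0 < sigma (mid xs j) := lt_le_trans m_gt0 a.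
  rewrite normrM normfV (gtr0_norm sg0); apply: ler_pM; rewrite ?invr_ge0 ?(ltW sg0)//; last first.
    by rewrite lef_pV2.
  have /andP[p0 p1] := sigmaS_bnd m01.
  have mb : `|mid_flux weight psi j| <= X + E.
    have b1 := vb _ (ltnW jM); have b2 := vb _ jM.
    rewrite mid_fluxE -/v normrM (@ger0_norm _ 2^-1) ?invr_ge0//.
    have := ler_normD (v j) (v j.+1); lra.
  rewrite /src /source (le_trans (ler_normD _ _))// /Gam addrAC; apply: lerD; last exact: f_bnd.
  by rewrite normrM ger0_norm// -mulrDr; apply: ler_pM.
have sgb j : (j < M)%N -> 0 < sigma (mid xs j) <= S.
  by move=> jM; have /andP[a ->] := sigma_mid jM; rewrite andbT (lt_le_trans m_gt0).
have node_le i : (i <= M)%N -> `|phi (pt xs i) - v i| <=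
    kappa + (s * (omega + E) + (deltaS * X + deltaf) / m) +
    2 * ((Gam + SS * E) / m) * S * h * L.
  move=> iM.
  have H1 := @node_estimate _ _ xs_part _ _ _ _ m_gt0 msigma sigma_bnd delta_ge0
    (fun j y jM yj => sigma_osc jM yj (mid_cell jM)) _ _ _ _ node_gt0 weight_gt0
    weight_sum C0_ge0 quad _ _ _ mg g_bnd phiE src _ B0 gB i iM.
  have H2 := @discrete_flux_error _ _ xs_part _ _ _ S _ _ _ _ node_gt0 weight_gt0 sol
    sgb _ srcb i iM.
  move: H1 H2; set fl := 2^-1 * _ => H1 H2.
  rewrite -(subrK fl (phi _)) -addrA (le_trans (ler_normD _ _))// lerD// distrC//.
rewrite {1}/E; apply: bigmax_le => [|i _]; first by apply: le_trans (node_le 0%N _).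
exact: node_le (ltn_ord i).
Qed.

End error_recursion.

(** * Constants *)

Section constants.
Context {R : realType}.
Implicit Types m S : R.

Lemma over1_ge1 S : 1 <= over1 S. Proof. by rewrite /over1 le_max lexx. Qed.

Lemma over1_ge S : S <= over1 S. Proof. by rewrite /over1 le_max lexx orbT. Qed.

Lemma under1_gt0 m : 0 < m -> 0 < under1 m.
Proof. by move=> m0; rewrite /under1 lt_min m0 ltr01. Qed.

Lemma under1_le m : under1 m <= m. Proof. by rewrite /under1 ge_min lexx. Qed.

Lemma under1_le1 m : under1 m <= 1. Proof. by rewrite /under1 ge_min lexx orbT. Qed.

Section ratio.
Variables m S : R.
Hypothesis m_gt0 : 0 < m.
(** A single number that dominates all the factors S, 1/m, 1/sqrt(m) and S/m of the estimates. *)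
Let r := over1 S / under1 m.
Let u0 := under1_gt0 m_gt0.

Lemma over1_le_ratio : over1 S <= r.
Proof.
rewrite /r ler_pdivlMr// ler_piMr ?under1_le1//.
exact: le_trans ler01 (over1_ge1 S).
Qed.

Lemma ratio_ge1 : 1 <= r. Proof. exact: le_trans (over1_ge1 S) over1_le_ratio. Qed.

Lemma inv_le_ratio : m^-1 <= r.
Proof.
rewrite /r -[leLHS]mul1r; apply: ler_pM; rewrite ?invr_ge0 ?ler01 ?over1_ge1//; first exact: ltW.
by rewrite lef_pV2 ?posrE// under1_le.
Qed.

Lemma div_le_ratio : 0 <= S -> S / m <= r.
Proof.
move=> S0; apply: ler_pM; rewrite ?invr_ge0 ?over1_ge//; first exact: ltW.
by rewrite lef_pV2 ?posrE// under1_le.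
Qed.

Lemma inv_sqrt_le_ratio : (Num.sqrt m)^-1 <= r.
Proof.
have s0 : 0 < Num.sqrt m by rewrite sqrtr_gt0.
have [m1|m1] := leP 1 m.
  apply: le_trans ratio_ge1; rewrite invf_le1//.
  by rewrite -[leLHS]sqrtr1 ler_wsqrtr.
apply: le_trans inv_le_ratio; rewrite lef_pV2 ?posrE//.
rewrite -{1}[m]sqr_sqrtr ?(ltW m_gt0)// expr2 ler_piMl ?(ltW s0)//.
by rewrite -[leRHS]sqrtr1 ler_wsqrtr// ltW.
Qed.

End ratio.

Lemma powR_ge1 (a p : R) : 1 <= a -> 0 <= p -> 1 <= a `^ p.
Proof. by move=> a1 p0; rewrite -[leLHS](powRr0 a) ler_powR. Qed.

Section R_constants.
Variables (sigma sigmaS : R -> R) (rho : R).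
Let m := minval sigma.
Let S := maxval sigma.
Let d := 1 - supnorm `[0, 1] (fun x => sigmaS x / sigma x).
Hypothesis m_gt0 : 0 < m.
Hypothesis mS : m <= S.
Hypothesis d_gt0 : 0 < d.
Hypothesis mS_gt0 : 0 < minval sigmaS.
Hypothesis mSS : minval sigmaS <= maxval sigmaS.
Hypothesis rho1 : 1 <= rho.

Lemma R1_ge : 2 / d <= R1 sigma sigmaS.
Proof.
rewrite /R1 -/m -/S -/d ler_wpM2r ?invr_ge0 ?(ltW d_gt0)// -mulrA ler_peMr//.
apply: mulr_ege1; first by apply: powR_ge1; rewrite ?over1_ge1.
by rewrite ler_pdivlMr// mul1r.
Qed.

Let R1_ge_inv : d^-1 <= R1 sigma sigmaS.
Proof.
apply: le_trans R1_ge; rewrite -[leLHS]mul1r ler_wpM2r ?invr_ge0 ?(ltW d_gt0)//.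
by rewrite ler1n.
Qed.

Lemma albedo_ratio_ge1 : 1 <= maxval sigmaS / minval sigmaS.
Proof. by rewrite ler_pdivlMr// mul1r. Qed.

(** [R4] and [R2] each contain [R1], hence one power of 1/d; [R2] also gives one power of the ratio,
    and two more are explicit. The factors left over are at least 1. *)
Lemma calR_ge (eta : R) cs :
  ratio_mm sigma ^+ 3 * over1 (pw_norm cs eta sigma) * over1 (pw_norm cs eta sigmaS)
    / d ^+ 2 <= calR rho eta cs sigma sigmaS.
Proof.
have d0 : 0 <= d^-1 by rewrite invr_ge0 ltW.
have r1 : 1 <= ratio_mm sigma by apply: ratio_ge1.
have p1 := over1_ge1 (pw_norm cs eta sigma); have p2 := over1_ge1 (pw_norm cs eta sigmaS).
have R4_ge : d^-1 <= R4 rho sigma sigmaS.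
  rewrite /R4 (le_trans R1_ge_inv)// ler_peMl ?(le_trans d0)//.
  have a1 : 1 <= over1 S / m by rewrite ler_pdivlMr// mul1r (le_trans mS)// over1_ge.
  exact: mulr_ege1 (mulr_ege1 (mulr_ege1 rho1 a1) albedo_ratio_ge1) (over1_ge1 _).
have R2_ge : ratio_mm sigma * d^-1 <= R2 sigma sigmaS.
  rewrite /R2; apply: ler_pM => //; first exact: le_trans r1.
  rewrite -[leLHS]mul1r; apply: ler_pM => //; first exact: le_trans r1.
    by apply: powR_ge1; rewrite ?over1_ge1.
  rewrite -[leLHS]powRr1 ?(le_trans ler01 r1)//; apply: ler_powR => //.
  by rewrite ler_pdivlMr// mul1r ler_nat.
have r0 := le_trans ler01 r1.
rewrite /calR.
have -> : ratio_mm sigma ^+ 3 * over1 (pw_norm cs eta sigma) * over1 (pw_norm cs eta sigmaS)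
    / d ^+ 2 = d^-1 * (ratio_mm sigma * d^-1) * ratio_mm sigma ^+ 2 *
     over1 (pw_norm cs eta sigma) * over1 (pw_norm cs eta sigmaS).
  by rewrite -exprVn; ring.
rewrite !ler_wpM2r ?(le_trans ler01 p1) ?(le_trans ler01 p2) ?exprn_ge0//.
apply: ler_pM => //; first by rewrite mulr_ge0.
by rewrite (le_trans R4_ge)// ler_peMl// (le_trans d0).
Qed.

End R_constants.
End constants.

(* The smallness assumption on [w] absorbs the terms in [X] and [E] on the right
   of the last two hypotheses. *)
Lemma absorption (R : realFieldType) (r d P Q e F X E SS im om ka delta deltaS deltaf b c1 : R) :
  let s := 1 - d in let Gam := SS * X + F in
  let u := r * P * e in let w := r ^+ 3 * P * e in
  1 <= r -> 0 < d -> d <= 1 -> 1 <= P -> 1 <= Q -> 0 < e -> 0 <= F -> 0 <= X -> 0 <= E ->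
  1 <= c1 -> 0 <= SS -> SS <= r -> im <= r ->
  0 <= om -> 0 <= ka -> om + ka <= Gam * (c1 * u) -> b <= c1 * u ->
  0 <= delta * im -> delta * im <= u -> deltaS * im <= Q * u -> deltaf * im <= F * u ->
  2 * (c1 + 1) * w <= d ->
  X <= om + ka + (s * X + (s * delta * X + F) * im) ->
  E <= ka + (s * (om + E) + (deltaS * X + deltaf) * im) + b * (Gam + SS * E) ->
  om + E <= (25 * c1 + 10) * (r ^+ 3 * P * Q / d ^+ 2) * e * F.
Proof.
(* In the application [r] is the ratio of the bounds of sigma, [P] and [Q] are the norms of sigma
   and sigmaS cut off below at 1, [e] is the error scale, [F] the norm of f, [im] the inverse of the
   infimum of sigma, and [b] the coefficient of the diamond difference error. *)
move=> s Gam u w r1 d0 d1 P1 Q1 e0 F0 X0 E0 c11 SS0 SSr imr om0 ka0 omka bu dm0 dm dS df small HX HE.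
have r0 : 0 <= r by lra.
have u0 : 0 <= u by rewrite !mulr_ge0// ltW//; lra.
have wE : w = r ^+ 2 * u by rewrite /w /u; ring.
have ru : r * u <= w by rewrite wE ler_wpM2r// expr2 ler_peMl.
have uru : u <= r * u by rewrite ler_peMl.
have Gam0 : 0 <= Gam by rewrite addr_ge0// mulr_ge0.
have c10 : 0 <= c1 by lra.
have w0 : 0 <= w by lra.
have cw0 : 0 <= c1 * w by rewrite mulr_ge0.
have cu_w : c1 * u <= c1 * w by rewrite ler_wpM2l//; lra.
have SScu : SS * (c1 * u) <= c1 * w.
  by rewrite mulrCA ler_wpM2l// (le_trans _ ru)// ler_wpM2r.
(* Moving [s * X] to the left leaves [d * X]; the small terms in [X] take at most half of it. *)
have HXd : X * d <= 4 * r * F.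
  have t1 : X * (SS * (c1 * u)) <= X * (c1 * w) by rewrite ler_wpM2l.
  have t2 : F * (c1 * u) <= F * (c1 * w) by rewrite ler_wpM2l.
  have t3 : X * (s * (delta * im)) <= X * w.
    rewrite ler_wpM2l// (le_trans (_ : _ <= delta * im))//; last by lra.
    by rewrite ler_piMl// /s; lra.
  have t4 : F * im <= F * r by rewrite ler_wpM2l.
  have t5 : X * (2 * (c1 + 1) * w) <= X * d by rewrite ler_wpM2l.
  have t6 : F * (2 * (c1 + 1) * w) <= F * 1 by rewrite ler_wpM2l//; lra.
  have t7 : F * 1 <= F * r by rewrite ler_wpM2l.
  have t8 : 0 <= F * w by rewrite mulr_ge0.
  have eq1 : Gam * (c1 * u) = X * (SS * (c1 * u)) + F * (c1 * u) by rewrite /Gam; ring.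
  have eq2 : s * X + (s * delta * X + F) * im = X - X * d + X * (s * (delta * im)) + F * im.
    by rewrite /s; ring.
  have eq3 : X * (2 * (c1 + 1) * w) = 2 * (X * (c1 * w)) + 2 * (X * w) by ring.
  have eq4 : F * (2 * (c1 + 1) * w) = 2 * (F * (c1 * w)) + 2 * (F * w) by ring.
  have eq5 : 4 * r * F = 4 * (F * r) by ring.
  lra.
have HGd : Gam * d <= 5 * (r ^+ 2 * F).
  have t1 : SS * (X * d) <= r * (4 * r * F) by apply: ler_pM => //; rewrite mulr_ge0// ltW.
  have t2 : F * d <= 1 * (r ^+ 2 * F).
    by rewrite mul1r mulrC ler_wpM2r// (le_trans d1)// exprn_ege1.
  have eq1 : Gam * d = SS * (X * d) + F * d by rewrite /Gam; ring.
  have eq2 : r * (4 * r * F) = 4 * (r ^+ 2 * F) by ring.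
  lra.
have HGu : Gam * d * (c1 * u) <= 5 * c1 * (w * F).
  have -> : 5 * c1 * (w * F) = 5 * (r ^+ 2 * F) * (c1 * u) by rewrite wE; ring.
  by rewrite ler_wpM2r// mulr_ge0.
have HEd : E * d <= 4 * (Gam * (c1 * u)) + 2 * (X * (Q * u)) + 2 * (F * u).
  have t1 : s * om <= om by rewrite ler_piMl// /s; lra.
  have t2 : b * Gam <= c1 * u * Gam by rewrite ler_wpM2r.
  have t3 : b * (SS * E) <= c1 * u * (SS * E) by rewrite ler_wpM2r// mulr_ge0.
  have t4 : SS * (c1 * u) * E <= c1 * w * E by rewrite ler_wpM2r.
  have t5 : E * (2 * (c1 + 1) * w) <= E * d by rewrite ler_wpM2l.
  have t6 : X * (deltaS * im) <= X * (Q * u) by rewrite ler_wpM2l.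
  have t8 : 0 <= E * w by rewrite mulr_ge0.
  have eq1 : s * (om + E) + (deltaS * X + deltaf) * im =
    s * om + E - E * d + X * (deltaS * im) + deltaf * im by rewrite /s; ring.
  have eq2 : b * (Gam + SS * E) = b * Gam + b * (SS * E) by ring.
  have eq3 : c1 * u * (SS * E) = SS * (c1 * u) * E by ring.
  have eq4 : E * (2 * (c1 + 1) * w) = 2 * (c1 * w * E) + 2 * (E * w) by ring.
  have eq5 : c1 * u * Gam = Gam * (c1 * u) by ring.
  lra.
have wF0 : 0 <= w * F by rewrite mulr_ge0.
have wFQ : w * F <= w * F * Q by rewrite ler_peMr.
have cwFQ : c1 * (w * F) <= c1 * (w * F * Q) by rewrite ler_wpM2l.
(* The second factor [d] pays for the bounds of [X] and [Gam], which are themselves of order 1/d. *)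
have HEdd : E * d ^+ 2 <= (20 * c1 + 10) * (w * F * Q).
  have t1 : E * d * d <= (4 * (Gam * (c1 * u)) + 2 * (X * (Q * u)) + 2 * (F * u)) * d.
    by rewrite ler_wpM2r// ltW.
  have t2 : X * d * (Q * u) <= 4 * r * F * (Q * u) by rewrite ler_wpM2r// mulr_ge0//; lra.
  have t3 : (r * u) * (F * Q) <= w * (F * Q) by rewrite ler_wpM2r// mulr_ge0//; lra.
  have t4 : F * u * d <= F * u * 1 by rewrite ler_wpM2l// mulr_ge0.
  have t5 : F * u <= F * w by rewrite ler_wpM2l//; lra.
  have eq1 : (4 * (Gam * (c1 * u)) + 2 * (X * (Q * u)) + 2 * (F * u)) * d =
    4 * (Gam * d * (c1 * u)) + 2 * (X * d * (Q * u)) + 2 * (F * u * d) by ring.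
  have eq2 : 4 * r * F * (Q * u) = 4 * ((r * u) * (F * Q)) by ring.
  have eq3 : w * (F * Q) = w * F * Q by ring.
  have eq4 : E * d ^+ 2 = E * d * d by ring.
  have eq5 : (20 * c1 + 10) * (w * F * Q) = 20 * (c1 * (w * F * Q)) + 10 * (w * F * Q) by ring.
  have eq6 : F * w = w * F by ring.
  have eq7 : 5 * c1 * (w * F) = 5 * (c1 * (w * F)) by ring.
  lra.
have Hom : om * d ^+ 2 <= 5 * (c1 * (w * F * Q)).
  have t1 : om * d <= Gam * (c1 * u) * d by rewrite ler_wpM2r ?(ltW d0)//; lra.
  have t2 : om * d * d <= om * d * 1 by rewrite ler_wpM2l// mulr_ge0// ltW.
  have eq1 : Gam * (c1 * u) * d = Gam * d * (c1 * u) by ring.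
  have eq2 : om * d ^+ 2 = om * d * d by ring.
  have eq7 : 5 * c1 * (w * F) = 5 * (c1 * (w * F)) by ring.
  lra.
have -> : (25 * c1 + 10) * (r ^+ 3 * P * Q / d ^+ 2) * e * F =
    (25 * c1 + 10) * (w * F * Q) / d ^+ 2 by rewrite /w; ring.
rewrite ler_pdivlMr ?exprn_gt0// mulrDl.
have eq5 : (25 * c1 + 10) * (w * F * Q) = 5 * (c1 * (w * F * Q)) + (20 * c1 + 10) * (w * F * Q) by ring.
lra.
Qed.

(** * Choice of the constants and assembly of the error estimate *)

Lemma gauss_legendre_estimates (R : realType) : exists c0 cL : R, 0 < c0 /\ 0 < cL /\
  forall (N : nat) (node weight : 'I_N -> R), (2 <= N)%N -> gauss_legendre node weight ->
  [/\ forall k, 0 < node k, forall k, 0 < weight k, \sum_k weight k = 1,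
      \sum_k weight k / node k <= cL * ln N%:R
    & forall z, 0 < z ->
        `|E1 z - quad_kernel node weight z| <= c0 / N%:R / Num.sqrt z].
Proof.
have [A A0 AE] : exists2 A : R, 0 < A & A = 1320%:R * pi.
  exists (1320%:R * pi); last exact: erefl.
  by rewrite pmulr_rgt0 ?pi_gt0 ?ltr0n.
(* 12 A pi / N is 4 B pi for the discrepancy constant B = 3 A / N. *)
exists (12 * A * pi), ((8 + 24 * A) / ln 2); split; first by rewrite !mulr_gt0 ?pi_gt0.
have ln2 : 0 < ln 2 :> R by rewrite ln_gt0// ltr1n.
split; first by rewrite divr_gt0// addr_gt0// mulr_gt0.
move=> N node weight N2 gl; have N0 : (0 < N)%N by apply: leq_trans N2.
have [inj _ _] := gl; have ex := gauss_legendre_exact gl.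
have wle k : weight k <= A * Num.sqrt (node k) / N%:R.
  by rewrite AE; exact: gauss_legendre_weight_le.
split.
- by move=> k; have /andP[] := node_in01 inj ex k.
- exact: weight_gt0 inj ex.
- exact: sum_weight ex N0.
- exact: gauss_sum_inv_le.
have B0 : 0 <= 3 * A / N%:R by rewrite divr_ge0// mulr_ge0// ltW.
move=> z z0; have := @E1_quadrature _ _ _ _ inj ex N0 (3 * A / N%:R) B0 _ z z0.
have -> : 4 * (3 * A / N%:R) * pi = 12 * A * pi / N%:R by ring.
apply=> x x01; have := gauss_discrepancy gl N0 A0 wle x01.
by rewrite [3 * A / N%:R * _]mulrAC.
Qed.

Lemma small_scaled (R : realFieldType) (a d e : R) : 0 < d -> 0 < e ->
  a * (2 / d) <= e^-1 -> 2 * a * e <= d.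
Proof.
move=> d0 e0; rewrite -(ler_pM2r e0) mulVf ?gt_eqF// => h.
have -> : 2 * a * e = a * (2 / d) * e * d by field; rewrite gt_eqF.
by rewrite -[leRHS]mul1r ler_pM2r.
Qed.

Section estimates_from_parameters.
Context {R : realType}.
Variables (c0 cL P Pw e h lnN Ninv he m S r L : R).
Hypotheses (c0_gt0 : 0 < c0) (cL_gt0 : 0 < cL) (P1 : 1 <= P) (PwP : 0 <= Pw <= P).
Hypotheses (h_gt0 : 0 < h) (lnN_ge0 : 0 <= lnN) (Ninv_ge0 : 0 <= Ninv) (he_ge0 : 0 <= he).
Hypothesis eE : e = Ninv + h * lnN + he.
Hypotheses (m_gt0 : 0 < m) (S_gt0 : 0 < S) (r1 : 1 <= r).
Hypotheses (rm : m^-1 <= r) (rs : (Num.sqrt m)^-1 <= r) (rS : S / m <= r).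
Hypotheses (L_ge0 : 0 <= L) (LE : L <= cL * lnN).
Let u := r * P * e.
Let c1 := 12 * c0 + 2 * cL + 1.

Let hl_ge0 : 0 <= h * lnN. Proof. by rewrite mulr_ge0// ltW. Qed.
Let e_ge0 : 0 <= e. Proof. by rewrite eE !addr_ge0. Qed.
Let r_ge0 : 0 <= r. Proof. exact: le_trans ler01 r1. Qed.
Let hl_le : h * lnN <= e. Proof. by rewrite eE addrAC lerDr addr_ge0. Qed.
Let he_le : he <= e. Proof. by rewrite eE lerDr addr_ge0. Qed.
Let Ninv_le : Ninv <= e. Proof. by rewrite eE -addrA lerDl addr_ge0. Qed.

Let re_le : r * e <= u.
Proof. by rewrite /u mulrAC ler_peMr// mulr_ge0. Qed.

Let le_re (x y : R) : 0 <= x -> x <= e -> y <= r -> x * y <= u.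
Proof.
move=> x0 xe yr; apply: le_trans re_le; rewrite [leRHS]mulrC.
by apply: (@le_trans _ _ (x * r)); [rewrite ler_wpM2l|rewrite ler_wpM2r].
Qed.

Lemma holder_part_le (q : R) : 0 <= q -> q * he * m^-1 <= q * u.
Proof. by move=> q0; rewrite -mulrA ler_wpM2l// le_re. Qed.

Lemma oscillation_part_le : Pw * he * m^-1 <= u.
Proof.
have /andP[p0 pP] := PwP; rewrite /u -mulrA.
apply: (@le_trans _ _ (P * (r * e))); last by rewrite mulrA [P * r]mulrC.
apply: ler_pM => //; first by rewrite mulr_ge0// invr_ge0 ltW.
by rewrite mulrC; apply: ler_pM => //; rewrite invr_ge0 ltW.
Qed.

Lemma transport_part_le : 2 * (S / m) * h * L <= 2 * cL * u.
Proof.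
have Sm : 0 <= S / m by rewrite divr_ge0// ltW.
have -> : 2 * (S / m) * h * L = 2 * (S / m * (h * L)) by ring.
rewrite -[leRHS]mulrA ler_wpM2l//; apply: (@le_trans _ _ (cL * (h * lnN * (S / m)))).
  by rewrite mulrC mulrA ler_wpM2r// mulrCA ler_wpM2l// ltW.
by rewrite ler_wpM2l ?(ltW cL_gt0)// le_re.
Qed.

Lemma quadrature_part_le (k : R) : 0 <= k ->
  k * (c0 * Ninv) / Num.sqrt m <= k * c0 * u.
Proof.
move=> k0; have -> : k * (c0 * Ninv) / Num.sqrt m = k * c0 * (Ninv * (Num.sqrt m)^-1) by ring.
by rewrite ler_wpM2l ?mulr_ge0 ?(ltW c0_gt0)// le_re.
Qed.

Lemma source_factor_le :
  (8 * (c0 * Ninv) / Num.sqrt m + 2 * (S / m) * h * L) +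
  (Pw * he / m + 4 * (c0 * Ninv) / Num.sqrt m) <= c1 * u.
Proof.
have -> : c1 * u = 8 * c0 * u + 2 * cL * u + (u + 4 * c0 * u) by rewrite /c1; ring.
apply: lerD; apply: lerD; [exact: quadrature_part_le|exact: transport_part_le| |].
  exact: oscillation_part_le.
exact: quadrature_part_le.
Qed.

End estimates_from_parameters.

Theorem theorem4p12 (R : realType) (eta : R) (eta_gt0 : 0 < eta)
    (eta_lt1 : eta < 1) :
  exists c : R, 0 < c /\
  forall rho : R, 1 <= rho ->
  exists K : R, 0 < K /\
  forall (cs : seq R) (sigmaS sigmaA f : R -> R) (xs : seq R) (N : nat)
      (node weight : 'I_N -> R) (phi : R -> R)
      (psi : bool * 'I_N -> nat -> R) (phihN : R -> R),
  let sigma := fun x => sigmaS x + sigmaA x in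
  let h := diam xs in
  let err := N%:R^-1 + h * ln N%:R + h `^ eta in
  itv_partition 0 1 cs ->
  bounded_positive sigmaS -> bounded_positive sigmaA ->
  in_pw cs eta sigma -> in_pw cs eta sigmaS -> in_pw cs eta f ->
  is_scalar_flux sigma sigmaS f phi ->
  itv_partition 0 1 xs -> {subset cs <= xs} -> quasi_uniform rho xs ->
  (2 <= N)%N -> gauss_legendre node weight ->
  discrete_solution node weight xs sigma sigmaS f psi ->
  is_pw_linear_interpolant xs (nodal_flux weight psi) phihN ->
  h * ln N%:R <= 1 ->
  K * (maxval sigmaS / minval sigmaS) * ratio_mm sigma ^+ 3
    * over1 (pw_norm cs eta sigma) * R1 sigma sigmaS <= err^-1 ->
  supnorm `[0, 1] (fun x => phi x - phihN x)
    <= c * calR rho eta cs sigma sigmaS * err * pw_norm cs eta f.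
Proof.
have [c0 [cL [c0_gt0 [cL_gt0 gauss]]]] := gauss_legendre_estimates R.
pose c1 : R := 12 * c0 + 2 * cL + 1.
have c1_ge1 : 1 <= c1 by rewrite /c1; lra.
exists (25 * c1 + 10); split; first by lra.
(* The absorption needs 2 (c1 + 1) r^3 P err <= 1 - s; the factor 2 is supplied by [R1_ge], which
   bounds [R1] below by 2 / (1 - s). *)
move=> rho rho1; exists (c1 + 1); split; first by lra.
move=> cs sigmaS sigmaA f xs N node weight phi psi phihN sigma h err cs_part posS posA
  pw_sigma pw_sigmaS pw_f [mphi bphi phiE] xs_part cs_xs _ N2 gl sol lin _ small.
have [node_gt0 weight_gt0 weight_sum L_le quad] := gauss N node weight N2 gl.
have [bS mS_gt0] := posS.
have bsigma : [bounded sigma x | x in `[0, 1]] by exact: bounded_sum.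
pose m := minval sigma; pose S := maxval sigma; pose SS := maxval sigmaS.
have m_gt0 : 0 < m := minval_sum_gt0 posS posA.
have mS : m <= S := maxval_ge_minval bsigma.
have mSS : minval sigmaS <= SS := maxval_ge_minval bS.
pose s := supnorm `[0, 1] (fun x => sigmaS x / sigma x).
have s_lt1 : s < 1 := albedo_lt1 posS posA.
have s_gt0 : 0 < s := albedo_gt0 posS posA.
have sigma_bnd x : 0 <= x <= 1 -> m <= sigma x <= S by exact: minval_maxval.
have sigmaS_bnd x : 0 <= x <= 1 -> 0 <= sigmaS x <= SS.
  by move=> /(minval_maxval bS)/andP[a ->]; rewrite (le_trans (ltW mS_gt0) a).
have sigmaS_le x : 0 <= x <= 1 -> sigmaS x <= s * sigma x by exact: albedo_bnd.
have msigma := pw_measurable eta_gt0 cs_part pw_sigma.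
have msigmaS := pw_measurable eta_gt0 cs_part pw_sigmaS.
have mf := pw_measurable eta_gt0 cs_part pw_f.
have f_bnd x : 0 <= x <= 1 -> `|f x| <= pw_norm cs eta f by exact: pw_bnd.
pose X := supnorm `[0, 1] phi.
have phi_bnd x : 0 <= x <= 1 -> `|phi x| <= X.
  by move=> x01; apply: le_supnorm => //; rewrite /= in_itv.
have phiE' x : 0 <= x <= 1 -> phi x = 2^-1 * \int[lebesgue_measure]_(y in `[0, 1])
    (E1 `|tau sigma x y| * (sigmaS y * phi y + f y)).
  by move=> x01; rewrite phiE// in_itv.
have osc g (pw : in_pw cs eta g) := pw_mesh_osc eta_gt0 cs_part pw xs_part cs_xs.
have h_gt0 : 0 < h := diam_gt0 xs_part.
have C0_ge0 : 0 <= c0 / N%:R by rewrite divr_ge0// ltW.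
have s01 : 0 <= s <= 1 by rewrite !ltW.
have HX := flux_bound xs_part m_gt0 msigma sigma_bnd msigmaS sigmaS_bnd s01 sigmaS_le mf
  f_bnd mphi phi_bnd phiE' (osc _ pw_sigma) node_gt0 weight_gt0 weight_sum C0_ge0 quad.
have HE := node_error_recursion xs_part m_gt0 msigma sigma_bnd msigmaS sigmaS_bnd s01
  sigmaS_le mf f_bnd mphi phi_bnd phiE' (osc _ pw_sigma) (osc _ pw_sigmaS) (osc _ pw_f)
  node_gt0 weight_gt0 weight_sum C0_ge0 quad sol.
have Herr x := interpolation_error xs_part m_gt0 msigma sigma_bnd msigmaS sigmaS_bnd mf
  f_bnd mphi phi_bnd phiE' node_gt0 weight_gt0 C0_ge0 quad lin (x := x).
have I0 : (`[0, 1] : set R) !=set0 by exists 0; rewrite /= in_itv/= lexx ler01.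
pose F := pw_norm cs eta f; pose L := \sum_k weight k / node k.
pose delta := pw_norm cs eta sigma * h `^ eta.
pose om := (SS * X + F) * (8 * (c0 / N%:R) / Num.sqrt m + 2 * (S / m) * h * L).
pose ka := (SS * X + F) * (delta / m + 4 * (c0 / N%:R) / Num.sqrt m).
pose E := node_error xs phi weight psi.
have HX' : X <= om + ka + (s * X + (s * delta * X + F) / m).
  by apply: supnorm_le => // x; rewrite /= in_itv/=; exact: HX.
apply: (@le_trans _ _ (om + E)).
  by apply: supnorm_le => // x; rewrite /= in_itv/=; exact: Herr.
have S_gt0 : 0 < S := lt_le_trans m_gt0 mS.
have r1 : 1 <= ratio_mm sigma := ratio_ge1 S m_gt0.
have P1 := over1_ge1 (pw_norm cs eta sigma); have Q1 := over1_ge1 (pw_norm cs eta sigmaS).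
have z01 : 0 <= (0 : R) <= 1 by rewrite lexx ler01.
have F_ge0 : 0 <= F := pw_norm_ge0 cs eta f.
have X_ge0 : 0 <= X := le_trans (normr_ge0 _) (phi_bnd 0 z01).
have SS_ge0 : 0 <= SS := le_trans (ltW mS_gt0) mSS.
have Gam_ge0 : 0 <= SS * X + F by rewrite addr_ge0// mulr_ge0.
have L_ge0 : 0 <= L by apply: sumr_ge0 => k _; rewrite divr_ge0// ltW.
have N_gt0 : 0 < N%:R :> R by rewrite ltr0n (leq_trans _ N2).
have lnN : 0 <= ln N%:R :> R by rewrite ln_ge0// ler1n (leq_trans _ N2).
have he_ge0 : 0 <= h `^ eta := powR_ge0 _ _.
have err_gt0 : 0 < err.
  by rewrite /err addrAC ltr_wpDr ?mulr_ge0 ?(ltW h_gt0)// ltr_pwDl ?invr_gt0.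
have Pw01 : 0 <= pw_norm cs eta sigma <= over1 (pw_norm cs eta sigma).
  by rewrite pw_norm_ge0 over1_ge.
have sqrt_ge0 : 0 <= (Num.sqrt m)^-1 by rewrite invr_ge0 sqrtr_ge0.
have im_ge0 : 0 <= m^-1 by rewrite invr_ge0 ltW.
(* Since sigmaS <= s sigma with s < 1, the supremum of sigmaS is controlled by that of sigma. *)
have SS_le : SS <= ratio_mm sigma.
  apply: le_trans (over1_le_ratio S m_gt0); apply: le_trans (over1_ge S).
  apply: ge_sup; first by case: I0 => x Ix; exists (sigmaS x), x.
  move=> _ [x /= + <-]; rewrite in_itv/= => x01; rewrite (le_trans (sigmaS_le x x01))//.
  have /andP[a b] := sigma_bnd x x01; rewrite (le_trans _ b)// ler_piMl ?(ltW s_lt1)//.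
  exact: le_trans (ltW m_gt0) a.
have N_ge0 : 0 <= (N%:R)^-1 :> R by rewrite invr_ge0.
have im_r := inv_le_ratio S m_gt0; have is_r := inv_sqrt_le_ratio S m_gt0.
have Sm_r := div_le_ratio m_gt0 (ltW S_gt0).
have d_gt0 : 0 < 1 - s by rewrite subr_gt0.
apply: (@le_trans _ _ ((25 * c1 + 10) * (ratio_mm sigma ^+ 3 * over1 (pw_norm cs eta sigma) *
    over1 (pw_norm cs eta sigmaS) / (1 - s) ^+ 2) * err * F)); last first.
  rewrite ler_wpM2r// ler_wpM2r ?(ltW err_gt0)// ler_wpM2l//; first by lra.
  exact: calR_ge.
have source_le : (8 * (c0 / N%:R) / Num.sqrt m + 2 * (S / m) * h * L) +
    (delta / m + 4 * (c0 / N%:R) / Num.sqrt m) <=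
    c1 * (ratio_mm sigma * over1 (pw_norm cs eta sigma) * err).
  exact: (source_factor_le c0_gt0 cL_gt0 P1 Pw01 h_gt0 lnN).
have transport_le : 2 * (S / m) * h * L <=
    c1 * (ratio_mm sigma * over1 (pw_norm cs eta sigma) * err).
  apply: le_trans source_le; rewrite -addrA addrCA lerDl.
  by rewrite !addr_ge0 ?mulr_ge0 ?(ltW c0_gt0)//; case/andP: Pw01.
apply: (absorption (im := m^-1) (SS := SS) (X := X) (ka := ka) (delta := delta)
  (deltaS := pw_norm cs eta sigmaS * h `^ eta) (deltaf := F * h `^ eta)
  (b := 2 * (S / m) * h * L)) => //.
- by rewrite lerBlDr lerDl ltW.
- by rewrite /E /node_error; elim/big_rec: _ => // i x _ x0; rewrite le_max x0 orbT.
- rewrite mulr_ge0// addr_ge0 ?mulr_ge0 ?(ltW c0_gt0) ?(ltW S_gt0) ?(ltW h_gt0)//.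
- rewrite mulr_ge0// addr_ge0 ?mulr_ge0 ?(ltW c0_gt0)//; by case/andP: Pw01.
- by rewrite /om /ka -mulrDr ler_wpM2l.
- by rewrite !mulr_ge0//; case/andP: Pw01.
- by apply: (oscillation_part_le (P := over1 (pw_norm cs eta sigma)) (lnN := ln N%:R)
    (Ninv := N%:R^-1) (h := h)).
- apply: (@le_trans _ _ (over1 (pw_norm cs eta sigmaS) * h `^ eta / m)).
    by rewrite ler_wpM2r// ler_wpM2r// over1_ge.
  apply: (holder_part_le P1 h_gt0 lnN N_ge0 he_ge0) => //; exact: le_trans ler01 Q1.
- exact: (holder_part_le P1 h_gt0 lnN N_ge0 he_ge0).
- have c1_ge0 : 0 <= c1 + 1 by lra.
  have r_ge0 := le_trans ler01 r1.
  have a0 : 0 <= (c1 + 1) * ratio_mm sigma ^+ 3 * over1 (pw_norm cs eta sigma).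
    exact: mulr_ge0 (mulr_ge0 c1_ge0 (exprn_ge0 3 r_ge0)) (le_trans ler01 P1).
  have : (c1 + 1) * ratio_mm sigma ^+ 3 * over1 (pw_norm cs eta sigma) * (2 / (1 - s)) <= err^-1.
    apply: le_trans small; apply: ler_pM; [exact: a0| | |exact: R1_ge].
      by rewrite divr_ge0// ltW.
    rewrite ler_wpM2r ?(le_trans ler01 P1)// ler_wpM2r ?exprn_ge0//.
    exact: ler_peMr c1_ge0 (albedo_ratio_ge1 mS_gt0 mSS).
  by move=> /(small_scaled d_gt0 err_gt0); rewrite !mulrA.
- by rewrite subKr.
- apply: le_trans HE _; rewrite subKr le_eqVlt; apply/orP; left; apply/eqP.
  congr (_ + _).
  have reorder (a b c d e : R) : 2 * (a * b) * c * d * e = 2 * (c * b) * d * e * a by ring.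
  exact: reorder.
Qed.
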